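(* Let $\rho:\pi_1^{\mathrm{orb}}(T^8/\Gamma)\to SO(5)$ be a representation with $\rho(\alpha)=\rho(\beta)=1$ and such that $\rho(\gamma)$ and $\rho(\delta)$ commute, with at least one of them non-trivial. If the image of $\{\tau_i\}_{i=1,\dots,8}$ (the subgroup of $SO(5)$ generated by the commuting involutions $\rho(\tau_i)$) is a $\mathbb Z_2\times\mathbb Z_2\times\mathbb Z_2$ subgroup acting trivially on a 1-dimensional subspace of $\mathbb R^5$, then $\rho$ is valid for the construction, i.e. the associated flat connection is irreducible, infinitesimally rigid and unobstructed.
   Context: $\pi_1^{\mathrm{orb}}(T^8/\Gamma)$ is the group of affine isometries of $\mathbb R^8$ generated by $\alpha:(x_1,\dots,x_8)\mapsto(-x_1,-x_2,-x_3,-x_4,x_5,x_6,x_7,x_8)$, $\beta:\ \mapsto(x_1,x_2,x_3,x_4,-x_5,-x_6,-x_7,-x_8)$, $\gamma:\ \mapsto(\frac12-x_1,\frac12-x_2,x_3,x_4,\frac12-x_5,\frac12-x_6,x_7,x_8)$, $\delta:\ \mapsto(-x_1,x_2,\frac12-x_3,x_4,\frac12-x_5,x_6,\frac12-x_7,x_8)$, and the unit translations $\tau_i:x_i\mapsto x_i+1$ ($i=1,\dots,8$). $\Gamma$ is the group generated by $\alpha,\beta,\gamma,\delta$ acting on $T^8=\mathbb R^8/\mathbb Z^8$. The flat $Spin(7)$-structure on $T^8/\Gamma$ is (with $dx_{ijkl}=dx_i\wedge dx_j\wedge dx_k\wedge dx_l$) $\Omega_0=dx_{1234}+dx_{1256}+dx_{1278}+dx_{1357}-dx_{1368}-dx_{1458}-dx_{1467}-dx_{2358}-dx_{2367}-dx_{2457}+dx_{2468}+dx_{3456}+dx_{3478}+dx_{5678}$;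 $\Lambda^2_7$ is the rank 7 eigenspace of $\omega\mapsto*(\Omega_0\wedge\omega)$ on 2-forms with eigenvalue $3$, and $\pi^2_7$ the orthogonal projection onto it. A homomorphism $\rho$ to $G$ determines an orbifold $G$-bundle $E_0=(\mathbb R^8\times G)/\pi_1^{\mathrm{orb}}(T^8/\Gamma)$ over $T^8/\Gamma$ with flat connection $\theta$, the flat connection associated with $\rho$. Let $\mathcal H^i_\theta$ be the cohomology of $0\to\Gamma(\mathrm{Ad}E_0)\xrightarrow{d_\theta}\Gamma(\Lambda^1\otimes\mathrm{Ad}E_0)\xrightarrow{\pi^2_7d_\theta}\Gamma(\Lambda^2_7\otimes\mathrm{Ad}E_0)\to0$ (sections on the orbifold are the equivariant ones upstairs). $\theta$ is irreducible if $\mathcal H^0_\theta=0$, infinitesimally rigid if $\mathcal H^1_\theta=0$, unobstructed if $\mathcal H^2_\theta=0$. *)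

(* Defs.v *)
From HB Require Import structures.
From mathcomp Require Import all_boot all_order all_algebra.
From mathcomp Require Import all_classical all_reals all_analysis.

Set Implicit Arguments.
Unset Strict Implicit.
Unset Printing Implicit Defensive.

Import Order.TTheory GRing.Theory Num.Theory.
Import numFieldNormedType.Exports.

Local Open Scope classical_set_scope.
Local Open Scope ring_scope.

(* [H] is a group for the associative law [op] with unit [e]. *)
Definition is_subgroup (T : Type) (op : T -> T -> T) (e : T) (H : set T) :=
  [/\ H e,
      forall x y, H x -> H y -> H (op x y) &
      forall x, H x -> exists y, [/\ H y, op x y = e & op y x = e]].

Definition gen_subgroup (T : Type) (op : T -> T -> T) (e : T) (S : set T) :
    set T :=
  smallest (is_subgroup op e) S.

Section ExteriorAlgebra.
Variables (R : realType) (n : nat).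

(* V-valued exterior forms on R^n: [w S] is the coefficient of
   dx_{i_1} /\ ... /\ dx_{i_k} where S = {i_1 < ... < i_k}. *)
Definition form (V : lmodType R) : Type := {ffun {set 'I_n} -> V}.

HB.instance Definition _ (V : lmodType R) := GRing.Lmodule.on (form V).

Definition homogeneous (V : lmodType R) (k : nat) (w : form V) :=
  forall S : {set 'I_n}, #|S| != k -> w S = 0.

(* dx_S /\ dx_T = shuffle_sign S T dx_(S u T) for disjoint S and T. *)
Definition shuffle_sign (S T : {set 'I_n}) : R :=
  (-1) ^+ #|[set p : 'I_n * 'I_n | [&& p.1 \in S, p.2 \in T & (p.2 < p.1)%N]]%SET|.

Definition wedge (V : lmodType R) (a : form R^o) (w : form V) : form V :=
  [ffun U : {set 'I_n} => \sum_(S : {set 'I_n} | S \subset U)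
     (shuffle_sign S (U :\: S) * a S) *: w (U :\: S)].

Definition form1 : form R^o := [ffun S : {set 'I_n} => (S == finset.set0)%:R].

Definition dx (i : 'I_n) : form R^o :=
  [ffun S : {set 'I_n} => (S == [set i]%SET)%:R].

(* The Euclidean Hodge star: dx_T |-> shuffle_sign T (~: T) dx_(~: T). *)
Definition hodge (V : lmodType R) (w : form V) : form V :=
  [ffun S : {set 'I_n} => shuffle_sign (~: S) S *: w (~: S)%SET].

(* Contraction of a real form with a V-valued one, extending the Euclidean
   inner product, for which the dx_S are orthonormal. *)
Definition contract (V : lmodType R) (a : form R^o) (w : form V) : V :=
  \sum_(S : {set 'I_n}) a S *: w S.

End ExteriorAlgebra.

Section Spin7.
Variable R : realType.

(* Indices i, j, k, l run over 1, ..., 8. *)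
Definition dx4 (i j k l : nat) : form 8 R^o :=
  let e m := dx R (inord m.-1 : 'I_8) in
  wedge (e i) (wedge (e j) (wedge (e k) (e l))).

Definition Omega0 : form 8 R^o :=
  dx4 1 2 3 4 + dx4 1 2 5 6 + dx4 1 2 7 8 + dx4 1 3 5 7 - dx4 1 3 6 8
  - dx4 1 4 5 8 - dx4 1 4 6 7 - dx4 2 3 5 8 - dx4 2 3 6 7 - dx4 2 4 5 7
  + dx4 2 4 6 8 + dx4 3 4 5 6 + dx4 3 4 7 8 + dx4 5 6 7 8.

(* Lambda^2_7 (x) V. *)
Definition Lambda27 (V : lmodType R) : set (form 8 V) :=
  [set w | homogeneous 2 w /\ hodge (wedge Omega0 w) = 3 *: w].

Arguments Lambda27 V : clear implicits.

Definition is_proj27 (V : lmodType R) (w p : form 8 V) :=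
  Lambda27 V p /\ forall eta, Lambda27 R^o eta -> contract eta (w - p) = 0.

Definition pi27 (V : lmodType R) (w : form 8 V) : form 8 V :=
  xget 0 (is_proj27 w).

End Spin7.

Arguments Lambda27 {R} V.

(* The orthogonal projection exists and is unique, so that the default value of
   [xget] in [pi27] plays no role. *)
Section OrthogonalProjection.
Variable R : realType.

Lemma mulmx_tr_eq0 (n : nat) (v : 'rV[R]_n) : (v *m v^T == 0) = (v == 0).
Proof.
apply/eqP/eqP => [/matrixP /(_ 0 0)|->]; last by rewrite mul0mx.
rewrite !mxE => /eqP; rewrite psumr_eq0 => [/allP h|i _]; last first.
  by rewrite mxE -expr2 sqr_ge0.
apply/rowP => i; rewrite mxE; apply/eqP.
by have := h i (mem_index_enum i); rewrite mxE /= mulf_eq0 orbb.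
Qed.

Lemma kermx_orth_proj (n m : nat) (M : 'M[R]_(n, m)) :
  exists P : 'M[R]_n, [/\ P^T = P, P *m M = 0,
    forall e : 'rV_n, e *m M = 0 -> e *m P = e & P + M *m M^T \in unitmx].
Proof.
have gram_unit k (B : 'M[R]_(k, n)) : row_free B -> B *m B^T \in unitmx.
  move=> Bfree; rewrite -row_free_unit -kermx_eq0; apply/rowV0P => v.
  move=> /sub_kermxP vBB; apply/eqP; rewrite -(mulmx_free_eq0 _ Bfree).
  by rewrite -mulmx_tr_eq0 trmx_mul mulmxA -(mulmxA v) vBB mul0mx.
have [k [B Bfree BE]] : exists k, exists2 B : 'M[R]_(k, n),
    row_free B & (B :=: kermx M)%MS.
  by exists (\rank (kermx M)), (row_base (kermx M));
    [exact: row_base_free | exact: eq_row_base].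
have Gu := gram_unit _ _ Bfree.
have BM : B *m M = 0 by apply/sub_kermxP; rewrite BE.
pose P := B^T *m invmx (B *m B^T) *m B.
have PT : P^T = P.
  by rewrite /P !trmx_mul trmx_inv trmx_mul !trmxK mulmxA.
have Pe e : e *m M = 0 -> e *m P = e :> 'rV_n.
  move=> /sub_kermxP; rewrite -BE => /submxP [c ->].
  by rewrite /P !mulmxA -(mulmxA c) mulmxK.
have PM : P *m M = 0 by rewrite /P -mulmxA BM mulmx0.
clearbody P; exists P; split => //.
rewrite -row_free_unit -kermx_eq0; apply/rowV0P => v /sub_kermxP h.
have PP : P *m P = P.
  by apply/row_matrixP => i; rewrite row_mul Pe // -row_mul PM row0.
have: v *m P *m (v *m P)^T + v *m M *m (v *m M)^T = 0.
  rewrite !trmx_mul PT !mulmxA -(mulmxA v P P) PP -(mulmxA v M) -mulmxDl.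
  by rewrite -mulmxDr h mul0mx.
have sq_ge0 l (u : 'rV[R]_l) : 0 <= (u *m u^T) 0 0.
  by rewrite mxE sumr_ge0 // => i _; rewrite mxE -expr2 sqr_ge0.
move=> /matrixP /(_ 0 0); rewrite !mxE => /eqP.
have := sq_ge0 _ (v *m P); have := sq_ge0 _ (v *m M).
rewrite ![(_ *m _^T) 0 0]mxE => ge1 ge2.
rewrite paddr_eq0 // => /andP[/eqP v1 /eqP v2].
have vP : v *m P = 0.
  by apply/eqP; rewrite -mulmx_tr_eq0; apply/eqP/rowP => i; rewrite ord1 !mxE.
have vM : v *m M = 0.
  by apply/eqP; rewrite -mulmx_tr_eq0; apply/eqP/rowP => i; rewrite ord1 !mxE.
by rewrite -(Pe v vM).
Qed.

Lemma kernel_orth_proj (I J : finType) (A : I -> J -> R) (V : lmodType R)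
    (w : I -> V) :
  exists! p : {ffun I -> V}, (forall j, \sum_i A i j *: p i = 0) /\
    forall eta : I -> R, (forall j, \sum_i A i j * eta i = 0) ->
      \sum_i eta i *: (w i - p i) = 0.
Proof.
pose M : 'M[R]_(#|I|, #|J|) := \matrix_(i, j) A (enum_val i) (enum_val j).
have [P [PT PM Pe Pu]] := kermx_orth_proj M.
pose Q i i' := P (enum_rank i) (enum_rank i').
have Qsym i i' : Q i i' = Q i' i by rewrite /Q -{1}PT mxE.
have reidx (W : lmodType R) (F : I -> W) :
    \sum_i F i = \sum_(k < #|I|) F (enum_val k).
  rewrite (reindex (@enum_val I I)) //=.
  by exists enum_rank => i _; rewrite ?enum_valK ?enum_rankK.
have QA i j : \sum_i' A i' j * Q i i' = 0.
  move/matrixP/(_ (enum_rank i) (enum_rank j)): PM; rewrite !mxE => PM0.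
  rewrite -[RHS]PM0 (reidx R^o); apply: eq_bigr => k _.
  by rewrite /Q !mxE enum_valK enum_rankK mulrC.
have Qeta (eta : I -> R) : (forall j, \sum_i A i j * eta i = 0) ->
    forall i, \sum_i' Q i i' * eta i' = eta i.
  move=> eta0 i; have /Pe : (\row_k eta (enum_val k)) *m M = 0.
    apply/rowP => j; rewrite !mxE -[RHS](eta0 (enum_val j)) (reidx R^o).
    by apply: eq_bigr => k _; rewrite !mxE mulrC.
  move=> /rowP /(_ (enum_rank i)); rewrite !mxE enum_rankK => <-.
  rewrite (reidx R^o); apply: eq_bigr => k _.
  by rewrite Qsym /Q !mxE enum_valK mulrC.
exists [ffun i => \sum_i' Q i i' *: w i']; split; first split.
- move=> j; under eq_bigr do rewrite ffunE scaler_sumr.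
  rewrite exchange_big /= big1 // => i' _.
  under eq_bigr do rewrite scalerA Qsym.
  by rewrite -scaler_suml QA scale0r.
- move=> eta eta0; under eq_bigr do rewrite scalerBr ffunE scaler_sumr.
  rewrite sumrB [X in _ - X]exchange_big /=.
  apply/eqP; rewrite subr_eq0; apply/eqP/eq_bigr => i' _.
  under eq_bigr do rewrite scalerA mulrC Qsym.
  by rewrite -scaler_suml Qeta.
move=> p [p1 p2]; apply/ffunP => i0; rewrite ffunE.
pose q i := p i - \sum_i' Q i i' *: w i'.
have Qq i : \sum_i' Q i i' *: q i' = 0.
  have QQ k : \sum_i' Q i i' * Q i' k = Q i k.
    rewrite -[RHS]Qsym -(Qeta (Q k)) //; apply: eq_bigr => i' _.
    by rewrite [Q i' k]Qsym.
  have := p2 (Q i) (QA i).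
  under eq_bigr do rewrite scalerBr.
  rewrite sumrB => /eqP; rewrite subr_eq0 => /eqP Qp.
  under eq_bigr do rewrite scalerBr scaler_sumr.
  rewrite sumrB -Qp exchange_big /=; apply/eqP; rewrite subr_eq0; apply/eqP.
  apply: eq_bigr => k _; under eq_bigr do rewrite scalerA.
  by rewrite -scaler_suml QQ.
have Aq j : \sum_i A i j *: q i = 0.
  under eq_bigr do rewrite scalerBr scaler_sumr.
  rewrite sumrB p1 exchange_big /= big1 ?subr0 // => i' _.
  under eq_bigr do rewrite scalerA Qsym.
  by rewrite -scaler_suml QA scale0r.
pose C i i' : R := (P + M *m M^T) (enum_rank i) (enum_rank i').
have Cq i : \sum_i' C i i' *: q i' = 0.
  have CE i' : C i i' = Q i i' + \sum_j A i j * A i' j.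
    rewrite /C !mxE; congr (_ + _).
    rewrite (reindex (@enum_val J J)) /=; last first.
      by exists enum_rank => j _; rewrite ?enum_valK ?enum_rankK.
    by apply: eq_bigr => k _; rewrite !mxE !enum_rankK.
  under eq_bigr do rewrite CE scalerDl scaler_suml.
  rewrite big_split /= Qq add0r exchange_big /= big1 // => j _.
  under eq_bigr do rewrite -scalerA.
  by rewrite -scaler_sumr Aq scaler0.
pose D i i' : R := invmx (P + M *m M^T) (enum_rank i) (enum_rank i').
have DC k : \sum_i D i0 i * C i k = (i0 == k)%:R.
  have := mulVmx Pu => /matrixP /(_ (enum_rank i0) (enum_rank k)).
  rewrite !mxE (inj_eq enum_rank_inj) => <-; rewrite (reidx R^o).
  by apply: eq_bigr => l _; rewrite /D /C enum_valK mxE.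
have : \sum_i D i0 i *: \sum_k C i k *: q k = 0.
  by rewrite big1 // => i _; rewrite Cq scaler0.
under eq_bigr do rewrite scaler_sumr.
rewrite exchange_big /= (bigD1 i0) //= [X in _ + X]big1 ?addr0 => [|k neq].
  under eq_bigr do rewrite scalerA.
  by rewrite -scaler_suml DC eqxx scale1r => /eqP; rewrite subr_eq0 => /eqP.
under eq_bigr do rewrite scalerA.
by rewrite -scaler_suml DC eq_sym (negPf neq) scale0r.
Qed.

Lemma Lambda27_kernel : exists A : {set 'I_8} -> bool * {set 'I_8} -> R,
  forall (V : lmodType R) (w : form 8 V),
    Lambda27 V w <-> forall j, \sum_T A T j *: w T = 0.
Proof.
pose c S T := shuffle_sign R (~: S) S * (\sum_(X : {set 'I_8} | X \subset ~: S)
  shuffle_sign R X (~: S :\: X) * Omega0 R X * (T == ~: S :\: X)%:R)%SET.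
pose A T (j : bool * {set 'I_8}) : R :=
  if j.1 then (#|j.2| != 2)%:R * (T == j.2)%:R else c j.2 T - 3 * (T == j.2)%:R.
exists A => V w.
have pick (S : {set 'I_8}) : \sum_T (T == S)%:R *: w T = w S.
  rewrite (bigD1 S) //= eqxx scale1r big1 ?addr0 // => T /negPf ->.
  by rewrite scale0r.
have AT S : \sum_T A T (true, S) *: w T = (#|S| != 2)%:R *: w S.
  by rewrite /A /=; under eq_bigr do rewrite -scalerA;
     rewrite -scaler_sumr pick.
have AF S : \sum_T A T (false, S) *: w T =
    hodge (wedge (Omega0 R) w) S - 3 *: w S.
  rewrite /A /=; under eq_bigr do rewrite scalerBl.
  rewrite sumrB; congr (_ - _); last first.
    by under eq_bigr do rewrite -scalerA; rewrite -scaler_sumr pick.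
  under eq_bigr do rewrite -scalerA scaler_suml.
  rewrite -scaler_sumr exchange_big /= !ffunE; congr (_ *: _).
  apply: eq_bigr => X _; under eq_bigr do rewrite -scalerA.
  by rewrite -scaler_sumr pick.
split=> [[w2 w3] [[] S]|Aw].
- by rewrite AT; case: (boolP (#|S| != 2)) => [/w2 ->|_];
    rewrite ?scaler0 ?scale0r.
- by rewrite AF w3 [(3 *: w) S]ffunE subrr.
split=> [S S2|]; first by rewrite -[LHS]scale1r; have := Aw (true, S); rewrite AT S2.
apply/ffunP => S; have := Aw (false, S); rewrite AF => /eqP.
by rewrite subr_eq0 => /eqP ->; rewrite [in RHS]ffunE.
Qed.

Lemma is_proj27_unique_exists (V : lmodType R) (w : form 8 V) :
  exists! p, is_proj27 w p.
Proof.
have [A AP] := Lambda27_kernel.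
have [p [[p1 p2] puniq]] := kernel_orth_proj A w.
have projE q : is_proj27 w q <-> (forall j, \sum_i A i j *: q i = 0) /\
    forall eta : {set 'I_8} -> R, (forall j, \sum_i A i j * eta i = 0) ->
      \sum_i eta i *: (w i - q i) = 0.
  split=> [[/AP q1 q2]|[q1 q2]]; split => //.
  - move=> eta eta0; pose e : form 8 R^o := [ffun S => eta S].
    have /q2 : Lambda27 R^o e.
      by apply/AP => j; rewrite -[RHS](eta0 j); apply: eq_bigr => T _; rewrite ffunE.
    by move=> h; rewrite -[RHS]h; apply: eq_bigr => T _; rewrite !ffunE.
  - exact/AP.
  - move=> eta /AP /q2 h; rewrite -[RHS]h.
    by apply: eq_bigr => T _; rewrite !ffunE.
exists p; split; first exact/projE.
by move=> q /projE /puniq.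
Qed.

Lemma pi27P (V : lmodType R) (w : form 8 V) : is_proj27 w (pi27 w).
Proof. by have [p [wp _]] := is_proj27_unique_exists w; apply: xgetI wp. Qed.
End OrthogonalProjection.

Section SmoothForms.
Variables (R : realType) (n : nat).

Definition partial (V : normedModType R) (i : 'I_n.+1)
    (f : 'rV[R]_n.+1 -> V) : 'rV[R]_n.+1 -> V :=
  fun x => 'D_(delta_mx 0 i) f x.

Fixpoint Ck (V : normedModType R) (k : nat) (f : 'rV[R]_n.+1 -> V) : Prop :=
  if k is k'.+1 then
    forall i, (forall x, derivable f x (delta_mx 0 i)) /\ Ck k' (partial i f)
  else continuous f.

Definition smooth (V : normedModType R) (f : 'rV[R]_n.+1 -> V) :=
  forall k, Ck k f.

Definition smooth_form (V : normedModType R)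
    (w : 'rV[R]_n.+1 -> form n.+1 V) :=
  forall S, smooth (fun x => w x S).

(* d w = sum_i dx_i /\ (partial_i w). *)
Definition ext_d (V : normedModType R) (w : 'rV[R]_n.+1 -> form n.+1 V) :
    'rV[R]_n.+1 -> form n.+1 V :=
  fun x => \sum_i wedge (dx R i)
    ([ffun S => partial i (fun y => w y S) x] : form n.+1 V).

Definition differential (f : 'rV[R]_n.+1 -> R^o) (x : 'rV[R]_n.+1) :
    form n.+1 R^o :=
  \sum_i partial i f x *: dx R i.

(* g^*(w_T dx_{t_1} /\ ... /\ dx_{t_k})
     = (w_T o g) dg_{t_1} /\ ... /\ dg_{t_k},  t_1 < ... < t_k. *)
Definition pullback (V : normedModType R) (g : 'rV[R]_n.+1 -> 'rV[R]_n.+1)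
    (w : 'rV[R]_n.+1 -> form n.+1 V) : 'rV[R]_n.+1 -> form n.+1 V :=
  fun x => [ffun U => \sum_(T : {set 'I_n.+1})
    (\big[@wedge R n.+1 R^o/form1 R n.+1]_(t <- enum T)
       differential (fun y => g y 0 t) x) U *: w (g x) T].

End SmoothForms.

Section OrbifoldGroup.
Variable R : realType.
Implicit Type x : 'rV[R]_8.

(* [i : 'I_8] indexes the coordinate x_(i+1). *)
Definition alpha x : 'rV[R]_8 :=
  \row_(i < 8) if i.+1 \in [:: 1; 2; 3; 4]%N then - x 0 i else x 0 i.

Definition beta x : 'rV[R]_8 :=
  \row_(i < 8) if i.+1 \in [:: 5; 6; 7; 8]%N then - x 0 i else x 0 i.

Definition gamma x : 'rV[R]_8 :=
  \row_(i < 8) if i.+1 \in [:: 1; 2; 5; 6]%N then 2^-1 - x 0 i else x 0 i.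

Definition delta x : 'rV[R]_8 :=
  \row_(i < 8) if i.+1 == 1%N then - x 0 i
               else if i.+1 \in [:: 3; 5; 7]%N then 2^-1 - x 0 i else x 0 i.

Definition tau (i : 'I_8) x : 'rV[R]_8 := x + delta_mx 0 i.

Definition pi1orb : set ('rV[R]_8 -> 'rV[R]_8) :=
  gen_subgroup (fun g h : 'rV[R]_8 -> 'rV[R]_8 => g \o h) id
    ([set alpha; beta; gamma; delta] `|` range tau).

End OrbifoldGroup.

Arguments pi1orb : clear implicits.

Section FlatConnection.
Variable R : realType.

Definition SO (m : nat) : set 'M[R]_m :=
  [set A | A *m A^T = 1%:M /\ \det A = 1].

(* A homomorphism pi1orb -> SO(5); the values of [rho] outside pi1orb are
   irrelevant. *)
Definition representation (rho : ('rV[R]_8 -> 'rV[R]_8) -> 'M[R]_5) :=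
  (forall g, pi1orb R g -> SO (rho g)) /\
  (forall g h, pi1orb R g -> pi1orb R h -> rho (g \o h) = rho g *m rho h).

Definition translation_image (rho : ('rV[R]_8 -> 'rV[R]_8) -> 'M[R]_5) :
    set 'M[R]_5 :=
  gen_subgroup (@mulmx R 5 5 5) 1%:M (range (fun i => rho (@tau R i))).

Definition is_Z2xZ2xZ2 (H : set 'M[R]_5) :=
  exists phi : 'Z_2 * 'Z_2 * 'Z_2 -> 'M[R]_5,
    [/\ injective phi, {morph phi : u v / u + v >-> u *m v} & range phi = H].

Variable rho : ('rV[R]_8 -> 'rV[R]_8) -> 'M[R]_5.

(* Sections of Lambda^k (x) Ad E_0, seen on R^8: E_0 is the quotient of
   R^8 x SO(5) by g.(x, h) = (g x, rho(g) h), so they are the so(5)-valued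
   k-forms w with g^* w = Ad(rho(g)) w for all g in pi1orb. In this
   trivialisation theta is the product connection and d_theta is [ext_d]. *)
Definition Ad_section (k : nat) : set ('rV[R]_8 -> form 8 'M[R]_5) :=
  [set w | [/\ smooth_form w,
               forall x, homogeneous k (w x),
               forall x S, (w x S)^T = - w x S &
               forall g, pi1orb R g -> forall x S,
                 pullback g w x S = rho g *m w x S *m invmx (rho g)]].

Definition cochain0 := Ad_section 0.
Definition cochain1 := Ad_section 1.
Definition cochain2 := Ad_section 2 `&` [set w | forall x, Lambda27 _ (w x)].

Definition D0 (f : 'rV[R]_8 -> form 8 'M[R]_5) := ext_d f.
Definition D1 (a : 'rV[R]_8 -> form 8 'M[R]_5) := fun x => pi27 (ext_d a x).

(* Vanishing of the cohomology groups ker D0, ker D1 / im D0, coker D1. *)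
Definition irreducible_connection :=
  cochain0 `&` [set f | forall x, D0 f x = 0] `<=` [set f | forall x, f x = 0].

Definition infinitesimally_rigid :=
  cochain1 `&` [set a | forall x, D1 a x = 0] `<=` D0 @` cochain0.

Definition unobstructed := cochain2 `<=` D1 @` cochain1.

End FlatConnection.

(* Main.v *)
(** Only the translations matter. The image of the [tau_i] is the group of all
    diagonal sign matrices of determinant 1 on a 4-dimensional subspace, so its
    five characters on [R^5] are distinct and so(5) contains no nonzero
    invariant. Hence an so(5)-valued function [w] with
    [w (x + e_i) = Ad(rho tau_i) (w x)] is killed by the average over the
    translations: it is a sum of functions each of which changes sign under one
    of the unit translations.

    On such functions the Laplacian is invertible without any Fourier theory.
    For the simple random walk of mesh [h], reflecting [f] in the direction [i]
    of antiperiodicity gives [F s = f (x + s e_i) + f (x - s e_i)], which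
    vanishes at [s = 1/2]; comparison with the barrier [1/4 - s^2] shows that
    the [k]-th iterate of the walk is bounded by [C (1 - c h^2)^k] times the
    Lipschitz constant of [f]. So the discrete Green operators are bounded
    uniformly in [h]; as they commute with translations and with derivatives,
    they converge, for [h] tending to 0, to a smooth solution operator [G] of
    the Poisson equation. [G] commutes with the affine maps of diagonal linear
    part [+1] or [-1], in particular with the orbifold group.

    Writing [pi27] in the explicit orthogonal basis of Lambda^2_7 indexed by
    [m = j xor k], one finds that [pi27 (d d^* u)] is a multiple of the
    Laplacian of [u] for [u] in Lambda^2_7, and that [pi27 (d a) = 0] implies
    [d^* d a = 0]. The first identity with [u = G w] gives unobstructedness, the
    second shows that [a] is [d] of a multiple of [G (d^* a)], and
    irreducibility is the injectivity of the Laplacian. *)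
Require Import Defs.
From mathcomp Require Import all_boot all_order all_algebra.
From mathcomp Require Import all_classical all_reals all_analysis.
From mathcomp Require Import ring lra zify.

Set Implicit Arguments.
Unset Strict Implicit.
Unset Printing Implicit Defensive.

Import Order.TTheory GRing.Theory Num.Theory.
Import numFieldNormedType.Exports.

Local Open Scope classical_set_scope.
Local Open Scope ring_scope.

Local Notation form := Defs.form.
Local Notation contract := Defs.contract.

(** * Smooth functions *)

Section SmoothFunctions.
Variables (R : realType) (n : nat).
Local Notation X := 'rV[R]_n.+1.
Local Notation e i := (delta_mx 0 i : X).

Lemma derivable_translate (V : normedModType R) (f : X -> V) (v x w : X) :
  derivable f (x + v) w -> derivable (fun y => f (y + v)) x w.
Proof.
rewrite /derivable.
by under eq_fun do rewrite /= addrA.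
Qed.

Lemma derive_translate (V : normedModType R) (f : X -> V) (v x w : X) :
  'D_w (fun y => f (y + v)) x = 'D_w f (x + v).
Proof. by rewrite /derive; under [in RHS]eq_fun do rewrite /= addrA. Qed.

Lemma partial_translate (V : normedModType R) i (f : X -> V) v :
  partial i (fun y => f (y + v)) = (fun x => partial i f (x + v)).
Proof. by apply/funext => x; exact: derive_translate. Qed.

Lemma smooth_derivable (V : normedModType R) (f : X -> V) i x :
  smooth f -> derivable f x (e i).
Proof. by move=> /(_ 1%N) /(_ i) []. Qed.

Lemma smooth_continuous (V : normedModType R) (f : X -> V) :
  smooth f -> continuous f.
Proof. exact: (@^~ 0%N). Qed.

Lemma smooth_partial (V : normedModType R) (f : X -> V) i :
  smooth f -> smooth (partial i f).
Proof. by move=> fs k; case: (fs k.+1 i). Qed.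

Lemma smooth_translate (V : normedModType R) (f : X -> V) v :
  smooth f -> smooth (fun x => f (x + v)).
Proof.
move=> fs k; elim: k f fs => [|k IH] f fs.
  move=> x; apply: (@continuous_comp _ _ _ (fun y : X => y + v) f x); last exact: (fs 0%N).
  exact: (@cvgD _ X X (nbhs x) _ id (cst v) x v cvg_id (cvg_cst v)).
move=> i; split.
  by move=> x; apply: derivable_translate; exact: smooth_derivable.
by rewrite partial_translate; apply: IH; exact: smooth_partial.
Qed.

Lemma smoothD (V : normedModType R) (f g : X -> V) :
  smooth f -> smooth g -> smooth (fun x => f x + g x).
Proof.
move=> fs gs k; elim: k f g fs gs => [|k IH] f g fs gs.
  by move=> x; exact: (@cvgD _ V X (nbhs x) _ f g _ _ (fs 0%N x) (gs 0%N x)).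
move=> i; split=> [x|]; first by apply: derivableD; exact: smooth_derivable.
have -> : partial i (fun x => f x + g x) = (fun x => partial i f x + partial i g x).
  by apply/funext => x; apply: deriveD; exact: smooth_derivable.
by apply: IH; exact: smooth_partial.
Qed.

Lemma smoothZ (V : normedModType R) (f : X -> V) (c : R) :
  smooth f -> smooth (fun x => c *: f x).
Proof.
move=> fs k; elim: k f fs => [|k IH] f fs.
  by move=> x; apply: (@continuousZ _ V X (cst c) f x _ (fs 0%N x)); exact: cst_continuous.
move=> i; split=> [x|]; first by apply: derivableZ; exact: smooth_derivable.
have -> : partial i (fun x => c *: f x) = (fun x => c *: partial i f x).
  by apply/funext => x; apply: deriveZ; exact: smooth_derivable.
by apply: IH; exact: smooth_partial.
Qed.

Lemma partial_cst (V : normedModType R) i (c : V) :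
  partial i (fun _ : X => c) = (fun=> 0).
Proof. by apply/funext => x; exact: derive_cst. Qed.

Lemma smooth_cst (V : normedModType R) (c : V) : smooth (fun _ : X => c).
Proof.
move=> k; elim: k c => [|k IH] c; first exact: cst_continuous.
by move=> i; split=> [x|]; [exact: derivable_cst | rewrite partial_cst; exact: IH].
Qed.

Lemma smooth_sum (V : normedModType R) I (r : seq I) (F : I -> X -> V) :
  (forall i, smooth (F i)) -> smooth (fun x => \sum_(i <- r) F i x).
Proof.
move=> Fs; elim: r => [|i r IH].
  by under eq_fun do rewrite big_nil; exact: smooth_cst.
by under eq_fun do rewrite big_cons; exact: smoothD.
Qed.

Lemma partialD (V : normedModType R) i (f g : X -> V) : smooth f -> smooth g ->
  partial i (fun x => f x + g x) = (fun x => partial i f x + partial i g x).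
Proof.
by move=> fs gs; apply/funext => x; apply: deriveD; exact: smooth_derivable.
Qed.

Lemma partialZ (V : normedModType R) i (f : X -> V) (c : R) : smooth f ->
  partial i (fun x => c *: f x) = (fun x => c *: partial i f x).
Proof. by move=> fs; apply/funext => x; apply: deriveZ; exact: smooth_derivable. Qed.

Lemma partial_sum (V : normedModType R) i I (r : seq I) (F : I -> X -> V) :
  (forall i, smooth (F i)) ->
  partial i (fun x => \sum_(j <- r) F j x) =
  (fun x => \sum_(j <- r) partial i (F j) x).
Proof.
move=> Fs; elim: r => [|j r IH].
  under eq_fun do rewrite big_nil; rewrite partial_cst.
  by under [RHS]eq_fun do rewrite big_nil.
under eq_fun do rewrite big_cons; rewrite partialD //; last exact: smooth_sum.
by rewrite IH; under [RHS]eq_fun do rewrite big_cons.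
Qed.

Lemma mx_continuousP p q (f : X -> 'M[R]_(p, q)) :
  continuous f <-> forall i j, continuous (fun x => f x i j).
Proof.
split=> [fc i j x|fc x].
  exact: (@continuous_comp _ _ _ f (fun A : 'M[R]_(p, q) => A i j) x (fc x)
            (@coord_continuous _ _ _ i j (f x))).
apply/(@cvgrPdist_le _ _ _ (nbhs x) (nbhs_filter x)) => eps eps0; near=> y.
rewrite /Num.Def.normr/= mx_normrE (bigmax_le _ (ltW eps0))//= => i _.
rewrite !mxE/=; move: i; near: y; apply: (@filter_forall _ _ _ (nbhs x) (nbhs_filter x)) => /= i.
exact: ((cvgrPdist_le _ _).1 (fc i.1 i.2 x)).
Unshelve. all: by end_near. Qed.

Lemma partial_mx p q (f : X -> 'M[R]_(p, q)) i x a b :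
  derivable f x (e i) -> partial i f x a b = partial i (fun y => f y a b) x.
Proof. by move=> fd; rewrite /partial derive_mx // mxE. Qed.

Lemma mx_smoothP p q (f : X -> 'M[R]_(p, q)) :
  smooth f <-> forall a b, smooth (fun x => f x a b).
Proof.
split=> [fs a b k|fs k].
  elim: k f fs => [|k IH] f fs.
    by move: (smooth_continuous fs) => /mx_continuousP; apply.
  move=> i; split=> [x|].
    by have /derivable_mxP := smooth_derivable (i := i) (x := x) fs; apply.
  have -> : partial i (fun x => f x a b) = (fun x => partial i f x a b).
    by apply/funext => x; rewrite partial_mx //; exact: smooth_derivable.
  by apply: IH; exact: smooth_partial.
elim: k f fs => [|k IH] f fs.
  by apply/mx_continuousP => a b; exact: smooth_continuous.
have fd i x : derivable f x (e i).
  by apply/derivable_mxP => a b; exact: smooth_derivable.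
move=> i; split=> //; apply: IH => a b.
have -> : (fun x => partial i f x a b) = partial i (fun x => f x a b).
  by apply/funext => x; rewrite partial_mx.
exact: smooth_partial.
Qed.

(** The one-variable mean value theorem for s |-> f (x + s e_i), on [0, t] or [t, 0] according to
    the sign of t; the bound |s| <= |t| serves both cases. *)
Lemma MVT_line (f : X -> R) i x (t : R) : smooth f ->
  exists2 s : R, `|s| <= `|t| &
    f (x + t *: e i) - f x = t * partial i f (x + s *: e i).
Proof.
move=> fs.
pose g (s : R) : R := f (x + s *: e i).
have gE s : (fun h : R => h^-1 *: ((g \o shift s) (h *: 1) - g s)) =
    (fun h : R => h^-1 *: ((f \o shift (x + s *: e i)) (h *: e i) -
                          f (x + s *: e i))).
  apply/funext => h; rewrite /g /=; congr (_ *: (f _ - _)).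
  by rewrite [h *: 1]mulr1 scalerDl addrCA.
have gd (s : R) : is_derive s (1 : R) (g : R -> R) (partial i f (x + s *: e i) : R).
  split; first by rewrite /derivable gE; exact: smooth_derivable.
  by rewrite /derive gE.
have gc a b : {within `[a, b], continuous g}.
  apply: continuous_subspaceT => s; apply: differentiable_continuous.
  by apply/derivable1_diffP; have [] := gd s.
case: (leP 0 t) => [t0|/ltW t0].
  have [s + E] := MVT_segment t0 (fun s _ => gd s) (gc _ _).
  rewrite in_itv /= => /andP[s0 st]; exists s; first by rewrite !ger0_norm.
  by move: E; rewrite /g scale0r addr0 subr0 mulrC.
have [s + E] := MVT_segment t0 (fun s _ => gd s) (gc _ _).
rewrite in_itv /= => /andP[ts s0]; exists s; first by rewrite !ler0_norm // lerN2.
move: E; rewrite /g scale0r addr0 sub0r mulrN mulrC => E.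
by rewrite -opprB E opprK.
Qed.

End SmoothFunctions.

(** * Symmetry of second partial derivatives *)

Section Schwarz.
Variables (R : realType) (n : nat).
Local Notation X := 'rV[R]_n.+1.
Local Notation e i := (delta_mx 0 i : X).

Lemma smoothB (f g : X -> R) : smooth f -> smooth g -> smooth (fun x => f x - g x).
Proof.
move=> fs gs; under eq_fun do rewrite -scaleN1r.
by apply: smoothD => //; exact: smoothZ.
Qed.

Lemma partialB i (f g : X -> R) : smooth f -> smooth g ->
  partial i (fun x => f x - g x) = (fun x => partial i f x - partial i g x).
Proof.
move=> fs gs; under eq_fun do rewrite -scaleN1r.
rewrite partialD // ?partialZ //; last exact: smoothZ.
by under eq_fun do rewrite scaleN1r.
Qed.

(** The mean value theorem twice: in direction i for the difference f (y + t e_j) - f y, then in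
    direction j for the partial of f along e_i. *)
Lemma second_difference (f : X -> R) i j x (t : R) : smooth f -> exists s s' : R,
  [/\ `|s| <= `|t|, `|s'| <= `|t| &
   f (x + t *: e i + t *: e j) - f (x + t *: e i) - f (x + t *: e j) + f x =
   t ^+ 2 * partial j (partial i f) (x + (s *: e i + s' *: e j))].
Proof.
move=> fs; pose p y := f (y + t *: e j) - f y.
have ps : smooth p by apply: smoothB => //; exact: smooth_translate.
have [s st E] := MVT_line i x t ps.
have [s' st' E'] := MVT_line j (x + s *: e i) t (smooth_partial i fs).
exists s, s'; split; [exact: st | exact: st' | ].
transitivity (p (x + t *: e i) - p x); first by rewrite /p; ring.
rewrite E /p (partialB _ (smooth_translate _ fs) fs) partial_translate E'.
by rewrite [in RHS]addrA expr2 mulrA.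
Qed.

(** Schwarz's theorem. The second difference is symmetric in i and j, so for every t the two mixed
    partials take a common value at points within O(t) of x; continuity brings both points to x. *)
Lemma partialC (f : X -> R) i j : smooth f ->
  partial i (partial j f) = partial j (partial i f).
Proof.
move=> fs; apply/funext => x; apply/eqP; rewrite -subr_eq0 -normr_le0.
apply/ler_addgt0Pl => eps eps0; rewrite addr0.
have c0 : 0 < 1 + `|e i| + `|e j| by rewrite -addrA ltr_pwDl ?addr_ge0.
have half : 0 < eps / 2 by rewrite divr_gt0.
have close k l : exists2 d : R, 0 < d & forall y, `|y| < d ->
    `|partial k (partial l f) x - partial k (partial l f) (x + y)| < eps / 2.
  have gs := smooth_continuous (smooth_partial k (smooth_partial l fs)).
  have /(@cvgrPdist_lt _ _ _ (nbhs x) (nbhs_filter x)) := gs x.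
  move=> /(_ _ half) /nbhs_ballP [d /= d0 H]; exists d => // y yd; apply: H.
  by rewrite -ball_normE /= opprD addrA subrr add0r normrN.
have [d1 d10 H1] := close i j; have [d2 d20 H2] := close j i.
(* For this t every x + s e_i + s' e_j with |s|, |s'| <= t lies in both neighbourhoods on which the
   mixed partials vary by less than eps / 2; the summand 1 makes the inequality strict. *)
pose t := Num.min d1 d2 / (1 + `|e i| + `|e j|) .
have t0 : 0 < t by rewrite divr_gt0 // lt_min d10.
have small (s s' : R) : `|s| <= `|t| -> `|s'| <= `|t| ->
    `|s *: e i + s' *: e j| < Num.min d1 d2.
  rewrite (gtr0_norm t0) => st st'; apply: le_lt_trans (ler_normD _ _) _.
  rewrite !normrZ; apply: (@le_lt_trans _ _ (t * (`|e i| + `|e j|))).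
    by rewrite mulrDr lerD // ler_wpM2r.
  rewrite /t mulrAC ltr_pdivrMr // ltr_pM2l ?lt_min ?d10 //.
  by rewrite -addrA ltrDr ltr01.
have [s [s' [st st' E]]] := second_difference i j x t fs.
have [u [u' [ut ut' E']]] := second_difference j i x t fs.
have /H2 : `|s *: e i + s' *: e j| < d2.
  by apply: lt_le_trans (small _ _ st st') _; rewrite ge_min lexx orbT.
have /H1 : `|u *: e j + u' *: e i| < d1.
  by rewrite addrC; apply: lt_le_trans (small _ _ ut' ut) _; rewrite ge_min lexx.
suff -> : partial i (partial j f) (x + (u *: e j + u' *: e i)) =
    partial j (partial i f) (x + (s *: e i + s' *: e j)).
  move: (partial i _ x) (partial j _ x) (partial j _ _) => a b c.
  move=> h1 h2; rewrite (_ : a - b = (a - c) - (b - c)); last by ring.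
  apply: le_trans (ler_normB _ _) _; rewrite (splitr eps).
  by apply: lerD; exact: ltW.
have t2 : t ^+ 2 != 0 by rewrite expf_neq0 // gt_eqF.
apply: (mulfI t2); apply: etrans (esym E') (etrans _ E).
by rewrite (addrAC x (t *: e j)); ring.
Qed.

End Schwarz.

(** * Inverting the Laplacian on antiperiodic functions *)

Section Antiperiodic.
Variables (R : realType) (n : nat).
Local Notation X := 'rV[R]_n.+1.
Local Notation e i := (delta_mx 0 i : X).
Implicit Types (f g : X -> R) (i j k : 'I_n.+1).

(** The period 2 in all directions bounds f and its derivatives by compactness; the change of sign
    along e_i excludes nonzero constants, which the Laplacian kills. *)
Definition antiperiodic i f := [/\ smooth f,
  forall j x, f (x + 2 *: e j) = f x & forall x, f (x + e i) = - f x].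

Lemma antiperiodic_smooth i f : antiperiodic i f -> smooth f.
Proof. by case. Qed.

Lemma antiperiodicD i f g : antiperiodic i f -> antiperiodic i g ->
  antiperiodic i (fun x => f x + g x).
Proof.
move=> [fs fp fa] [gs gp ga]; split; first exact: smoothD.
  by move=> j x; rewrite fp gp.
by move=> x; rewrite fa ga opprD.
Qed.

Lemma antiperiodicZ i (c : R) f : antiperiodic i f ->
  antiperiodic i (fun x => c * f x).
Proof.
move=> [fs fp fa]; split; first exact: smoothZ.
  by move=> j x; rewrite fp.
by move=> x; rewrite fa mulrN.
Qed.

Lemma antiperiodicB i f g : antiperiodic i f -> antiperiodic i g ->
  antiperiodic i (fun x => f x - g x).
Proof.
move=> fa ga; under eq_fun do rewrite -mulN1r.
by apply: antiperiodicD => //; exact: antiperiodicZ.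
Qed.

Lemma antiperiodic_translate i f v : antiperiodic i f ->
  antiperiodic i (fun x => f (x + v)).
Proof.
move=> [fs fp fa]; split; first exact: smooth_translate.
  by move=> j x; rewrite addrAC fp.
by move=> x; rewrite addrAC fa.
Qed.

Lemma antiperiodic_sum i I (r : seq I) (F : I -> X -> R) :
  (forall a, antiperiodic i (F a)) -> antiperiodic i (fun x => \sum_(a <- r) F a x).
Proof.
move=> Fa; elim: r => [|a r IH].
  under eq_fun do rewrite big_nil.
  by split=> [||x]; [exact: smooth_cst | | rewrite oppr0].
by under eq_fun do rewrite big_cons; exact: antiperiodicD.
Qed.

Lemma antiperiodic_partial i j f : antiperiodic i f -> antiperiodic i (partial j f).
Proof.
move=> [fs fp fa]; split; first exact: smooth_partial.
  move=> k x; have E : (fun y => f (y + 2 *: e k)) = f.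
    by apply/funext => y; rewrite fp.
  by have := congr1 (fun F => partial j F x) E; rewrite partial_translate.
move=> x; have E : (fun y => f (y + e i)) = (fun y => -1 *: f y).
  by apply/funext => y; rewrite fa scaleN1r.
have := congr1 (fun F => partial j F x) E.
by rewrite partial_translate partialZ // scaleN1r.
Qed.

(** Translations by even integers bring every point into the compact cube of side 2, so the extreme
    values on the cube bound f everywhere. *)
Lemma periodic_bounded f : continuous f ->
  (forall j x, f (x + 2 *: e j) = f x) -> exists B, forall x, `|f x| <= B.
Proof.
move=> fc fp.
have fint j x (z : int) : f (x + (2 * z%:~R) *: e j) = f x.
  have fnat y m : f (y + (2 * m%:R) *: e j) = f y.
    elim: m y => [|m IH] y; first by rewrite mulr0 scale0r addr0.
    by rewrite -[m.+1]addn1 natrD mulrDr mulr1 scalerDl addrA fp IH.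
  case: z => m; first exact: fnat.
  by rewrite NegzE mulrNz mulrN scaleNr -[LHS](fnat _ m.+1) subrK.
have fsum (z : 'I_n.+1 -> int) (r : seq 'I_n.+1) x :
    f (x + \sum_(j <- r) (2 * (z j)%:~R) *: e j) = f x.
  elim: r x => [|j r IH] x; first by rewrite big_nil addr0.
  by rewrite big_cons addrA IH fint.
pose A : set X := [set v | forall j, `[0, 2]%classic (v ord0 j)].
have cA : compact A.
  have h (j : 'I_n.+1) : compact (`[0, 2]%classic : set R) by exact: segment_compact.
  exact: (rV_compact h).
have A0 : A !=set0 by exists 0 => j /=; rewrite mxE in_itv /= lexx ler0n.
have Ac : {within A, continuous f} by exact: continuous_subspaceT.
have [M _ HM] := EVT_max_rV A0 cA Ac.
have [m _ Hm] := EVT_min_rV A0 cA Ac.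
exists (`|f M| + `|f m|) => x.
pose z j := - Num.floor (x 0 j / 2).
have : x + \sum_j (2 * (z j)%:~R) *: e j \in A.
  rewrite inE => j /=; rewrite in_itv /= mxE summxE (bigD1 j) //= big1 => [|k kj]; last first.
    by rewrite !mxE [j == k]eq_sym (negPf kj) andbF mulr0.
  rewrite !mxE !eqxx mulr1 addr0 /z mulrNz; have /andP[] := floor_itv (x 0 j / 2).
  by rewrite intrD; move: (_%:~R) => c; lra.
rewrite -(fsum z (index_enum _) x); move: (x + _) => y yA.
have := HM _ yA; have := Hm _ yA.
have := ler_norm (f M); have := ler_norm (- f m); rewrite normrN.
have := normr_ge0 (f M); have := normr_ge0 (f m).
by rewrite ler_norml => h1 h2 h3 h4 h5 h6; apply/andP; split; lra.
Qed.

Fixpoint Cbound (m : nat) (C : R) f : Prop :=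
  (forall x, `|f x| <= C) /\
  if m is m'.+1 then forall j, Cbound m' C (partial j f) else True.

Lemma Cbound_le m m' C C' f : (m' <= m)%N -> C <= C' -> Cbound m C f -> Cbound m' C' f.
Proof.
move=> mm CC; elim: m m' mm f => [|m IH] [|m'] //= mm f [fb fd]; split => //.
- by move=> x; apply: le_trans (fb x) CC.
- by move=> x; apply: le_trans (fb x) CC.
- by move=> x; apply: le_trans (fb x) CC.
by move=> j; apply: IH.
Qed.

Lemma Cbound_ge0 m C f : Cbound m C f -> 0 <= C.
Proof. by case: m => [|m] [fb _]; apply: le_trans (fb 0). Qed.

Lemma antiperiodic_Cbound i m f : antiperiodic i f -> exists C, Cbound m C f.
Proof.
elim: m f => [|m IH] f fa; have [fs fp _] := fa.
  by have [B fB] := periodic_bounded (smooth_continuous fs) fp; exists B.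
have [B fB] := periodic_bounded (smooth_continuous fs) fp.
have /choice[C HC] : forall j, exists C, Cbound m C (partial j f).
  by move=> j; apply: IH; exact: antiperiodic_partial.
have C0 j : 0 <= C j := Cbound_ge0 (HC j).
exists (`|B| + \sum_j C j); split.
  move=> x; apply: le_trans (fB x) _; apply: le_trans (ler_norm _) _.
  by rewrite lerDl sumr_ge0.
move=> j; apply: Cbound_le (HC j) => //.
rewrite (bigD1 j) //= addrCA lerDl addr_ge0 // sumr_ge0 //.
Qed.

(** Lipschitz along coordinate lines only: bounds on the partials give this, and the walk moves
    along the axes. *)
Definition lip (L : R) f := forall i x (t : R), `|f (x + t *: e i) - f x| <= L * `|t|.

Lemma lipP L f : smooth f -> (forall j x, `|partial j f x| <= L) -> lip L f.
Proof.
move=> fs fb i x t; have [s _ ->] := MVT_line i x t fs.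
by rewrite normrM mulrC ler_wpM2r.
Qed.

Lemma Cbound_lip m C f : smooth f -> Cbound m.+1 C f -> lip C f.
Proof.
move=> fs [_ fd]; apply: lipP => // j x.
by have := fd j; case: m {fd} => [|m] [].
Qed.

End Antiperiodic.

(** * Combinations of translations and the decay of the random walk *)

Section TranslationOperators.
Variables (R : realType) (n : nat).
Local Notation X := 'rV[R]_n.+1.
Local Notation e i := (delta_mx 0 i : X).
Implicit Types (f g : X -> R) (i j : 'I_n.+1) (Phi Psi : (X -> R) -> X -> R).

(** All discrete operators below have this form. It gives at once that they are linear, commute with
    one another and with partial derivatives, and preserve antiperiodicity. *)
Definition translation_op Phi := exists s : seq (R * X),
  forall f x, Phi f x = \sum_(p <- s) p.1 * f (x + p.2).

Lemma translation_op_translate v : translation_op (fun f x => f (x + v)).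
Proof. by exists [:: (1, v)] => f x; rewrite big_seq1 mul1r. Qed.

Lemma translation_op_id : translation_op id.
Proof. by exists [:: (1, 0)] => f x; rewrite big_seq1 mul1r addr0. Qed.

Lemma translation_opD Phi Psi : translation_op Phi -> translation_op Psi ->
  translation_op (fun f x => Phi f x + Psi f x).
Proof. by move=> [s Hs] [t Ht]; exists (s ++ t) => f x; rewrite big_cat Hs Ht. Qed.

Lemma translation_opZ c Phi : translation_op Phi ->
  translation_op (fun f x => c * Phi f x).
Proof.
move=> [s Hs]; exists [seq (c * p.1, p.2) | p <- s] => f x.
by rewrite big_map Hs mulr_sumr; apply: eq_bigr => p _; rewrite mulrA.
Qed.

Lemma translation_opB Phi Psi : translation_op Phi -> translation_op Psi ->
  translation_op (fun f x => Phi f x - Psi f x).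
Proof.
move=> Phit Psit.
have -> : (fun f x => Phi f x - Psi f x) = (fun f x => Phi f x + -1 * Psi f x).
  by apply/funext => f; apply/funext => x; rewrite mulN1r.
by apply: translation_opD => //; exact: translation_opZ.
Qed.

Lemma translation_op_sum I (r : seq I) (F : I -> (X -> R) -> X -> R) :
  (forall a, translation_op (F a)) ->
  translation_op (fun f x => \sum_(a <- r) F a f x).
Proof.
move=> Ft; elim: r => [|a r IH].
  by exists [::] => f x; rewrite !big_nil.
have -> : (fun f x => \sum_(b <- a :: r) F b f x) =
    (fun f x => F a f x + \sum_(b <- r) F b f x).
  by apply/funext => f; apply/funext => x; rewrite big_cons.
exact: translation_opD.
Qed.

Lemma translation_op_comp Phi Psi : translation_op Phi -> translation_op Psi ->
  translation_op (fun f => Phi (Psi f)).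
Proof.
move=> [s Hs] [t Ht].
exists [seq (p.1 * q.1, p.2 + q.2) | p <- s, q <- t] => f x.
rewrite big_allpairs_dep Hs; apply: eq_bigr => p _.
by rewrite Ht mulr_sumr; apply: eq_bigr => q _; rewrite mulrA addrA.
Qed.

Lemma translation_op_iter Phi m : translation_op Phi ->
  translation_op (fun f => iter m Phi f).
Proof.
move=> Phit; elim: m => [|m IH]; first exact: translation_op_id.
exact: (translation_op_comp Phit IH).
Qed.

Lemma translation_op_comm Phi Psi f : translation_op Phi -> translation_op Psi ->
  Phi (Psi f) = Psi (Phi f).
Proof.
move=> [s Hs] [t Ht]; apply/funext => x; rewrite Hs Ht.
under eq_bigr do rewrite Ht mulr_sumr.
rewrite exchange_big; apply: eq_bigr => q _; rewrite Hs mulr_sumr.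
by apply: eq_bigr => p _; rewrite mulrCA addrAC.
Qed.

Lemma translation_op_add Phi f g : translation_op Phi ->
  Phi (fun x => f x + g x) = (fun x => Phi f x + Phi g x).
Proof.
move=> [s Hs]; apply/funext => x; rewrite !Hs -big_split.
by apply: eq_bigr => p _; rewrite mulrDr.
Qed.

Lemma translation_op_scale Phi c f : translation_op Phi ->
  Phi (fun x => c * f x) = (fun x => c * Phi f x).
Proof.
move=> [s Hs]; apply/funext => x; rewrite !Hs mulr_sumr.
by apply: eq_bigr => p _; rewrite mulrCA.
Qed.

Lemma translation_op_sub Phi f g : translation_op Phi ->
  Phi (fun x => f x - g x) = (fun x => Phi f x - Phi g x).
Proof.
move=> Phit; have := translation_op_add f (fun x => -1 * g x) Phit.
rewrite translation_op_scale //.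
by under eq_fun do rewrite mulN1r; under [RHS]eq_fun do rewrite mulN1r.
Qed.

Lemma translation_op_partial Phi f j : translation_op Phi -> smooth f ->
  partial j (Phi f) = Phi (partial j f).
Proof.
move=> [s Hs] fs.
have E g : Phi g = (fun x => \sum_(p <- s) p.1 *: g (x + p.2)).
  by apply/funext => x; rewrite Hs.
rewrite !E partial_sum; last by move=> p; apply: smoothZ; exact: smooth_translate.
apply/funext => x; apply: eq_bigr => p _; rewrite partialZ ?partial_translate //.
exact: smooth_translate.
Qed.

Lemma translation_op_antiperiodic Phi f i : translation_op Phi ->
  antiperiodic i f -> antiperiodic i (Phi f).
Proof.
move=> [s Hs] fa; rewrite (_ : Phi f = fun x => \sum_(p <- s) p.1 * f (x + p.2)).
  by apply: antiperiodic_sum => p; apply: antiperiodicZ; exact: antiperiodic_translate.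
by apply/funext => x.
Qed.

Definition walk (h : R) f : X -> R := fun x =>
  (n.+1%:R *+ 2)^-1 * \sum_j (f (x + h *: e j) + f (x - h *: e j)).

Lemma translation_op_walk h : translation_op (walk h).
Proof.
apply: translation_opZ; apply: translation_op_sum => j.
by apply: translation_opD; exact: translation_op_translate.
Qed.

(** Averaging lowers the barrier 1/4 - s^2 by h^2 / (n + 1), since only the two neighbours along e_i
    change s; as the barrier is at most 1/4, it shrinks at least by this factor. *)
Definition decay (h : R) : R := 1 - h ^+ 2 *+ 4 / n.+1%:R.

(* The reflected sum [f (x + s e_i) + f (x - s e_i)] vanishes at [s = 1/2], so
   that [1/4 - s^2] is a barrier for it, which the walk contracts. *)
Lemma walk_decay i f L (N m : nat) h x : N.+1%:R * h = 2^-1 ->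
  (forall x, f (x + e i) = - f x) -> lip L f -> 0 <= L ->
  `|iter m (walk h) f x| <= L / 2 * decay h ^+ m.
Proof.
move=> hN fa fL L0.
have h0 : 0 < h by rewrite -(@pmulr_rgt0 _ N.+1%:R) // hN invr_gt0.
have d0 : 0 < n.+1%:R :> R by [].
have d1 : 1 <= n.+1%:R :> R by rewrite ler1n.
have hle : h <= 2^-1.
  by rewrite -hN ler_peMl ?(ltW h0) // ler1n.
have q0 : 0 <= decay h.
  rewrite /decay subr_ge0 ler_pdivrMr // mul1r; apply: le_trans d1.
  nra.
have ta k y : iter k (walk h) f (y + e i) = - iter k (walk h) f y.
  have [s Hs] := translation_op_iter k (translation_op_walk h).
  by rewrite !Hs -sumrN; apply: eq_bigr => p _; rewrite addrAC fa mulrN.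
pose phi (a : nat) : R := 4^-1 - (a%:R * h) ^+ 2.
pose F k y (a : nat) :=
  iter k (walk h) f (y + (a%:R * h) *: e i) + iter k (walk h) f (y - (a%:R * h) *: e i).
(* Induction on the number k of steps, for all centres y and all distances a h <= 1/2. At a = 0 the
   reflected sum is twice the iterate and phi is 1/4, which gives the factor L / 2. *)
suff H k y a : (a <= N.+1)%N -> `|F k y a| <= L *+ 4 * decay h ^+ k * phi a.
  have := H m x 0%N isT; rewrite /F /phi mul0r scale0r addr0 subr0 expr0n subr0 /=.
  rewrite -mulr2n normrMn; move: (`|_|) (decay h ^+ m) => u v; lra.
elim: k y a => [|k IH] y a aN.
  rewrite /F /= expr0 mulr1 /phi.
  have aN' : a%:R * h <= 2^-1 by rewrite -hN ler_wpM2r ?(ltW h0) // ler_nat.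
  have a0 : 0 <= a%:R * h by rewrite mulr_ge0 // ltW.
  move: (a%:R * h) a0 aN' => s s0 s2.
  (* Antiperiodicity turns the sum into a difference of values at distance 1 - 2 s, and 1 - 2 s <= 1
     - 4 s^2 on [0, 1/2]. *)
  have -> : f (y + s *: e i) = - f (y + s *: e i - e i).
    by rewrite -fa subrK.
  have -> : y + s *: e i - e i = (y - s *: e i) + (2 * s - 1) *: e i.
    rewrite scalerBl scale1r mulr_natl mulr2n scalerDl; move: (s *: e i) => v.
    by rewrite !addrA subrK.
  rewrite addrC -normrN opprB.
  apply: le_trans (fL i _ _) _.
  rewrite ler0_norm; last by lra.
  have -> : L *+ 4 * (4^-1 - s ^+ 2) = L * (1 - s ^+ 2 *+ 4) by field.
  by rewrite ler_wpM2l //; nra.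
have FE : F k.+1 y a = (n.+1%:R *+ 2)^-1 * \sum_j (F k (y + h *: e j) a + F k (y - h *: e j) a).
  rewrite /F /= /walk -mulrDr -big_split; congr (_ * _); apply: eq_bigr => j _ /=.
  rewrite [y + h *: e j + _]addrAC [y - h *: e j + _]addrAC.
  rewrite [y + h *: e j - _]addrAC [y - h *: e j - _]addrAC.
  by rewrite addrACA.
move: aN; rewrite leq_eqVlt => /orP[/eqP ->|aN].
  (* At s = 1/2 the two reflected points differ by e_i, so the sum and the barrier both vanish. *)
  rewrite /F hN; have -> : y + 2^-1 *: e i = y - 2^-1 *: e i + e i.
    rewrite -addrA; congr (_ + _); rewrite -{3}[e i]scale1r -scaleNr -scalerDl.
    by congr (_ *: _); lra.
  rewrite ta addNr normr0 /phi hN mulr_ge0 //; last by lra.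
  by rewrite mulr_ge0 ?exprn_ge0 // mulrn_wge0.
pose B (b : nat) := L *+ 4 * decay h ^+ k * phi b.
(* Directions other than i leave the distance a unchanged. Along e_i the terms regroup as the
   reflected sums at a + 1 and a - 1, or twice the one at 1 when a = 0, and the second difference of
   the barrier is - 2 h^2. *)
have step j : `|F k (y + h *: e j) a + F k (y - h *: e j) a| <=
    B a *+ 2 - (j == i)%:R * (L *+ 8 * decay h ^+ k * h ^+ 2).
  have [->|ji] := eqVneq j i; last first.
    rewrite mul0r subr0 mulr2n; apply: le_trans (ler_normD _ _) _.
    by apply: lerD; apply: IH; exact: ltnW.
  rewrite mul1r.
  have -> : B a *+ 2 - L *+ 8 * decay h ^+ k * h ^+ 2 =
      L *+ 4 * decay h ^+ k * (phi a *+ 2 - h ^+ 2 *+ 2) by rewrite /B; ring.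
  clear FE; case: a aN @B => [|a] aN B.
    have -> : F k (y + h *: e i) 0 + F k (y - h *: e i) 0 = F k y 1 *+ 2.
      by rewrite /F mul0r scale0r !addr0 !subr0 mul1r; ring.
    have -> : phi 0%N *+ 2 - h ^+ 2 *+ 2 = phi 1%N *+ 2.
      by rewrite /phi; ring.
    by rewrite normrMn mulrnAr lerMn2r IH.
  have -> : F k (y + h *: e i) a.+1 + F k (y - h *: e i) a.+1 = F k y a.+2 + F k y a.
    have -> : F k (y + h *: e i) a.+1 =
      iter k (walk h) f (y + (a.+2%:R * h) *: e i) + iter k (walk h) f (y - (a%:R * h) *: e i).
      rewrite /F -!natr1 !mulrDl !mul1r !scalerDl.
      congr (iter k (walk h) f _ + iter k (walk h) f _); move: (h *: e i) (_ *: e i) => u v.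
        by rewrite -!addrA; congr (_ + _); rewrite addrCA addrA.
      by rewrite opprD -!addrA; congr (_ + _); rewrite addrCA subrr addr0.
    have -> : F k (y - h *: e i) a.+1 =
      iter k (walk h) f (y + (a%:R * h) *: e i) + iter k (walk h) f (y - (a.+2%:R * h) *: e i).
      rewrite /F -!natr1 !mulrDl !mul1r !scalerDl.
      congr (iter k (walk h) f _ + iter k (walk h) f _); move: (h *: e i) (_ *: e i) => u v.
        by rewrite -!addrA; congr (_ + _); rewrite addrCA addNr addr0.
      by rewrite !opprD -!addrA; congr (_ + _); rewrite addrCA addrA.
    by rewrite /F; ring.
  have -> : phi a.+1 *+ 2 - h ^+ 2 *+ 2 = phi a.+2 + phi a.
    by rewrite /phi -!natr1; ring.
  rewrite mulrDr; apply: le_trans (ler_normD _ _) _.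
  by apply: lerD; apply: IH => //; apply: ltnW; exact: ltnW.
rewrite FE normrM ger0_norm; last by rewrite invr_ge0 mulrn_wge0.
rewrite mulrC ler_pdivrMr; last by rewrite mulrn_wgt0.
apply: le_trans (ler_norm_sum _ _ _) _.
apply: le_trans (ler_sum _ (fun j _ => step j)) _.
rewrite sumrB sumr_const card_ord -mulr_suml (bigD1 i) //= eqxx big1 => [|j /negPf -> //].
rewrite addr0 mul1r /B [decay h ^+ k.+1]exprSr.
have -> : L *+ 4 * decay h ^+ k * phi a *+ 2 *+ n.+1 -
    L *+ 8 * decay h ^+ k * h ^+ 2 =
    (L *+ 8 * decay h ^+ k) * (n.+1%:R * phi a - h ^+ 2).
  by rewrite -[X in X - _]mulr_natr; ring.
have -> : L *+ 4 * (decay h ^+ k * decay h) * phi a * (n.+1%:R *+ 2) =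
    (L *+ 8 * decay h ^+ k) * (n.+1%:R * phi a * decay h) by ring.
rewrite ler_wpM2l //; first by rewrite mulr_ge0 ?exprn_ge0 // mulrn_wge0.
have -> : n.+1%:R * phi a * decay h = n.+1%:R * phi a - phi a * h ^+ 2 *+ 4.
  by rewrite /decay; field; rewrite gt_eqF.
rewrite lerD2l lerN2 /phi; nra.
Qed.

End TranslationOperators.

(** * Discrete Laplacian and discrete Green operators *)

Section DiscreteGreen.
Variables (R : realType) (n : nat).
Local Notation X := 'rV[R]_n.+1.
Local Notation e i := (delta_mx 0 i : X).
Implicit Types (f g : X -> R) (i j : 'I_n.+1).

(** Chosen so that N + 1 steps cover exactly the length 1/2 at which the reflected sum vanishes. *)
Definition mesh (N : nat) : R := (N.+1%:R *+ 2)^-1.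

(** For this mesh [decay] is 1 - 1 / ((N + 1)^2 (n + 1)), so that this many steps reduce an iterate
    to the order 1 / (N + 1). *)
Definition steps (N : nat) := (N.+1 ^ 3 * n.+1)%N.

(** The Neumann series for the inverse of [dlap], truncated after [steps N] terms. *)
Definition green (N : nat) f : X -> R := fun x =>
  mesh N ^+ 2 * \sum_(k < steps N) iter k (walk (mesh N)) f x.

(** The rescaled generator of the walk. It tends to - 1 / (2 (n + 1)) times the Laplacian, whence
    the factors 2 (n + 1) below. *)
Definition dlap (N : nat) f : X -> R := fun x =>
  (mesh N ^+ 2)^-1 * (f x - walk (mesh N) f x).

Lemma mesh_gt0 N : 0 < mesh N.
Proof. by rewrite invr_gt0 mulrn_wgt0. Qed.

Lemma meshE N : N.+1%:R * mesh N = 2^-1 :> R.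
Proof.
have : N.+1%:R != 0 :> R by rewrite pnatr_eq0.
by rewrite /mesh; move: (N.+1%:R) => a a0; field.
Qed.

Lemma translation_op_green N : translation_op (green N).
Proof.
apply: translation_opZ; apply: translation_op_sum => k.
exact/translation_op_iter/translation_op_walk.
Qed.

Lemma translation_op_dlap N : translation_op (dlap N).
Proof.
apply: translation_opZ; apply: translation_opB; first exact: translation_op_id.
exact: translation_op_walk.
Qed.

Lemma expr_bernoulli (y : R) K : 0 <= y <= 1 -> (1 - y) ^+ K * (1 + K%:R * y) <= 1.
Proof.
move=> /andP[y0 y1]; elim: K => [|K IH]; first by rewrite mul0r addr0 mulr1.
apply: le_trans IH; rewrite exprSr -mulrA ler_wpM2l ?exprn_ge0 ?subr_ge0 //.
have : 0 <= K%:R :> R by [].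
rewrite -natr1; move: (K%:R) => k k0; nra.
Qed.

Lemma decay_mesh N : decay n (mesh N) = 1 - (N.+1%:R ^+ 2 * n.+1%:R)^-1.
Proof.
have : N.+1%:R != 0 :> R by rewrite pnatr_eq0.
have : n.+1%:R != 0 :> R by rewrite pnatr_eq0.
by rewrite /decay /mesh; move: (N.+1%:R) (n.+1%:R) => a b b0 a0; field; apply/andP.
Qed.

Lemma decay_steps N : decay n (mesh N) ^+ steps N <= N.+1%:R^-1.
Proof.
rewrite decay_mesh; set y := (_ * _)^-1.
have N1 : 1 <= N.+1%:R :> R by rewrite ler1n.
have n1 : 1 <= n.+1%:R :> R by rewrite ler1n.
have y0 : 0 <= y <= 1.
  rewrite /y invr_ge0 mulr_ge0 ?sqr_ge0 //= invf_le1 ?mulr_gt0 ?exprn_gt0 //.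
  nra.
have := expr_bernoulli (steps N) y0.
have -> : (steps N)%:R * y = N.+1%:R.
  rewrite /steps natrM natrX /y; move: N1 n1; move: (N.+1%:R) (n.+1%:R) => a b a1 b1.
  by field; rewrite !gt_eqF //; lra.
rewrite -ler_pdivlMr; last by lra.
move/le_trans; apply; rewrite mul1r lef_pV2 ?posrE //; lra.
Qed.

Lemma decay_ge0 N : 0 <= decay n (mesh N) < 1.
Proof.
have N1 : 1 <= N.+1%:R :> R by rewrite ler1n.
have n1 : 1 <= n.+1%:R :> R by rewrite ler1n.
rewrite decay_mesh; set z := (_ * _).
have z1 : 1 <= z by rewrite /z; nra.
have : 0 < z^-1 by rewrite invr_gt0; lra.
have : z^-1 <= 1 by rewrite invf_le1 //; lra.
by move=> *; apply/andP; split; lra.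
Qed.

(** The bounds on the walk sum to a geometric series with 1 - [decay] = 4 h^2 / (n + 1); this
    cancels the factor h^2 of [green], so the bound is uniform in N. *)
Lemma green_bound i f L N x : (forall x, f (x + e i) = - f x) -> lip L f ->
  0 <= L -> `|green N f x| <= n.+1%:R / 8 * L.
Proof.
move=> fa fL L0; rewrite normrM ger0_norm ?sqr_ge0 //.
set A := \sum_(k < steps N) _; pose B := \sum_(k < steps N) decay n (mesh N) ^+ k.
have AB : `|A| <= L / 2 * B.
  apply: le_trans (ler_norm_sum _ _ _) _; rewrite mulr_sumr; apply: ler_sum => k _.
  exact: walk_decay (meshE N) fa fL L0.
have /andP[q0 q1] := decay_ge0 N.
have : (1 - decay n (mesh N)) * B <= 1.
  have := subrX1 (decay n (mesh N)) (steps N); rewrite -/B.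
  have := exprn_ge0 (steps N) q0.
  by move: (_ ^+ steps N) B {AB} => a b a0 E; nra.
have -> : 1 - decay n (mesh N) = mesh N ^+ 2 *+ 4 / n.+1%:R by rewrite /decay; ring.
have n0 : 0 < n.+1%:R :> R by [].
rewrite mulrAC ler_pdivrMr // mul1r.
move: AB; move: (`|A|) B (mesh N ^+ 2) (sqr_ge0 (mesh N)) => a b c c0 h1 h2.
apply: (@le_trans _ _ (c * (L / 2 * b))); first exact: ler_wpM2l.
have -> : c * (L / 2 * b) = (c *+ 4 * b) * (L / 8) by field.
have -> : n.+1%:R / 8 * L = n.+1%:R * (L / 8) by ring.
by rewrite ler_wpM2r // divr_ge0.
Qed.

Lemma walk_steps i f L N x : (forall x, f (x + e i) = - f x) -> lip L f ->
  0 <= L -> `|iter (steps N) (walk (mesh N)) f x| <= L / N.+1%:R.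
Proof.
move=> fa fL L0.
apply: le_trans (walk_decay (steps N) x (meshE N) fa fL L0) _.
have := decay_steps N.
have /andP[q0 q1] := decay_ge0 N; have := exprn_ge0 (steps N) q0.
by move: (_ ^+ _) (_^-1) => a b a0 ab; nra.
Qed.

(** The sum telescopes; the last iterate is the error of the truncation. *)
Lemma green_dlap N f x :
  green N (dlap N f) x = f x - iter (steps N) (walk (mesh N)) f x.
Proof.
have gt := translation_op_green N.
have c0 : mesh N ^+ 2 != 0 by rewrite expf_neq0 // gt_eqF // mesh_gt0.
rewrite /dlap translation_op_scale // translation_op_sub // /green -mulrBr mulrA mulVf //.
rewrite mul1r; elim: (steps N) => [|K IH]; first by rewrite !big_ord0 subrr /= subrr.
rewrite !big_ord_recr /= opprD addrACA IH -iterSr /=.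
by rewrite addrA subrK.
Qed.

Lemma dlap_green N f x :
  dlap N (green N f) x = f x - iter (steps N) (walk (mesh N)) f x.
Proof.
rewrite -green_dlap (translation_op_comm f (translation_op_dlap N)) //.
exact: translation_op_green.
Qed.

Lemma lip_translateB L f j (t : R) : smooth f -> (forall k, lip L (partial k f)) ->
  lip (L * `|t|) (fun x => f (x + t *: e j) - f x).
Proof.
move=> fs fL; have fs' := smooth_translate (t *: e j) fs.
apply: lipP; first exact: smoothB.
by move=> k x; rewrite partialB // partial_translate; exact: fL.
Qed.

(** Increments of [green N f] are [green N] of the increments of f, and these have Lipschitz
    constant L |t|. *)
Lemma green_lip i f L N : antiperiodic i f -> 0 <= L ->
  (forall k, lip L (partial k f)) -> lip (n.+1%:R / 8 * L) (green N f).
Proof.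
move=> fa L0 fL j x t.
have gt := translation_op_green N.
have -> : green N f (x + t *: e j) - green N f x =
    green N (fun y => f (y + t *: e j) - f y) x.
  rewrite translation_op_sub //; congr (_ - _).
  have := translation_op_comm f (translation_op_translate (t *: e j)) gt.
  by move/(congr1 (@^~ x)).
rewrite -[leRHS]mulrA; apply: (@green_bound i).
- have [] : antiperiodic i (fun y => f (y + t *: e j) - f y).
    by apply: antiperiodicB => //; exact: antiperiodic_translate.
  by [].
- by apply: lip_translateB => //; exact: antiperiodic_smooth fa.
- by rewrite mulr_ge0.
Qed.

Definition laplacian f : X -> R := fun x => \sum_j partial j (partial j f) x.

(** The centred second difference is a difference of first differences; two mean values write it as
    h^2 times the second partial at a point within 2 h of x. *)
Lemma second_difference_lip f j (h : R) L x : smooth f ->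
  lip L (partial j (partial j f)) -> 0 < h ->
  `|f (x + h *: e j) + f (x - h *: e j) - 2 * f x - h ^+ 2 * partial j (partial j f) x|
    <= h ^+ 2 * (L * (2 * h)).
Proof.
move=> fs fL h0.
have fs' := smooth_translate (h *: e j) fs.
have [s sh E] := MVT_line j x (- h) (smoothB fs' fs).
have [s' sh' E'] := MVT_line j (x + s *: e j) h (smooth_partial j fs).
rewrite normrN (gtr0_norm h0) in sh; rewrite (gtr0_norm h0) in sh'.
have -> : f (x + h *: e j) + f (x - h *: e j) - 2 * f x =
    h ^+ 2 * partial j (partial j f) (x + (s + s') *: e j).
  rewrite (_ : _ - _ = - (f (x + - h *: e j + h *: e j) - f (x + - h *: e j)
      - (f (x + h *: e j) - f x))); last first.
    by rewrite scaleNr subrK; ring.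
  rewrite E (partialB _ fs' fs) partial_translate E' scalerDl addrA; ring.
rewrite -mulrBr normrM [`|h ^+ 2|]ger0_norm ?sqr_ge0 // ler_wpM2l ?sqr_ge0 //.
have L0 : 0 <= L.
  by have := le_trans (normr_ge0 _) (fL j x 1); rewrite normr1 mulr1.
apply: le_trans (fL j _ _) _; rewrite ler_wpM2l //.
by apply: le_trans (ler_normD _ _) _; lra.
Qed.

Lemma dlap_consistency N f L x : smooth f ->
  (forall j, lip L (partial j (partial j f))) ->
  `|dlap N f x + (n.+1%:R *+ 2)^-1 * laplacian f x| <= L / N.+1%:R.
Proof.
move=> fs fL; set h := mesh N; have h0 : 0 < h := mesh_gt0 N.
pose D j := f (x + h *: e j) + f (x - h *: e j) - 2 * f x.
have d0 : n.+1%:R != 0 :> R by rewrite pnatr_eq0.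
have hn0 : h != 0 by rewrite gt_eqF.
have -> : dlap N f x + (n.+1%:R *+ 2)^-1 * laplacian f x =
  - ((n.+1%:R *+ 2)^-1 * (h ^+ 2)^-1 *
      \sum_j (D j - h ^+ 2 * partial j (partial j f) x)).
  rewrite sumrB -mulr_sumr /dlap -/h /walk /laplacian /D.
  rewrite [\sum_j (_ + _ - _)]sumrB sumr_const card_ord -(mulr_natr (2 * f x)).
  move: (\sum_j _) (\sum_j _) (n.+1%:R) d0 => u v a a0; field; exact/andP.
rewrite normrN normrM ger0_norm; last first.
  by rewrite mulr_ge0 ?invr_ge0 ?sqr_ge0 // mulrn_wge0.
apply: (@le_trans _ _ ((n.+1%:R *+ 2)^-1 * (h ^+ 2)^-1 * (h ^+ 2 * (L * (2 * h)) *+ n.+1))).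
  apply: ler_wpM2l; first by rewrite mulr_ge0 ?invr_ge0 ?sqr_ge0 // mulrn_wge0.
  rewrite -[n.+1 in X in _ <= X]card_ord -sumr_const.
  apply: le_trans (ler_norm_sum _ _ _) _; apply: ler_sum => j _.
  exact: second_difference_lip.
have L0 : 0 <= L.
  by have := le_trans (normr_ge0 _) (fL 0 0 x 1); rewrite normr1 mulr1.
have -> : (n.+1%:R *+ 2)^-1 * (h ^+ 2)^-1 * (h ^+ 2 * (L * (2 * h)) *+ n.+1) = L * h.
  by rewrite -(mulr_natr (h ^+ 2 * _)); move: (n.+1%:R) d0 => a a0; field; apply/andP.
apply: ler_wpM2l => //; rewrite /h /mesh lef_pV2 ?posrE ?mulrn_wgt0 //.
by rewrite mulr2n lerDl.
Qed.

End DiscreteGreen.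

(** * The limit Green operator on antiperiodic functions *)

Section GreenOperator.
Variables (R : realType) (n : nat).
Local Notation X := 'rV[R]_n.+1.
Local Notation e i := (delta_mx 0 i : X).
Implicit Types (f g : X -> R) (i j : 'I_n.+1).
Local Notation c8 := (n.+1%:R / 8 : R).

Lemma lip_continuous L f : lip L f -> continuous f.
Proof.
move=> fL x.
have path (r : seq 'I_n.+1) (c : 'I_n.+1 -> R) y :
    `|f (y + \sum_(j <- r) c j *: e j) - f y| <= \sum_(j <- r) L * `|c j|.
  elim: r y => [|j r IH] y; first by rewrite !big_nil addr0 subrr normr0.
  rewrite !big_cons addrA -(subrK (f (y + c j *: e j)) (f (_ + _ + _))) -addrA addrC.
  by apply: le_trans (ler_normD _ _) _; apply: lerD.
have L0 : 0 <= L.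
  by have := le_trans (normr_ge0 _) (fL 0 x 1); rewrite normr1 mulr1.
apply/(@cvgrPdist_le _ _ _ (nbhs x) (nbhs_filter x)) => eps eps0.
pose d := eps / (L * n.+1%:R + 1).
have c0 : 0 < L * n.+1%:R + 1 by rewrite ltr_wpDl // mulr_ge0.
have d0 : 0 < d by rewrite divr_gt0.
apply/nbhs_ballP; exists d => //= y; rewrite -ball_normE /= => xy.
have yE : x = y + \sum_j (x - y) 0 j *: e j.
  by rewrite -row_sum_delta addrC subrK.
rewrite {1}yE; apply: le_trans (path _ _ _) _.
apply: (@le_trans _ _ (\sum_(j < n.+1) L * d)).
  apply: ler_sum => j _; apply: ler_wpM2l => //; apply: le_trans (ltW xy).
  by rewrite [leRHS]/Num.Def.normr /= mx_normrE; apply: (le_bigmax _ _ (0, j)).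
rewrite sumr_const card_ord -(mulr_natr (L * d)) mulrAC /d mulrA ler_pdivrMr //.
by rewrite mulrC ler_wpM2l ?(ltW eps0) // lerDl.
Qed.

Lemma Cbound_partial m C f j : Cbound m.+1 C f -> Cbound m C (partial j f).
Proof. by move=> [_ /(_ j)]. Qed.

(** Write G for [green] and D for [dlap]. As D inverts G up to the last iterate of the walk, G_N -
    G_M equals G_N G_M (D_M - D_N) plus remainders, as in the resolvent identity. Consistency makes
    D_M - D_N small; each of the two G costs one derivative and consistency three, whence the order
    5. *)
Lemma green_cauchy i f C N M x : antiperiodic i f -> Cbound 5 C f ->
  `|green N f x - green M f x| <= (c8 * c8 + c8) * C * (N.+1%:R^-1 + M.+1%:R^-1).
Proof.
move=> fa fC; have C0 := Cbound_ge0 fC.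
pose rem K := iter (steps n K) (walk (mesh R K)) f.
pose r := fun y => dlap M f y - dlap N f y.
have gt K := translation_op_green R n K; have lt K := translation_op_dlap R n K.
have remt K := translation_op_iter (steps n K) (translation_op_walk n (mesh R K)).
have fE K : f = fun y => dlap K (green K f) y + rem K y.
  by apply/funext => y; rewrite dlap_green subrK.
have gE K K' : green K f = fun y => green K (dlap K' (green K' f)) y + green K (rem K') y.
  by rewrite {1}(fE K') translation_op_add.
have -> : green N f x - green M f x =
    green N (green M r) x + (green N (rem M) x - green M (rem N) x).
  have -> : green N (green M r) x =
      green N (dlap M (green M f)) x - green M (dlap N (green N f)) x.
    rewrite /r (translation_op_sub _ _ (gt M)) (translation_op_sub _ _ (gt N)).
    rewrite (translation_op_comm f (gt M) (lt M)).
    by rewrite (translation_op_comm _ (gt N) (gt M)) (translation_op_comm f (gt N) (lt N)).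
  have /(congr1 (@^~ x)) /= -> := gE N M; have /(congr1 (@^~ x)) /= -> := gE M N.
  ring.
have fs := antiperiodic_smooth fa.
have pa k : antiperiodic i (partial k f) by exact: antiperiodic_partial.
have ra : antiperiodic i r.
  by apply: antiperiodicB; apply: translation_op_antiperiodic.
have n8 : 0 <= c8 by rewrite divr_ge0.
have inv0 K : 0 <= K.+1%:R^-1 :> R by rewrite invr_ge0.
have H1 : `|green N (green M r) x| <= c8 * (c8 * (C * (N.+1%:R^-1 + M.+1%:R^-1))).
  apply: (@green_bound _ _ i).
  - by have [] : antiperiodic i (green M r) by exact: translation_op_antiperiodic.
  - apply: (green_lip _ ra); first by rewrite mulr_ge0 ?addr_ge0.
    move=> k; have pr K : partial k (dlap K f) = dlap K (partial k f).
      exact: translation_op_partial.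
    have Da K g : antiperiodic i g -> smooth (dlap K g).
      by move=> ga; apply: antiperiodic_smooth; apply: translation_op_antiperiodic ga.
    rewrite /r (partialB _ (Da M f fa) (Da N f fa)) !pr.
    apply: lipP; first by apply: smoothB; exact: Da.
    move=> l y; rewrite (partialB _ (Da M _ (pa k)) (Da N _ (pa k))).
    have pks : smooth (partial k f) by exact: smooth_partial.
    rewrite !(translation_op_partial _ (lt _) pks).
    have pkls : smooth (partial l (partial k f)) by exact: smooth_partial.
    have cons K : `|dlap K (partial l (partial k f)) y +
        (n.+1%:R *+ 2)^-1 * laplacian (partial l (partial k f)) y| <= C / K.+1%:R.
      apply: dlap_consistency => // j; apply: (@Cbound_lip _ _ 0).
        by do 2!apply: smooth_partial.
      by do 4!apply: Cbound_partial.
    move: (cons M) (cons N); move: (dlap M _ _) (dlap N _ _) (_ * laplacian _ _) => a b c aM bN.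
    rewrite (_ : a - b = (a + c) - (b + c)); last by ring.
    by apply: le_trans (ler_normB _ _) _; rewrite mulrDr addrC; apply: lerD.
  - by rewrite mulr_ge0 // mulr_ge0 // addr_ge0.
have H2 K K' : `|green K (rem K') x| <= c8 * (C / K'.+1%:R).
  have rema : antiperiodic i (rem K') by exact: (translation_op_antiperiodic (remt K') fa).
  apply: (@green_bound _ _ i); last by rewrite mulr_ge0.
    by case: rema.
  apply: lipP; first exact: antiperiodic_smooth rema.
  move=> k y; rewrite (translation_op_partial _ (remt K') fs).
  apply: (@walk_steps _ _ i) => //; first by case: (pa k).
  by apply: (@Cbound_lip _ _ 0); [exact: smooth_partial | apply: Cbound_partial; apply: Cbound_le fC].
apply: le_trans (ler_normD _ _) _; rewrite -!mulrA mulrDl; apply: lerD; first by rewrite -!mulrA in H1 *.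
apply: le_trans (ler_normB _ _) _.
by rewrite !mulrDr [leRHS]addrC; apply: lerD; exact: H2.
Qed.

(** The sequence converges for antiperiodic f, by [green_cvg], hence for sums of such; without
    convergence [lim] is a default value. *)
Definition green_lim f : X -> R := fun x => lim (green N f x @[N --> \oo]).

Lemma harmonic_le (eps : R) : 0 < eps -> \forall N \near \oo, N.+1%:R^-1 <= eps.
Proof.
move=> eps0; near=> N; rewrite -[leRHS]invrK lef_pV2 ?posrE ?invr_gt0 //.
apply: (@le_trans _ _ N%:R); last by rewrite ler_nat.
by near: N; exact: nbhs_infty_ger.
Unshelve. all: by end_near. Qed.

Lemma cvg_of_rate (u : nat -> R) (l C : R) :
  (forall N, `|u N - l| <= C / N.+1%:R) -> u N @[N --> \oo] --> l.
Proof.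
move=> uC; have C0 : 0 <= C.
  by have := le_trans (normr_ge0 _) (uC 0%N); rewrite divr1.
apply/cvgrPdist_le => eps eps0; near=> N; rewrite distrC.
apply: le_trans (uC N) _; rewrite (@le_trans _ _ (C * (eps / (C + 1)))) //.
  apply: ler_wpM2l => //; near: N; apply: harmonic_le; by rewrite divr_gt0 // ltr_wpDl.
rewrite mulrCA ler_piMr ?(ltW eps0) // ler_pdivrMr ?mul1r ?lerDl //.
by rewrite ltr_wpDl.
Unshelve. all: by end_near. Qed.

Lemma lim_norm_le (u : nat -> R) (l B : R) :
  u N @[N --> \oo] --> l -> (forall N, `|u N| <= B) -> `|l| <= B.
Proof.
move=> ul uB; have ul' : `|u N| @[N --> \oo] --> `|l| by exact: cvg_norm.
rewrite -(cvg_lim _ ul') //; apply: limr_le; first exact: (cvgP _ ul').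
by near=> N; exact: uB.
Unshelve. all: by end_near. Qed.

Lemma green_cvg i f x : antiperiodic i f ->
  green N f x @[N --> \oo] --> green_lim f x.
Proof.
move=> fa; have [C fC] := antiperiodic_Cbound 5 fa.
pose K := (c8 * c8 + c8) * C.
have K0 : 0 <= K.
  by rewrite mulr_ge0 ?(Cbound_ge0 fC) // addr_ge0 ?mulr_ge0 ?divr_ge0.
suff : cvg (green N f x @[N --> \oo]) by [].
apply: cauchy_cvg; apply: cauchy_exP => eps eps0.
have d0 : 0 < eps / (K * 2 + 1) by rewrite divr_gt0 // ltr_wpDl // mulr_ge0.
have [N0 _ HN0] := harmonic_le d0.
have HN N : (N0 <= N)%N -> N.+1%:R^-1 <= eps / (K * 2 + 1) by exact: HN0.
exists (green N0 f x); change (\forall N \near \oo, ball (green N0 f x) eps (green N f x)).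
near=> N; rewrite -ball_normE /=.
apply: le_lt_trans (green_cauchy N0 N x fa fC) _; rewrite -/K.
apply: (@le_lt_trans _ _ (K * (eps / (K * 2 + 1) + eps / (K * 2 + 1)))).
  apply: ler_wpM2l => //; apply: lerD; apply: HN => //.
  by near: N; exact: nbhs_infty_ge.
rewrite (_ : K * _ = eps * (K * 2 / (K * 2 + 1))); last by ring.
by rewrite gtr_pMr // ltr_pdivrMr ?mul1r ?ltrDl // ltr_wpDl // mulr_ge0.
Unshelve. all: by end_near. Qed.

Lemma green_lim_bound i f L x : antiperiodic i f -> lip L f -> 0 <= L ->
  `|green_lim f x| <= c8 * L.
Proof.
move=> fa fL L0; apply: (lim_norm_le (green_cvg (x := x) fa)) => N.
by apply: (@green_bound _ _ i) => //; case: fa.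
Qed.

Lemma green_limD i j f g x : antiperiodic i f -> antiperiodic j g ->
  green_lim (fun y => f y + g y) x = green_lim f x + green_lim g x.
Proof.
move=> fa ga; rewrite /green_lim.
under eq_fun do rewrite (translation_op_add _ _ (translation_op_green _ _ _)).
by apply: cvg_lim => //; apply: cvgD; [exact: green_cvg fa | exact: green_cvg ga].
Qed.

Lemma green_limZ i c f x : antiperiodic i f ->
  green_lim (fun y => c * f y) x = c * green_lim f x.
Proof.
move=> fa; rewrite /green_lim.
under eq_fun do rewrite (translation_op_scale _ _ (translation_op_green _ _ _)).
by apply: cvg_lim => //; apply: cvgMr; exact: green_cvg fa.
Qed.

Lemma green_limB i f g x : antiperiodic i f -> antiperiodic i g ->
  green_lim (fun y => f y - g y) x = green_lim f x - green_lim g x.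
Proof.
move=> fa ga.
have E : (fun y => f y - g y) = (fun y => f y + -1 * g y).
  by apply/funext => y; rewrite mulN1r.
rewrite E (green_limD x fa (antiperiodicZ (-1) ga)) (green_limZ _ _ ga).
by rewrite mulN1r.
Qed.

Lemma green_translate N f v x : green N f (x + v) = green N (fun y => f (y + v)) x.
Proof.
have := translation_op_comm f (translation_op_translate v) (translation_op_green R n N).
by move/(congr1 (@^~ x)).
Qed.

Lemma green_lim_translate f v x :
  green_lim f (x + v) = green_lim (fun y => f (y + v)) x.
Proof. by rewrite /green_lim; under eq_fun do rewrite green_translate. Qed.

Lemma green_lim_lip i f C : antiperiodic i f -> Cbound 2 C f ->
  lip (c8 * C) (green_lim f).
Proof.
move=> fa fC j x t; have C0 := Cbound_ge0 fC.
rewrite green_lim_translate -(green_limB x (antiperiodic_translate _ fa) fa).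
rewrite -[leRHS]mulrA; apply: (@green_lim_bound i); last by rewrite mulr_ge0.
  by apply: antiperiodicB => //; exact: antiperiodic_translate.
have fs := antiperiodic_smooth fa.
apply: lip_translateB => // k.
by apply: Cbound_lip; [exact: smooth_partial | exact: Cbound_partial fC].
Qed.

(** By linearity and translation invariance the left side is [green_lim] of the Taylor remainder f
    (y + t e_j) - f y - t d_j f y, whose partials are of order t^2. Differentiability thus follows
    from the uniform bound, without exchanging limits. *)
Lemma green_lim_taylor i f C j x (t : R) : antiperiodic i f -> Cbound 4 C f ->
  `|green_lim f (x + t *: e j) - green_lim f x - t * green_lim (partial j f) x|
   <= c8 * C * t ^+ 2.
Proof.
move=> fa fC; have C0 := Cbound_ge0 fC; have fs := antiperiodic_smooth fa.
have ta := antiperiodic_translate (t *: e j) fa.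
have pa := antiperiodic_partial j fa.
rewrite green_lim_translate -(green_limB x ta fa) -(green_limZ _ _ pa).
rewrite -(green_limB _ (antiperiodicB ta fa) (antiperiodicZ t pa)).
rewrite -[leRHS]mulrA; apply: (@green_lim_bound i); last by rewrite mulr_ge0 ?sqr_ge0.
  by apply: antiperiodicB; [exact: antiperiodicB | exact: antiperiodicZ].
have ts := antiperiodic_smooth ta; have ps := antiperiodic_smooth pa.
have tfs := smoothB ts fs; have tps := smoothZ t ps.
apply: lipP => [|k y]; first exact: smoothB tfs tps.
rewrite (partialB _ tfs tps) (partialB _ ts fs) (partialZ _ _ ps) partial_translate.
have [s st ->] := MVT_line j y t (smooth_partial k fs).
rewrite (partialC _ _ fs) -mulrBr normrM.
have H : lip C (partial k (partial j f)).
  apply: Cbound_lip (Cbound_partial k (Cbound_partial j fC)).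
  by do 2!apply: smooth_partial.
apply: le_trans (ler_wpM2l (normr_ge0 t) (H j y s)) _.
by rewrite -[t ^+ 2]real_normK ?num_real // expr2 mulrCA ler_wpM2l // ler_wpM2l.
Qed.

Lemma derive_of_taylor (u : X -> R) j x (a C : R) :
  (forall t : R, `|u (x + t *: e j) - u x - t * a| <= C * t ^+ 2) ->
  derivable u x (e j) /\ partial j u x = a.
Proof.
move=> uC; have C0 : 0 <= C.
  by have := le_trans (normr_ge0 _) (uC 1); rewrite expr1n mulr1.
suff H : h^-1 *: ((u \o shift x) (h *: e j) - u x) @[h --> 0^'] --> a.
  by split; [apply/cvg_ex; exists a | exact: cvg_lim H].
apply/cvgrPdist_le => eps eps0; near=> h.
have h0 : h != 0 by near: h; exact: nbhs_dnbhs_neq.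
have hle : `|h| <= eps / (C + 1).
  by near: h; apply: dnbhs0_le; rewrite divr_gt0 // ltr_wpDl.
rewrite -(ler_pM2l (x := `|h|)) ?normr_gt0 // -normrM mulrBr /= mulVKf //.
rewrite -normrN opprB [h *: _ + x]addrC; apply: le_trans (uC h) _.
rewrite -[h ^+ 2]real_normK ?num_real // expr2 mulrCA ler_wpM2l //.
rewrite mulrC; apply: le_trans (ler_wpM2r C0 hle) _.
by rewrite mulrAC ler_pdivrMr ?ltr_wpDl // ler_wpM2l ?(ltW eps0) // lerDl.
Unshelve. all: by end_near. Qed.

Lemma green_lim_partial i f j : antiperiodic i f ->
  (forall x, derivable (green_lim f) x (e j)) /\
  partial j (green_lim f) = green_lim (partial j f).
Proof.
move=> fa; have [C fC] := antiperiodic_Cbound 4 fa.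
have H x := derive_of_taylor (fun t => green_lim_taylor j x t fa fC).
by split=> [x|]; [have [] := H x | apply/funext => x; have [] := H x].
Qed.

Lemma green_lim_smooth i f : antiperiodic i f -> smooth (green_lim f).
Proof.
move=> fa k; elim: k f fa => [|k IH] f fa.
  have [C fC] := antiperiodic_Cbound 2 fa.
  exact: lip_continuous (green_lim_lip fa fC).
move=> j; have [fd ->] := green_lim_partial j fa; split=> //.
by apply: IH; exact: antiperiodic_partial.
Qed.

Lemma antiperiodic_laplacian i f : antiperiodic i f -> antiperiodic i (laplacian f).
Proof.
by move=> fa; apply: antiperiodic_sum => j; do 2!apply: antiperiodic_partial.
Qed.

(** With c = 1 / (2 (n + 1)), [dlap N f] + c [laplacian f] is small together with its first
    partials, and [green N] inverts [dlap N] up to the last iterate; both errors are of order 1 / (N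
    + 1). *)
Lemma green_lim_laplacian i f x : antiperiodic i f ->
  green_lim (laplacian f) x = - (n.+1%:R *+ 2) * f x.
Proof.
move=> fa; have [C fC] := antiperiodic_Cbound 4 fa.
have C0 := Cbound_ge0 fC; have fs := antiperiodic_smooth fa.
have n8 : 0 <= c8 by rewrite divr_ge0.
have la := antiperiodic_laplacian fa.
pose c : R := (n.+1%:R *+ 2)^-1.
have c0 : n.+1%:R *+ 2 != 0 :> R by rewrite gt_eqF // mulrn_wgt0.
suff H : green N (fun y => c * laplacian f y) x @[N --> \oo] --> - f x.
  have := cvg_unique _ H (green_cvg (x := x) (antiperiodicZ c la)).
  by rewrite (green_limZ _ _ la) => /(_ (@Rhausdorff _)) E; rewrite mulNr -mulrN E /c mulVKf.
apply: (@cvg_of_rate _ _ ((c8 + 1) * C)) => N.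
have gt := translation_op_green R n N; have dt := translation_op_dlap R n N.
have -> : green N (fun y => c * laplacian f y) x - - f x =
    green N (fun y => dlap N f y + c * laplacian f y) x +
    iter (steps n N) (walk (mesh R N)) f x.
  by rewrite translation_op_add // green_dlap; ring.
apply: le_trans (ler_normD _ _) _; rewrite -mulrA mulrDl mul1r; apply: lerD.
  have da : antiperiodic i (dlap N f) by exact: translation_op_antiperiodic.
  have sa : antiperiodic i (fun y => dlap N f y + c * laplacian f y).
    exact: antiperiodicD da (antiperiodicZ c la).
  apply: (@green_bound _ _ i); [by case: sa| |by rewrite mulr_ge0 // invr_ge0].
  apply: lipP => [|k y]; first exact: antiperiodic_smooth sa.
  have ls := antiperiodic_smooth la; have ds := antiperiodic_smooth da.
  rewrite (partialD _ ds (smoothZ c ls)) (partialZ _ _ ls).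
  rewrite (translation_op_partial _ dt fs).
  have -> : partial k (laplacian f) = laplacian (partial k f).
    rewrite /laplacian partial_sum => [|j]; last by do 2!apply: smooth_partial.
    apply/funext => z; apply: eq_bigr => j _.
    by rewrite (partialC _ _ (smooth_partial j fs)) (partialC k j fs).
  have ks := smooth_partial k fs.
  apply: dlap_consistency => // j; apply: (@Cbound_lip _ _ 0).
    by do 2!apply: smooth_partial.
  by do 3!apply: Cbound_partial.
apply: (@walk_steps _ _ i) => //; first by case: fa.
by apply: (@Cbound_lip _ _ 3).
Qed.

End GreenOperator.

(** * Sums of antiperiodic functions and signed affine maps *)

Section Balanced.
Variables (R : realType) (n : nat).
Local Notation X := 'rV[R]_n.+1.
Local Notation e i := (delta_mx 0 i : X).
Implicit Types (f : X -> R) (i j : 'I_n.+1).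

(** The domain on which the Green operator is used: one summand, possibly zero, for each direction,
    so that its properties pass from the summands to the sum. *)
Definition balanced f := exists2 F : 'I_n.+1 -> X -> R,
  forall i, antiperiodic i (F i) & f = fun x => \sum_i F i x.

Lemma balancedD f g : balanced f -> balanced g -> balanced (fun x => f x + g x).
Proof.
move=> [F Fa ->] [G Ga ->]; exists (fun i x => F i x + G i x).
  by move=> i; exact: antiperiodicD.
by apply/funext => x; rewrite big_split.
Qed.

Lemma balanced0 : balanced (fun=> 0).
Proof.
exists (fun _ _ => 0); last by apply/funext => x; rewrite big1.
by move=> i; split => [|//|x]; [exact: smooth_cst | rewrite oppr0].
Qed.

Lemma balanced_sum I (r : seq I) (F : I -> X -> R) :
  (forall a, balanced (F a)) -> balanced (fun x => \sum_(a <- r) F a x).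
Proof.
move=> Fb; elim: r => [|a r IH].
  by under eq_fun do rewrite big_nil; exact: balanced0.
by under eq_fun do rewrite big_cons; exact: balancedD.
Qed.

Lemma balanced_smooth f : balanced f -> smooth f.
Proof.
by move=> [F Fa ->]; apply: smooth_sum => i; exact: antiperiodic_smooth (Fa i).
Qed.

Lemma balanced_partial j f : balanced f -> balanced (partial j f).
Proof.
move=> [F Fa ->]; exists (fun i => partial j (F i)).
  by move=> i; exact: antiperiodic_partial.
by rewrite partial_sum // => i; exact: antiperiodic_smooth (Fa i).
Qed.

Lemma green_sum I (r : seq I) (F : I -> X -> R) N x :
  green N (fun y => \sum_(a <- r) F a y) x = \sum_(a <- r) green N (F a) x.
Proof.
have [s Hs] := translation_op_green R n N; rewrite Hs.
under eq_bigr do rewrite mulr_sumr; rewrite exchange_big.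
by apply: eq_bigr => a _; rewrite Hs.
Qed.

Lemma cvgn_sum I (r : seq I) (u : I -> nat -> R) (l : I -> R) :
  (forall a, u a N @[N --> \oo] --> l a) ->
  \sum_(a <- r) u a N @[N --> \oo] --> \sum_(a <- r) l a.
Proof.
move=> ul; elim: r => [|a r IH].
  by under eq_fun do rewrite big_nil; rewrite big_nil; exact: cvg_cst.
by under eq_fun do rewrite big_cons; rewrite big_cons; apply: cvgD.
Qed.

Lemma balanced_green_cvg f x : balanced f ->
  green N f x @[N --> \oo] --> green_lim f x.
Proof.
move=> [F Fa fE].
have H : green N f x @[N --> \oo] --> \sum_i green_lim (F i) x.
  rewrite fE; under eq_fun do rewrite green_sum.
  by apply: cvgn_sum => i; exact: green_cvg (Fa i).
by rewrite /green_lim (cvg_lim _ H).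
Qed.

Lemma green_lim_sum (F : 'I_n.+1 -> X -> R) : (forall i, antiperiodic i (F i)) ->
  green_lim (fun x => \sum_i F i x) = fun x => \sum_i green_lim (F i) x.
Proof.
move=> Fa; apply/funext => x; apply: cvg_lim => //.
under eq_fun do rewrite green_sum.
by apply: cvgn_sum => i; exact: green_cvg (Fa i).
Qed.

Lemma balanced_green_lin I (r : seq I) (c : I -> R) (F : I -> X -> R) x :
  (forall a, balanced (F a)) ->
  green_lim (fun y => \sum_(a <- r) c a * F a y) x =
  \sum_(a <- r) c a * green_lim (F a) x.
Proof.
move=> Fb; apply: cvg_lim => //.
under eq_fun => N do rewrite green_sum.
apply: cvgn_sum => a.
under eq_fun do rewrite (translation_op_scale _ _ (translation_op_green _ _ _)).
by apply: cvgMr; exact: balanced_green_cvg.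
Qed.

Lemma balanced_green_smooth f : balanced f -> smooth (green_lim f).
Proof.
move=> [F Fa ->]; rewrite green_lim_sum //; apply: smooth_sum => i.
exact: green_lim_smooth (Fa i).
Qed.

Lemma balanced_green_partial f j : balanced f ->
  partial j (green_lim f) = green_lim (partial j f).
Proof.
move=> [F Fa ->]; rewrite green_lim_sum //.
have Fs i : smooth (F i) := antiperiodic_smooth (Fa i).
have Gs i : smooth (green_lim (F i)) := green_lim_smooth (Fa i).
rewrite (partial_sum _ _ Gs) (partial_sum _ _ Fs).
rewrite green_lim_sum; last by move=> i; exact: antiperiodic_partial.
by apply/funext => x; apply: eq_bigr => i _; rewrite (green_lim_partial j (Fa i)).2.
Qed.

Lemma balanced_green_laplacian f : balanced f ->
  green_lim (laplacian f) = (fun x => - (n.+1%:R *+ 2) * f x).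
Proof.
move=> [F Fa ->].
have -> : laplacian (fun x => \sum_i F i x) = fun x => \sum_i laplacian (F i) x.
  apply/funext => x; rewrite /laplacian exchange_big; apply: eq_bigr => j _.
  rewrite !partial_sum // => i; first by apply: smooth_partial; exact: antiperiodic_smooth (Fa i).
  exact: antiperiodic_smooth (Fa i).
rewrite green_lim_sum; last by move=> i; exact: antiperiodic_laplacian.
by apply/funext => x; rewrite mulr_sumr; apply: eq_bigr => i _; rewrite (green_lim_laplacian x (Fa i)).
Qed.

Lemma laplacian_green f : balanced f ->
  laplacian (green_lim f) = (fun x => - (n.+1%:R *+ 2) * f x).
Proof.
move=> fb; rewrite -balanced_green_laplacian //.
apply/funext => x; rewrite /laplacian.
have -> : green_lim (fun y => \sum_j partial j (partial j f) y) x =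
    green_lim (fun y => \sum_j 1 * partial j (partial j f) y) x.
  by congr (green_lim _ x); apply/funext => y; under [RHS]eq_bigr do rewrite mul1r.
rewrite balanced_green_lin; last by move=> j; do 2!apply: balanced_partial.
apply: eq_bigr => j _; rewrite mul1r balanced_green_partial //.
by rewrite balanced_green_partial //; exact: balanced_partial.
Qed.

Definition average (V : lmodType R) i (f : X -> V) : X -> V :=
  fun x => 2^-1 *: (f x + f (x + e i)).

(** Split f into its average over x and x + e_a and half the difference f x - f (x + e_a), which is
    antiperiodic along e_a; then continue with the average along the rest of r. *)
Lemma average_decomposition (r : seq 'I_n.+1) f : smooth f ->
  (forall j x, f (x + 2 *: e j) = f x) ->
  exists2 F : 'I_n.+1 -> X -> R, forall i, antiperiodic i (F i) &
    f = fun x => foldl (fun g i => average i (g : X -> R^o)) f r x + \sum_i F i x.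
Proof.
elim: r f => [|a r IH] f fs fp.
  exists (fun _ _ => 0); last by apply/funext => x; rewrite /= big1 ?addr0.
  by move=> i; split => [|//|x]; [exact: smooth_cst | rewrite oppr0].
have fs' := smooth_translate (e a) fs.
have as_ : smooth (average a (f : X -> R^o)) by apply: smoothZ; exact: smoothD.
have ap j x : average a (f : X -> R^o) (x + 2 *: e j) = average a (f : X -> R^o) x.
  by rewrite /average fp addrAC fp.
have [F Fa fE] := IH _ as_ ap.
pose G x := 2^-1 * (f x - f (x + e a)).
have Ga : antiperiodic a G.
  split; first by apply: (smoothZ 2^-1); exact: smoothB.
    by move=> j x; rewrite /G fp addrAC fp.
  move=> x; rewrite /G -addrA -(scale1r (e a)) -scalerDl fp.
  by rewrite scale1r -mulrN opprB.
(* The direction a may occur again later in r, so the new antiperiodic part is added to the summand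
   already there. *)
exists (fun i => if i == a then fun x => F i x + G x else F i).
  by move=> i; case: eqP => [->|_] //; exact: antiperiodicD.
apply/funext => x /=.
rewrite (bigD1 a) //= eqxx (eq_bigr (fun i => F i x)) => [|i /negPf -> //].
rewrite addrAC -addrA addrA addrAC addrA.
have /(congr1 (@^~ x)) /= E := fE; rewrite (bigD1 a) //= in E.
move: E; rewrite {1}/average /G /=; set S := foldl _ _ _ _; set T := \sum_(_ | _) _.
by rewrite /GRing.scale /=; move=> E; lra.
Qed.

Lemma balanced_of_average f (r : seq 'I_n.+1) : smooth f ->
  (forall j x, f (x + 2 *: e j) = f x) ->
  (forall x, foldl (fun g i => average i (g : X -> R^o)) f r x = 0) -> balanced f.
Proof.
move=> fs fp f0; have [F Fa fE] := average_decomposition r fs fp.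
exists F => //; rewrite {1}fE; apply/funext => x; by rewrite f0 add0r.
Qed.

(* Affine maps with diagonal linear part of entries [+1] ([s j = false]) or
   [-1] ([s j = true]). *)
Definition signed_affine (s : 'I_n.+1 -> bool) (g : X -> X) :=
  forall x j (t : R), g (x + t *: e j) = g x + (-1) ^+ s j * t *: e j.

(** A change of sign of the coordinate j interchanges the two neighbours along e_j, which have equal
    weight. *)
Lemma walk_signed_affine s g h f x : signed_affine s g ->
  walk h f (g x) = walk h (f \o g) x.
Proof.
move=> gs; rewrite /walk; congr (_ * _); apply: eq_bigr => j _ /=.
rewrite -(scaleNr h) !gs.
by case: (s j); rewrite ?expr0 ?expr1 ?mul1r ?mulN1r ?opprK ?scaleNr // addrC.
Qed.

Lemma green_lim_signed_affine s g f x : signed_affine s g ->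
  green_lim f (g x) = green_lim (f \o g) x.
Proof.
move=> gs; rewrite /green_lim.
suff E N : green N f (g x) = green N (f \o g) x by under eq_fun do rewrite E.
rewrite /green; congr (_ * _); apply: eq_bigr => k _.
have : (iter k (walk (mesh R N)) f) \o g = iter k (walk (mesh R N)) (f \o g).
  elim: (k : nat) => [|m IH] //=; rewrite -IH.
  by apply/funext => y /=; exact: walk_signed_affine gs.
by move/(congr1 (@^~ x)).
Qed.

Lemma near_dnbhs0_sign (b : bool) (P : set R) :
  (\forall h \near 0^', P h) -> \forall h \near 0^', P ((-1) ^+ b * h).
Proof.
move=> /nbhs_ballP [d /= d0 H]; apply/nbhs_ballP; exists d => // h hd h0; apply: H.
  by move: hd; rewrite -!ball_normE /= !sub0r !normrN normrM normrX normrN1 expr1n mul1r.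
by rewrite mulf_neq0 // signr_eq0.
Qed.

Lemma partial_signed_affine (V : normedModType R) s g (f : X -> V) j x :
  signed_affine s g -> derivable f (g x) (e j) ->
  derivable (f \o g) x (e j) /\
  partial j (f \o g) x = (-1) ^+ s j *: partial j f (g x).
Proof.
move=> gs fd; set c := (-1) ^+ s j.
have cc : c * c = 1 by rewrite -expr2 sqrr_sign.
suff H : h^-1 *: (((f \o g) \o shift x) (h *: e j) - (f \o g) x) @[h --> 0^'] -->
    c *: partial j f (g x).
  split; first by apply/cvg_ex; exists (c *: partial j f (g x)).
  exact: cvg_lim H.
apply/cvgrPdist_le => eps eps0.
have /cvgrPdist_le /(_ _ eps0) /(near_dnbhs0_sign (s j)) := fd.
apply: filterS => h; rewrite -/c => H.
have -> : h^-1 *: (((f \o g) \o shift x) (h *: e j) - (f \o g) x) =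
  c *: ((c * h)^-1 *: ((f \o shift (g x)) ((c * h) *: e j) - f (g x))).
  rewrite scalerA invfM mulrA divff ?mul1r ?signr_eq0 //=.
  by rewrite [h *: _ + x]addrC gs -/c [(c * h) *: _ + _]addrC.
rewrite -scalerBr normrZ normrX normrN1 expr1n mul1r; exact: H.
Qed.

End Balanced.

(** * The bundle of 2-forms of type 7 *)

Section SignedSums.
Variables (R : realType) (V : lmodType R) (T : Type) (v : T -> V).

(** Signs are booleans, true for minus, and terms are data, so that identities between such sums
    reduce to concrete lists and are decided by computation. *)
Definition signed_sum (s : seq (bool * T)) : V := \sum_(p <- s) (-1) ^+ p.1 *: v p.2.

Lemma signed_sum_cat s t : signed_sum (s ++ t) = signed_sum s + signed_sum t.
Proof. exact: big_cat. Qed.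

Lemma signed_sum_cons b x s : signed_sum ((b, x) :: s) = (-1) ^+ b *: v x + signed_sum s.
Proof. exact: big_cons. Qed.

Lemma signed_sum_flatten ss : signed_sum (flatten ss) = \sum_(s <- ss) signed_sum s.
Proof. by rewrite /signed_sum big_flatten. Qed.

Definition flip_signs (b : bool) (s : seq (bool * T)) := [seq (p.1 (+) b, p.2) | p <- s].

Lemma signed_sum_flip b s : signed_sum (flip_signs b s) = (-1) ^+ b *: signed_sum s.
Proof.
rewrite /signed_sum big_map scaler_sumr; apply: eq_bigr => p _.
by rewrite scalerA mulrC signr_addb.
Qed.

End SignedSums.

Section Cancellation.
Variables (R : realType) (V : lmodType R) (T : eqType) (v : T -> V).

Lemma signed_sum_perm s t : perm_eq s t -> signed_sum v s = signed_sum v t.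
Proof. exact: perm_big. Qed.

(** Deletes equal terms of opposite signs; m is fuel, since the recursion after a deletion is not
    structural in s. *)
Fixpoint cancel_terms (m : nat) (s : seq (bool * T)) :=
  if m is m'.+1 then
    if s is p :: s' then
      if (~~ p.1, p.2) \in s' then cancel_terms m' (rem (~~ p.1, p.2) s')
      else p :: cancel_terms m' s'
    else [::]
  else s.

Lemma signed_sum_cancel_terms m s : signed_sum v (cancel_terms m s) = signed_sum v s.
Proof.
elim: m s => [|m IH] [|[b x] s] //=; case: ifP => [ps|_]; rewrite ?signed_sum_cons IH //.
rewrite (signed_sum_perm (perm_to_rem ps)) signed_sum_cons addrA -scalerDl.
by case: b {ps}; rewrite ?expr0 ?expr1 ?addNr ?subrr scale0r add0r.
Qed.

End Cancellation.

(** * Wedge products of basis forms *)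

Section FormAlgebra.
Variables (R : realType) (n : nat).
Implicit Types (V : lmodType R) (S U : {set 'I_n}) (i : 'I_n).

Definition basis_form S : form n R^o := [ffun U => (U == S)%:R].

Lemma wedge_basis V S (w : form n V) U : wedge (basis_form S) w U =
  if S \subset U then shuffle_sign R S (U :\: S)%SET *: w (U :\: S)%SET else 0.
Proof.
rewrite ffunE; case: ifP => [SU|SU].
  rewrite (bigD1 S) //= ffunE eqxx mulr1 big1 ?addr0 // => S' /andP[_ S'S].
  by rewrite ffunE (negPf S'S) mulr0 scale0r.
rewrite big1 // => S' S'U; rewrite ffunE.
by case: eqP S'U SU => [-> ->|]; rewrite // mulr0 scale0r.
Qed.

Lemma dx_basis i : dx R i = basis_form [set i]%SET.
Proof. by []. Qed.

Lemma shuffle_sign1 i S : (forall j, j \in S -> (i <= j)%N) ->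
  shuffle_sign R [set i]%SET S = 1.
Proof.
move=> iS; rewrite /shuffle_sign (_ : [set _ | _]%SET = finset.set0) ?cards0 //.
apply/setP => p; rewrite !inE; case: eqP => //= ->.
by case: (boolP (_ \in S)) => //= /iS; rewrite ltnNge => ->.
Qed.

Lemma wedge_dx_basis i S : i \notin S -> (forall j, j \in S -> (i <= j)%N) ->
  wedge (dx R i) (basis_form S) = basis_form (i |: S)%SET.
Proof.
move=> iS iltS; apply/ffunP => U; rewrite dx_basis wedge_basis [in RHS]ffunE finset.sub1set.
case: (boolP (i \in U)) => iU; last first.
  by case: eqP iU => [->|//]; rewrite finset.setU11.
rewrite ffunE; case: (U =P i |: S)%SET => [->|US].
  by rewrite finset.setU1K // eqxx shuffle_sign1 //; exact: scale1r.
case: eqP => [E|_]; last exact: scaler0.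
by case: US; rewrite -E finset.setD1K.
Qed.

End FormAlgebra.

(** * Computable index sets and the operator defined by [Omega0] *)

Section NatSets.
Variable R : realType.

(** Index sets given by lists of numbers counted from 0, on which complements, differences and signs
    can be computed. *)
Definition nset (s : seq nat) : {set 'I_8} := [set i : 'I_8 | (i : nat) \in s]%SET.

Lemma dx4E i j k l : (i < j < k)%N -> (k < l < 8)%N ->
  dx4 R i.+1 j.+1 k.+1 l.+1 = basis_form R (nset [:: i; j; k; l]).
Proof.
move=> /andP[ij jk] /andP[kl l8].
have k8 := ltn_trans kl l8; have j8 := ltn_trans jk k8; have i8 := ltn_trans ij j8.
have jl := ltn_trans jk kl; have ik := ltn_trans ij jk; have il := ltn_trans ij jl.
have val m : (m < 8)%N -> (inord m : 'I_8) = m :> nat by move=> ?; rewrite inordK.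
have neq a b : (a < b)%N -> (b < 8)%N -> (inord a == inord b :> 'I_8) = false.
  by move=> ab b8; rewrite -val_eqE /= !val ?(ltn_trans ab) // ltn_eqF.
rewrite /dx4 /= (dx_basis R (inord l)).
rewrite wedge_dx_basis => [|//|]; first last.
- by move=> a; rewrite inE => /eqP ->; rewrite !val // ltnW.
- by rewrite inE neq.
rewrite wedge_dx_basis => [|//|]; first last.
- by move=> a; rewrite !inE => /orP[] /eqP ->; rewrite !val // ltnW.
- by rewrite !inE !neq.
rewrite wedge_dx_basis => [|//|]; first last.
- by move=> a; rewrite !inE => /or3P[] /eqP ->; rewrite !val // ltnW.
- by rewrite !inE !neq.
congr basis_form; apply/setP => a; rewrite !inE -!val_eqE /= !val //.
Qed.

(** The fourteen terms of [Omega0], with indices lowered by 1. *)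
Definition Omega_terms : seq (bool * seq nat) :=
  [:: (false, [:: 0; 1; 2; 3]); (false, [:: 0; 1; 4; 5]); (false, [:: 0; 1; 6; 7]);
      (false, [:: 0; 2; 4; 6]); (true, [:: 0; 2; 5; 7]); (true, [:: 0; 3; 4; 7]);
      (true, [:: 0; 3; 5; 6]); (true, [:: 1; 2; 4; 7]); (true, [:: 1; 2; 5; 6]);
      (true, [:: 1; 3; 4; 6]); (false, [:: 1; 3; 5; 7]); (false, [:: 2; 3; 4; 5]);
      (false, [:: 2; 3; 6; 7]); (false, [:: 4; 5; 6; 7])]%N.

Lemma Omega0E : Omega0 R = signed_sum (fun s => basis_form R (nset s)) Omega_terms.
Proof.
rewrite /Omega0 !dx4E // /signed_sum !big_cons big_nil /=.
by rewrite addr0 !expr0 !expr1 !scale1r !scaleN1r !addrA.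
Qed.

Lemma wedge_signed_sum (V : lmodType R) n (T : eqType) (F : T -> form n R^o) s
    (w : form n V) U :
  wedge (signed_sum F s) w U = signed_sum (fun x => wedge (F x) w U) s.
Proof.
rewrite ffunE /signed_sum; under [RHS]eq_bigr do rewrite ffunE scaler_sumr.
rewrite exchange_big; apply: eq_bigr => S _ /=.
rewrite sum_ffunE mulr_sumr scaler_suml; apply: eq_bigr => p _.
by rewrite ffunE scalerA; congr (_ *: _); exact: mulrCA.
Qed.

Definition compl8 (s : seq nat) := [seq i <- iota 0 8 | i \notin s].

Definition inverted (s t : seq nat) (i j : nat) : nat :=
  [&& i \in s, j \in t & (j < i)%N].

Definition inversions (s t : seq nat) : nat :=
  sumn (map (fun i : nat => sumn (map (inverted s t i) (iota 0 8))) (iota 0 8)).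

Lemma setC_nset s : (~: nset s)%SET = nset (compl8 s).
Proof.
by apply/setP => i; rewrite !inE mem_filter mem_iota /= ltn_ord andbT.
Qed.

Lemma setD_nset s t : (nset s :\: nset t)%SET = nset [seq i <- s | i \notin t].
Proof. by apply/setP => i; rewrite !inE mem_filter. Qed.

Lemma subset_nset s t : all (gtn 8) s -> (nset s \subset nset t) = all (mem t) s.
Proof.
move=> /allP s8; apply/fintype.subsetP/allP => [st i si|st i].
  by have := st (Ordinal (s8 i si)); rewrite !inE; apply.
by rewrite !inE => /st.
Qed.

Lemma shuffle_sign_nset s t : shuffle_sign R (nset s) (nset t) = (-1) ^+ odd (inversions s t).
Proof.
rewrite signr_odd /shuffle_sign; congr (_ ^+ _).
have sumE (F : nat -> nat) : sumn (map F (iota 0 8)) = (\sum_(i < 8) F i)%N.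
  by rewrite sumnE big_map -(big_mkord xpredT).
rewrite /inversions sumE -sum1_card (eq_bigl (fun p : 'I_8 * 'I_8 =>
  [&& (p.1 : nat) \in s, (p.2 : nat) \in t & (p.2 < p.1)%N])) => [|p]; last by rewrite !inE.
under [RHS]eq_bigr do rewrite sumE; rewrite pair_big /= big_mkcond; apply: eq_bigr => p _.
by rewrite /inverted; case: [&& _, _ & _].
Qed.

(* [star_terms s] lists the signed pairs occurring in the coefficient of [dx_s]
   in [hodge (wedge Omega0 w)]. *)
Definition star_terms (s : seq nat) : seq (bool * seq nat) :=
  let c := compl8 s in
  [seq (o.1 (+) odd (inversions o.2 [seq i <- c | i \notin o.2]) (+) odd (inversions c s),
        [seq i <- c | i \notin o.2]) | o <- Omega_terms & all (mem c) o.2].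

Lemma hodge_wedge_Omega0 (V : lmodType R) (w : form 8 V) s :
  hodge (wedge (Omega0 R) w) (nset s) = signed_sum (fun t => w (nset t)) (star_terms s).
Proof.
rewrite ffunE setC_nset shuffle_sign_nset Omega0E wedge_signed_sum /signed_sum.
rewrite /star_terms [RHS]big_map [RHS]big_filter [RHS]big_mkcond scaler_sumr.
rewrite big_seq [RHS]big_seq; apply: eq_bigr => o oO.
have o8 : all (gtn 8) o.2.
  by move: o oO; apply/allP; vm_compute.
rewrite wedge_basis subset_nset //; case: ifP => _; last by rewrite !scaler0.
rewrite setD_nset shuffle_sign_nset !scalerA.
by rewrite -mulrA mulrC -!signr_addb.
Qed.

(** Each term of [Omega0] takes four of the indices outside S, so it leaves a 2-set exactly when S
    has two elements. *)
Lemma hodge_wedge_Omega0_homogeneous (V : lmodType R) (w : form 8 V) :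
  homogeneous 2 w -> homogeneous 2 (hodge (wedge (Omega0 R) w)).
Proof.
move=> w2 S S2; rewrite ffunE Omega0E wedge_signed_sum /signed_sum big_seq big1 ?scaler0 // => o oO.
rewrite wedge_basis; case: ifP => [oS|_]; last exact: scaler0.
rewrite w2 ?scaler0 //.
have o8 : uniq o.2 && all (gtn 8) o.2 && (size o.2 == 4)%N.
  by move: o oO {oS}; apply/allP; vm_compute.
have oE : (#|nset o.2| = 4)%N.
  move/andP: o8 => [/andP[ou o8] /eqP o4]; apply: etrans o4.
  rewrite -(size_map (fun i => inord i : 'I_8)).
  have /card_uniqP <- : uniq (map (fun i => inord i : 'I_8) o.2).
    rewrite map_inj_in_uniq // => i j /(allP o8) i8 /(allP o8) j8 /(congr1 val).
    by rewrite /= !inordK.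
  apply: eq_card => i; rewrite !inE; apply/idP/mapP => [io|[j jo ->]].
    by exists (i : nat) => //; apply: val_inj; rewrite /= inordK.
  by rewrite inordK //; exact: (allP o8).
have := cardsC S; rewrite card_ord cardsD (finset.setIidPr oS) oE => SC.
apply: contra S2 => /eqP E; apply/eqP.
have : (#|nset o.2| <= #|(~: S)%SET|)%N by exact: subset_leq_card.
by move: SC E; rewrite oE; lia.
Qed.

End NatSets.

(** * An orthogonal basis of Lambda^2_7 and its projection *)

Section Lambda27Basis.
Variable R : realType.

(* The pairs [{j, k}] of indices in [0, ..., 7] fall into seven blocks of four
   disjoint pairs, according to [j xor k = m]; up to the signs recorded here,
   [w |-> hodge (wedge Omega0 w)] sends [dx_q] to the sum of the [dx_p] for the
   other pairs [p] of the block of [q]. *)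
Definition block (m : nat) : seq (bool * seq nat) :=
  (false, [:: 0; m]%N) :: star_terms [:: 0; m]%N.

(** On a block of four pairs the operator is, up to signs, the all-ones matrix minus the identity,
    and this form is its eigenvector for 3. The seven of them form an orthogonal basis of
    Lambda^2_7, each of squared norm 4. *)
Definition two_form (m : nat) : form 8 R^o :=
  signed_sum (fun s => basis_form R (nset s)) (block m).

Lemma nset_eq s t : all (gtn 8) s -> all (gtn 8) t ->
  (nset s == nset t) = all (mem t) s && all (mem s) t.
Proof. by move=> s8 t8; rewrite finset.eqEsubset !subset_nset. Qed.

(** Operator plus identity is the all-ones matrix up to signs, so every pair q of the block sees, up
    to its own sign, the same signed total. *)
Lemma block_star (V : lmodType R) (w : form 8 V) m q : m \in iota 1 7 -> q \in block m ->
  (-1) ^+ q.1 *: (hodge (wedge (Omega0 R) w) (nset q.2) + w (nset q.2)) =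
  signed_sum (fun s => w (nset s)) (block m).
Proof.
move=> m7 qm; have /signed_sum_perm -> :
    perm_eq (block m) (rcons (flip_signs q.1 (star_terms q.2)) q).
  move: q qm; apply/allP; move: m m7; apply/allP; by vm_compute.
rewrite -cats1 signed_sum_cat signed_sum_flip /signed_sum big_seq1 scalerDr.
by rewrite hodge_wedge_Omega0.
Qed.

Lemma block_lt8 m q : m \in iota 1 7 -> q \in block m -> all (gtn 8) q.2.
Proof.
move=> m7 qm; move: q qm; apply/allP; move: m m7; apply/allP; by vm_compute.
Qed.

Lemma block_nset_eq m m' p q : m \in iota 1 7 -> m' \in iota 1 7 ->
  p \in block m -> q \in block m' ->
  (nset p.2 == nset q.2) = (m == m') && (p == q).
Proof.
move=> m7 m7' pm qm; rewrite nset_eq ?(block_lt8 m7 pm) ?(block_lt8 m7' qm) //.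
apply/eqP; move: q qm; apply/allP; move: p pm; apply/allP; move: m' m7'; apply/allP.
by move: m m7; apply/allP; vm_compute.
Qed.

Lemma block_card m q : m \in iota 1 7 -> q \in block m -> #|nset q.2| = 2%N.
Proof.
move=> m7 qm.
have [j [k [jk k8 ->]]] : exists j k : nat, [/\ (j < k)%N, (k < 8)%N & q.2 = [:: j; k]].
  have : (fun l => if l is [:: j; k] then (j < k)%N && (k < 8)%N else false) q.2.
    move: q qm; apply/allP; move: m m7; apply/allP; by vm_compute.
  case: (q.2) => [|j [|k [|]]] //= /andP[jk k8].
  by exists j, k.
have j8 := ltn_trans jk k8.
have -> : nset [:: j; k] = [set Ordinal j8; Ordinal k8]%SET.
  by apply/setP => i; rewrite !inE.
by rewrite cards2 -val_eqE /= neq_ltn jk.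
Qed.

Lemma blockP (S : {set 'I_8}) : #|S| = 2%N ->
  exists m, m \in iota 1 7 /\ exists2 q, q \in block m & S = nset q.2.
Proof.
move/eqP/cards2P => [i [j [ij ->]]].
have [m m7 [q qm E]] : exists2 m, m \in iota 1 7 & exists2 q, q \in block m &
    all (mem q.2) [:: i : nat; j : nat] && all (mem [:: i : nat; j : nat]) q.2.
  have i8 : (i : nat) \in iota 0 8 by rewrite mem_iota ltn_ord.
  have j8 : (j : nat) \in iota 0 8 by rewrite mem_iota ltn_ord.
  have : ((i : nat) == j) || has (fun m => has (fun q : bool * seq nat =>
      all (mem q.2) [:: i : nat; j : nat] && all (mem [:: i : nat; j : nat]) q.2)
      (block m)) (iota 1 7).
    move: (i : nat) i8 (j : nat) j8 => a a8 b b8; move: b b8; apply/allP.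
    by move: a a8; apply/allP; vm_compute.
  rewrite val_eqE (negPf ij) orFb => /hasP[m m7] /hasP[q qm E].
  by exists m => //; exists q.
exists m; split=> //; exists q => //.
have <- : nset [:: i : nat; j : nat] = nset q.2.
  apply/eqP; rewrite nset_eq ?(block_lt8 m7 qm) //=.
  by rewrite !ltn_ord.
by apply/setP => k; rewrite !inE -!val_eqE.
Qed.

Lemma two_formE m m' q : m \in iota 1 7 -> m' \in iota 1 7 -> q \in block m' ->
  two_form m (nset q.2) = (m == m')%:R * (-1) ^+ q.1.
Proof.
move=> m7 m7' qm; rewrite /two_form /signed_sum sum_ffunE.
rewrite big_seq (eq_bigr (fun p => if (m == m') && (q == p) then (-1) ^+ p.1 else 0)); last first.
  move=> p pm; rewrite !ffunE (block_nset_eq m7' m7 qm pm) (eq_sym m').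
  by case: ifP => _; [exact: mulr1 | exact: mulr0].
rewrite -big_seq; case: (m =P m') => [->|_] /=; last by rewrite big1 // mul0r.
rewrite mul1r -big_mkcond -big_filter.
have -> : [seq p <- block m' | q == p] = [:: q].
  apply/eqP; move: q qm; apply/allP; move: m' m7'; apply/allP; by vm_compute.
by rewrite big_seq1.
Qed.

Lemma contract_basis (V : lmodType R) S (w : form 8 V) :
  contract (basis_form R S) w = w S.
Proof.
rewrite /contract (bigD1 S) //= ffunE eqxx big1 ?addr0 => [|U /negPf US].
  exact: scale1r.
by rewrite ffunE US; exact: scale0r.
Qed.

Lemma contract_signed_sum (V : lmodType R) (T : eqType) (F : T -> form 8 R^o) s
    (w : form 8 V) :
  contract (signed_sum F s) w = signed_sum (fun x => contract (F x) w) s.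
Proof.
rewrite /contract /signed_sum; under [RHS]eq_bigr do rewrite scaler_sumr.
rewrite exchange_big; apply: eq_bigr => S _ /=.
rewrite sum_ffunE scaler_suml; apply: eq_bigr => p _.
by rewrite ffunE scalerA.
Qed.

Lemma contract_two_form (V : lmodType R) m (w : form 8 V) :
  contract (two_form m) w = signed_sum (fun s => w (nset s)) (block m).
Proof.
rewrite contract_signed_sum; apply: eq_bigr => p _; by rewrite contract_basis.
Qed.

Lemma two_form_homogeneous m : m \in iota 1 7 -> homogeneous 2 (two_form m).
Proof.
move=> m7 S S2; rewrite /two_form /signed_sum sum_ffunE big_seq big1 // => p pm.
rewrite !ffunE; case: eqP => [E|_]; last exact: mulr0.
by move: S2; rewrite E (block_card m7 pm).
Qed.

Lemma form2P (V : lmodType R) (w w' : form 8 V) : homogeneous 2 w -> homogeneous 2 w' ->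
  (forall m q, m \in iota 1 7 -> q \in block m -> w (nset q.2) = w' (nset q.2)) ->
  w = w'.
Proof.
move=> w2 w'2 E; apply/ffunP => S; case: (#|S| =P 2%N) => [|/eqP S2].
  by move/blockP => [m [m7 [q qm ->]]]; exact: E qm.
by rewrite w2 // w'2.
Qed.

Lemma homogeneousZ (V : lmodType R) k c (w : form 8 V) :
  homogeneous k w -> homogeneous k (c *: w).
Proof. by move=> wk S Sk; rewrite ffunE wk // scaler0. Qed.

Lemma block_size m : m \in iota 1 7 -> size (block m) = 4%N.
Proof. by move=> m7; apply/eqP; move: m m7; apply/allP; vm_compute. Qed.

Lemma two_form_Lambda27 m : m \in iota 1 7 -> Lambda27 R^o (two_form m).
Proof.
move=> m7; have e2 := two_form_homogeneous m7; split => //.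
apply: form2P; [exact: hodge_wedge_Omega0_homogeneous | exact: homogeneousZ | ].
move=> m' q m7' qm; have := block_star (two_form m) m7' qm.
have -> : signed_sum (fun s => two_form m (nset s)) (block m') = 4 * (m == m')%:R.
  rewrite /signed_sum big_seq (eq_bigr (fun=> (m == m')%:R)) => [|p pm]; last first.
    rewrite (two_formE m7 m7' pm) [LHS]mulrCA -expr2 sqrr_sign; exact: mulr1.
  rewrite -big_seq big_const_seq count_predT block_size //= /iter /=.
  by move: (_%:R) => c; ring.
rewrite (two_formE m7 m7' qm) [(3 *: two_form m) _]ffunE (two_formE m7 m7' qm).
have solve (h c : R) (b : bool) : (-1) ^+ b * (h + c * (-1) ^+ b) = 4 * c ->
    h = 3 * (c * (-1) ^+ b) by case: b; rewrite ?expr0 ?expr1; lra.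
exact: solve.
Qed.

(** For the eigenvalue 3, four times each coefficient is up to sign the signed total of its block;
    so all coefficients of a block agree up to sign. *)
Lemma Lambda27E (V : lmodType R) (w : form 8 V) m q : Lambda27 V w ->
  m \in iota 1 7 -> q \in block m ->
  w (nset q.2) = (-1) ^+ q.1 *: w (nset [:: 0; m]%N).
Proof.
move=> [w2 w3] m7 qm.
have H p : p \in block m -> 4 *: ((-1) ^+ p.1 *: w (nset p.2)) =
    signed_sum (fun s => w (nset s)) (block m).
  move=> pm; rewrite -(block_star w m7 pm) w3 ffunE scalerA mulrC -scalerA.
  by congr (_ *: _); rewrite -[X in _ = _ + X]scale1r -scalerDl; congr (_ *: _); lra.
have four : (4 : R) != 0 by rewrite pnatr_eq0.
have /H : (false, [:: 0; m]%N) \in block m by exact: mem_head.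
rewrite -(H q qm) => /(scalerI four) /=; rewrite expr0 scale1r => ->.
by rewrite scalerA -expr2 sqrr_sign scale1r.
Qed.

Lemma Lambda27_contract (V : lmodType R) (w : form 8 V) m : Lambda27 V w ->
  m \in iota 1 7 ->
  signed_sum (fun s => w (nset s)) (block m) = 4 *: w (nset [:: 0; m]%N).
Proof.
move=> wL m7; rewrite /signed_sum big_seq (eq_bigr (fun=> w (nset [:: 0; m]%N))).
  rewrite -big_seq big_const_seq count_predT block_size //= /iter /=.
  move: (w _) => x; rewrite -[X in X + (X + (X + (X + 0)))]scale1r addr0 -!scalerDl.
  by congr (_ *: _); lra.
move=> q qm; rewrite (Lambda27E wL m7 qm) scalerA -expr2 sqrr_sign.
exact: scale1r.
Qed.

Lemma Lambda27_decomposition (eta : form 8 R^o) : Lambda27 R^o eta ->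
  eta = \sum_(m <- iota 1 7) eta (nset [:: 0; m]%N) *: two_form m.
Proof.
move=> eL; have [e2 _] := eL; apply: form2P => //.
  move=> S S2; rewrite sum_ffunE big_seq big1 // => m m7.
  by rewrite ffunE two_form_homogeneous // scaler0.
move=> m q m7 qm; rewrite (Lambda27E eL m7 qm) sum_ffunE.
rewrite (bigD1_seq m) ?iota_uniq //= big_seq_cond big1 => [|k /andP[k7 km]].
  rewrite addr0 ffunE (two_formE m7 m7 qm) eqxx mul1r; exact: mulrC.
by rewrite ffunE (two_formE k7 m7 qm) (negPf km) mul0r scaler0.
Qed.

Lemma contract_sum (V : lmodType R) I (r : seq I) (c : I -> R) (F : I -> form 8 R^o)
    (w : form 8 V) :
  contract (\sum_(i <- r) c i *: F i) w = \sum_(i <- r) c i *: contract (F i) w.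
Proof.
rewrite /contract; under [RHS]eq_bigr do rewrite scaler_sumr.
rewrite exchange_big; apply: eq_bigr => S _ /=.
rewrite sum_ffunE scaler_suml; apply: eq_bigr => p _.
by rewrite ffunE scalerA.
Qed.

(** The projection is determined by its pairings with the seven basis forms, and w in Lambda^2_7
    pairs with [two_form m] to 4 times its coefficient of dx_(0m). *)
Lemma pi27_eq (V : lmodType R) (w b : form 8 V) : Lambda27 V w ->
  (forall m, m \in iota 1 7 ->
     signed_sum (fun s => b (nset s)) (block m) = 4 *: w (nset [:: 0; m]%N)) ->
  pi27 b = w.
Proof.
move=> wL H; have [p [_ pu]] := is_proj27_unique_exists b.
rewrite -(pu _ (pi27P b)); apply: pu; split=> // eta eL.
rewrite (Lambda27_decomposition eL) contract_sum big_seq big1 // => m m7.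
rewrite contract_two_form.
have -> : signed_sum (fun s => (b - w) (nset s)) (block m) =
  signed_sum (fun s => b (nset s)) (block m) - signed_sum (fun s => w (nset s)) (block m).
  rewrite /signed_sum -sumrB; apply: eq_bigr => q _; rewrite -scalerBr.
  by rewrite [(b - w) _]ffunE [(- w) _]ffunE.
by rewrite H // Lambda27_contract // subrr scaler0.
Qed.

Lemma pi27_eq0 (V : lmodType R) (b : form 8 V) m : pi27 b = 0 -> m \in iota 1 7 ->
  signed_sum (fun s => b (nset s)) (block m) = 0.
Proof.
move=> b0 m7; have [_] := pi27P b; rewrite b0 subr0 => /(_ _ (two_form_Lambda27 m7)).
by rewrite contract_two_form.
Qed.

End Lambda27Basis.

(** * Formal second-order identities, checked by computation *)

Section FormalIdentities.

Local Open Scope nat_scope.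

Definition hd1 (s : seq nat) := nth 0 s 0.
Definition hd2 (s : seq nat) := nth 0 s 1.

(* With [u = \sum_m u_m two_form m], the term [(b, (j, m))] stands for
   [(-1)^b d_j u_m] in the [k]-th component [\sum_i d_i u_ik] of a 1-form. *)
Definition codiff_terms (k : nat) : seq (bool * (nat * nat)) :=
  flatten [seq flatten [seq
    (if hd2 q.2 == k then [:: (q.1, (hd1 q.2, m))] else [::]) ++
    (if hd1 q.2 == k then [:: (~~ q.1, (hd2 q.2, m))] else [::])
    | q <- block m] | m <- iota 1 7].

Definition prepend_index (i : nat) (s : seq (bool * (nat * nat))) :=
  [seq (p.1, (i, p.2.1, p.2.2)) | p <- s].

(** The pairing of [two_form m] with d of the 1-form whose components are given by
    [codiff_terms]. *)
Definition dcodiff_terms (m : nat) : seq (bool * (nat * nat * nat)) :=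
  flatten [seq flip_signs q.1 (prepend_index (hd1 q.2) (codiff_terms (hd2 q.2))) ++
               flip_signs (~~ q.1) (prepend_index (hd2 q.2) (codiff_terms (hd1 q.2)))
          | q <- block m].

(* [(b, (i, j, l))] stands for [(-1)^b d_i d_j a_l]. *)
Definition d_terms (i m : nat) : seq (bool * (nat * nat * nat)) :=
  flatten [seq [:: (q.1, (i, hd1 q.2, hd2 q.2)); (~~ q.1, (i, hd2 q.2, hd1 q.2))]
          | q <- block m].

(** This is [codiff_terms] with u_m the pairing of da with [two_form m], that is, applied to the
    2-form 4 pi27 (da). *)
Definition codiff_d_terms (k : nat) : seq (bool * (nat * nat * nat)) :=
  flatten [seq flatten [seq
    (if hd2 q.2 == k then flip_signs q.1 (d_terms (hd1 q.2) m) else [::]) ++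
    (if hd1 q.2 == k then flip_signs (~~ q.1) (d_terms (hd2 q.2) m) else [::])
    | q <- block m] | m <- iota 1 7].

(** Normal form of a term under the symmetry of second partials. *)
Definition sort_partials (p : bool * (nat * nat * nat)) :=
  (p.1, (minn p.2.1.1 p.2.1.2, maxn p.2.1.1 p.2.1.2, p.2.2)).

(** Mixed second partials and components other than u_m cancel, leaving the Laplacian of u_m. The
    fuel 100 exceeds the 56 terms. *)
Lemma dcodiff_termsP m : m \in iota 1 7 ->
  perm_eq (cancel_terms 100 (map sort_partials (dcodiff_terms m)))
          [seq (false, (i, i, m)) | i <- iota 0 8].
Proof. by move: m; apply/allP; vm_compute. Qed.

(** On 2-forms 4 pi27 is the identity plus w |-> hodge (wedge Omega0 w); up to sign, the
    codifferential of the second part of 4 pi27 (da) is the Hodge dual of d (Omega0 /\ da) = 0. What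
    remains is the sum over i of d_i d_i a_k - d_k d_i a_i. The fuel 200 exceeds the 72 terms. *)
Lemma codiff_d_termsP k : k \in iota 0 8 ->
  cancel_terms 200 (map sort_partials (codiff_d_terms k) ++
    map sort_partials (flatten [seq [:: (true, (i, i, k)); (false, (k, i, i))] | i <- iota 0 8])) = [::].
Proof. by move=> k8; apply/eqP; move: k k8; apply/allP; vm_compute. Qed.

Section SymmetricPartials.
Local Open Scope ring_scope.
Variables (R : realType) (V : lmodType R) (Q : nat -> nat -> nat -> V).
Hypothesis Qsym : forall i j l, Q i j l = Q j i l.

Let val3 (t : nat * nat * nat) := Q t.1.1 t.1.2 t.2.

Lemma signed_sum_sort_partials s :
  signed_sum val3 (map sort_partials s) = signed_sum val3 s.
Proof.
rewrite /signed_sum big_map; apply: eq_bigr => [[b [[i j] l]]] _ /=.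
congr (_ *: _); rewrite /val3 /=; case: (leqP i j) => ij //.
Qed.

Lemma signed_sum_dcodiff m : m \in iota 1 7 ->
  signed_sum val3 (dcodiff_terms m) = \sum_(i <- iota 0 8) Q i i m.
Proof.
move=> m7; rewrite -signed_sum_sort_partials -(signed_sum_cancel_terms _ 100).
rewrite (signed_sum_perm _ (dcodiff_termsP m7)) /signed_sum big_map.
by apply: eq_bigr => i _ /=; rewrite scale1r.
Qed.

Lemma signed_sum_codiff_d :
  (forall i m, m \in iota 1 7 -> signed_sum val3 (d_terms i m) = 0) ->
  forall k, k \in iota 0 8 -> \sum_(i <- iota 0 8) Q i i k = \sum_(i <- iota 0 8) Q k i i.
Proof.
move=> Q0 k k8.
have : signed_sum val3 (codiff_d_terms k) = 0.
  rewrite signed_sum_flatten big_map big_seq big1 // => m m7.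
  rewrite signed_sum_flatten big_map big1 // => q _; rewrite signed_sum_cat.
  by do 2!case: ifP => _; rewrite ?signed_sum_flip ?Q0 // ?scaler0 /signed_sum ?big_nil addr0.
move=> E; have := signed_sum_cancel_terms val3 200 (map sort_partials (codiff_d_terms k) ++
    map sort_partials (flatten [seq [:: (true, (i, i, k)); (false, (k, i, i))] | i <- iota 0 8])).
rewrite codiff_d_termsP // signed_sum_cat !signed_sum_sort_partials E add0r.
rewrite signed_sum_flatten big_map /signed_sum big_nil => /esym.
under eq_bigr do rewrite !big_cons big_nil /= addr0 expr1 expr0 scaleN1r scale1r /val3 /=.
by rewrite big_split sumrN /= addrC => /eqP; rewrite subr_eq0 => /eqP.
Qed.

End SymmetricPartials.

End FormalIdentities.

(** * The exterior derivative on 0-forms and 1-forms *)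

Section Forms.
Variable R : realType.
Local Notation X := 'rV[R]_8.
Local Notation o k := (inord k : 'I_8).

Definition comp1 (V : lmodType R) (a : X -> form 8 V) (k : nat) : X -> V :=
  fun x => a x (nset [:: k]).

Lemma ext_dE (n : nat) (V : normedModType R) (w : 'rV[R]_n.+1 -> form n.+1 V) x U :
  ext_d w x U = \sum_(i in U) shuffle_sign R [set i]%SET (U :\ i)%SET *:
    partial i (fun y => w y (U :\ i)%SET) x.
Proof.
rewrite /ext_d sum_ffunE [RHS]big_mkcond; apply: eq_bigr => i _.
by rewrite dx_basis wedge_basis finset.sub1set; case: ifP => // _; rewrite ffunE.
Qed.

Lemma ext_d_homogeneous (n : nat) (V : normedModType R) (w : 'rV[R]_n.+1 -> form n.+1 V) k x :
  (forall y, homogeneous k (w y)) -> homogeneous k.+1 (ext_d w x).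
Proof.
move=> wk U Uk; rewrite ext_dE big1 // => i iU.
have -> : (fun y => w y (U :\ i)%SET) = fun=> 0.
  apply/funext => y; apply: wk; move: Uk; rewrite (cardsD1 i) iU.
  by apply: contra => /eqP ->.
by rewrite partial_cst scaler0.
Qed.

Lemma nset1 k : (k < 8)%N -> nset [:: k] = [set o k]%SET.
Proof. by move=> k8; apply/setP => i; rewrite !inE -val_eqE /= inordK. Qed.

Lemma ext_d_set1 (V : normedModType R) (f : X -> form 8 V) x k :
  ext_d f x [set k]%SET = partial k (fun y => f y finset.set0) x.
Proof.
rewrite ext_dE big_set1 finset.setDv shuffle_sign1 ?scale1r // => j.
by rewrite inE.
Qed.

Lemma ext_d_pair (V : normedModType R) (a : X -> form 8 V) x j k :
  (j < k)%N -> (k < 8)%N -> ext_d a x (nset [:: j; k]) =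
  partial (o j) (comp1 a k) x - partial (o k) (comp1 a j) x.
Proof.
move=> jk k8; have j8 := ltn_trans jk k8.
have jko : o j != o k by rewrite -val_eqE /= !inordK // ltn_eqF.
have E : nset [:: j; k] = [set o j; o k]%SET.
  by apply/setP => i; rewrite !inE -!val_eqE /= !inordK.
have D1 : (nset [:: j; k] :\ o j = nset [:: k])%SET.
  by rewrite E finset.setU1K ?inE // nset1.
have D2 : (nset [:: j; k] :\ o k = nset [:: j])%SET.
  by rewrite E finset.setUC finset.setU1K ?inE 1?eq_sym // nset1.
rewrite ext_dE (big_setD1 (o j)) /=; last by rewrite E !inE eqxx.
rewrite D1 [in X in _ + X]nset1 // big_set1 D2 -!nset1 // !shuffle_sign_nset.
have : odd (inversions [:: k] [:: j]) && ~~ odd (inversions [:: j] [:: k]).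
  have : (j < k)%N ==> (odd (inversions [:: k] [:: j]) && ~~ odd (inversions [:: j] [:: k])).
    have : k \in iota 0 8 by rewrite mem_iota.
    have : j \in iota 0 8 by rewrite mem_iota.
    move=> jI; move: k {jk k8 jko E D1 D2}; apply/allP; move: j jI {j8}; apply/allP; by vm_compute.
  by rewrite jk.
by move=> /andP[-> /negPf ->]; rewrite scale1r expr1 scaleN1r.
Qed.

Lemma blockE m q : m \in iota 1 7 -> q \in block m ->
  [/\ (hd1 q.2 < hd2 q.2)%N, (hd2 q.2 < 8)%N & q.2 = [:: hd1 q.2; hd2 q.2]].
Proof.
move=> m7 qm.
have /and3P[h1 h2 /eqP h3] :
    [&& hd1 q.2 < hd2 q.2, hd2 q.2 < 8 & q.2 == [:: hd1 q.2; hd2 q.2]]%N.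
  by move: q qm; apply/allP; move: m m7; apply/allP; vm_compute.
by [].
Qed.

Lemma signed_sum_ext_d (V : normedModType R) (a : X -> form 8 V) x m :
  m \in iota 1 7 -> signed_sum (fun s => ext_d a x (nset s)) (block m) =
  \sum_(q <- block m) (-1) ^+ q.1 *: (partial (o (hd1 q.2)) (comp1 a (hd2 q.2)) x -
     partial (o (hd2 q.2)) (comp1 a (hd1 q.2)) x).
Proof.
move=> m7; rewrite /signed_sum big_seq [RHS]big_seq; apply: eq_bigr => q qm.
have [h1 h2 E] := blockE m7 qm.
by rewrite [in nset _]E ext_d_pair.
Qed.

Lemma mx_partialC p q (f : X -> 'M[R]_(p, q)) i j : smooth f ->
  partial i (partial j f) = partial j (partial i f).
Proof.
move=> fs; apply/funext => x; apply/matrixP => a b.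
have fab : smooth (fun y => f y a b) by move/mx_smoothP: fs; apply.
have E k : (fun y => partial k f y a b) = partial k (fun y => f y a b).
  by apply/funext => y; rewrite partial_mx //; exact: smooth_derivable.
have E2 k l : partial k (partial l f) x a b = partial k (partial l (fun y => f y a b)) x.
  by rewrite -E (partial_mx a b (smooth_derivable (smooth_partial l fs))).
exact: etrans (E2 i j) (etrans (congr1 (@^~ x) (partialC i j fab)) (esym (E2 j i))).
Qed.

End Forms.

(** * The Laplacian expressed through d and [pi27] *)

Section WeitzenboeckIdentities.
Variables (R : realType) (p q : nat).
Local Notation X := 'rV[R]_8.
Local Notation M := 'M[R]_(p, q).
Local Notation o k := (inord k : 'I_8).

Definition one_form (c : nat -> X -> M) : X -> form 8 M :=
  fun x => [ffun S => \sum_(k <- iota 0 8) (S == nset [:: k])%:R *: c k x].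

Lemma nset1_inj j k : (j < 8)%N -> (k < 8)%N -> (nset [:: j] == nset [:: k]) = (j == k).
Proof.
move=> j8 k8; rewrite !nset1 //; apply/eqP/eqP => [|-> //].
by move/finset.set1_inj/(congr1 val); rewrite /= !inordK.
Qed.

Lemma comp1_one_form c k : (k < 8)%N -> comp1 (one_form c) k = c k.
Proof.
move=> k8; apply/funext => x; rewrite /comp1 ffunE (bigD1_seq k) ?iota_uniq ?mem_iota //.
rewrite eqxx scale1r big1_seq => [|j /andP[jk]]; first exact: addr0.
by rewrite mem_iota => /= j8; rewrite nset1_inj // eq_sym (negPf jk) scale0r.
Qed.

Lemma one_form_homogeneous c x : homogeneous 1 (one_form c x).
Proof.
move=> S S1; rewrite ffunE big_seq big1 // => k; rewrite mem_iota => /= k8.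
case: (S =P nset [:: k]) => [E|_]; last exact: scale0r.
by move: S1; rewrite E nset1 // cards1.
Qed.

Lemma one_form_smooth c : (forall k, smooth (c k)) -> smooth_form (one_form c).
Proof.
move=> cs S; under eq_fun do rewrite ffunE.
by apply: smooth_sum => k; exact: smoothZ.
Qed.

Lemma signed_sum_smooth (T : Type) (F : T -> X -> M) s :
  (forall t, smooth (F t)) -> smooth (fun x => signed_sum (fun t => F t x) s).
Proof. by move=> Fs; apply: smooth_sum => t; exact: smoothZ. Qed.

Lemma partial_signed_sum (T : Type) (F : T -> X -> M) s i :
  (forall t, smooth (F t)) -> partial i (fun x => signed_sum (fun t => F t x) s) =
  (fun x => signed_sum (fun t => partial i (F t) x) s).
Proof.
move=> Fs; rewrite /signed_sum partial_sum; last by move=> t; exact: smoothZ.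
by apply/funext => x; apply: eq_bigr => t _; rewrite (partialZ _ _ (Fs _)).
Qed.

Definition codiff (u : nat -> X -> M) (k : nat) : X -> M :=
  fun x => signed_sum (fun jm => partial (o jm.1) (u jm.2) x) (codiff_terms k).

Lemma codiff_smooth u k : (forall m, smooth (u m)) -> smooth (codiff u k).
Proof. by move=> us; apply: signed_sum_smooth => t; exact: smooth_partial. Qed.

(** The formal expansion is evaluated at Q i j l = d_i d_j u_l, symmetric in i and j by Schwarz's
    theorem. *)
Lemma block_ext_d_codiff u m x : (forall m, smooth (u m)) -> m \in iota 1 7 ->
  signed_sum (fun s => ext_d (one_form (codiff u)) x (nset s)) (block m) =
  \sum_(i <- iota 0 8) partial (o i) (partial (o i) (u m)) x.
Proof.
move=> us m7; pose Q i j l := partial (o i) (partial (o j) (u l)) x.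
have Qsym i j l : Q i j l = Q j i l.
  exact: (congr1 (@^~ x) (mx_partialC (o i) (o j) (us l))).
rewrite -[RHS](signed_sum_dcodiff Qsym m7) signed_sum_ext_d //.
rewrite /dcodiff_terms signed_sum_flatten big_map big_seq [RHS]big_seq.
apply: eq_bigr => r rm; have [h1 h2 _] := blockE m7 rm.
have D i k : partial (o i) (codiff u k) x =
    signed_sum (fun t => Q t.1.1 t.1.2 t.2) (prepend_index i (codiff_terms k)).
  rewrite /codiff partial_signed_sum; last by move=> t; exact: smooth_partial.
  by rewrite /signed_sum big_map; apply: eq_bigr => t _.
rewrite signed_sum_cat !signed_sum_flip -!D !comp1_one_form //; last exact: ltn_trans h2.
by rewrite scalerBr signrN scaleNr.
Qed.

Lemma signed_sum_pair (V : lmodType R) (T : Type) (v : T -> V) b t t' :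
  signed_sum v [:: (b, t); (~~ b, t')] = (-1) ^+ b *: (v t + -1 *: v t').
Proof.
rewrite /signed_sum !big_cons big_nil /= addr0 signrN scalerDr scalerA mulrN1.
by [].
Qed.

(** The hypothesis makes the seven pairings of da with the basis forms vanish identically. Their
    derivatives, inserted in the formal identity, show that the codifferential of da is zero, which
    is the equality. *)
Lemma codifferential_ext_d_eq0 (a : X -> form 8 M) : smooth_form a ->
  (forall x, pi27 (ext_d a x) = 0) -> forall k x, (k < 8)%N ->
  \sum_(i <- iota 0 8) partial (o i) (partial (o i) (comp1 a k)) x =
  \sum_(i <- iota 0 8) partial (o k) (partial (o i) (comp1 a i)) x.
Proof.
move=> as_ a0 k x k8.
have As l : smooth (comp1 a l) by exact: as_.
pose Q i j l := partial (o i) (partial (o j) (comp1 a l)) x.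
have Qsym i j l : Q i j l = Q j i l.
  exact: (congr1 (@^~ x) (mx_partialC (o i) (o j) (As l))).
apply: (signed_sum_codiff_d Qsym); last by rewrite mem_iota.
move=> i m m7.
pose F (r : bool * seq nat) y := partial (o (hd1 r.2)) (comp1 a (hd2 r.2)) y -
     partial (o (hd2 r.2)) (comp1 a (hd1 r.2)) y.
have Fs r : smooth (F r).
  rewrite /F; under eq_fun do rewrite -scaleN1r.
  by apply: smoothD; [|apply: smoothZ]; exact: smooth_partial.
have E : (fun y => \sum_(r <- block m) (-1) ^+ r.1 *: F r y) = fun=> 0.
  by apply/funext => y; rewrite -signed_sum_ext_d // pi27_eq0.
have := congr1 (fun f => partial (o i) f x) E; rewrite partial_cst.
rewrite partial_sum => [<-|r]; last exact: smoothZ.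
rewrite /d_terms signed_sum_flatten big_map; apply: eq_bigr => r _.
rewrite (partialZ _ _ (Fs r)) /F.
under [in RHS]eq_fun do rewrite -scaleN1r.
have S1 := smooth_partial (o (hd1 r.2)) (As (hd2 r.2)).
have S2 := smooth_partial (o (hd2 r.2)) (As (hd1 r.2)).
rewrite (partialD _ S1 (smoothZ (-1) S2)) (partialZ _ _ S2).
exact: signed_sum_pair.
Qed.

End WeitzenboeckIdentities.

(** * The holonomy group of the torus *)

Section SkewCommutant.
Variable R : realType.

(** The minimal polynomial divides (X - 1) (X + 1), which has simple roots. *)
Lemma involution_diagonalizable n (A : 'M[R]_n.+1) : A *m A = 1%:M ->
  exists2 P : 'M[R]_n.+1, P \in unitmx & similar_diag P A.
Proof.
move=> AA; apply/diagonalizableP; exists [:: 1; -1] => /=.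
  by rewrite inE andbT -subr_eq0 opprK -mulr2n pnatr_eq0.
rewrite dvd_mxminpoly !big_cons big_nil mulr1 rmorphM !rmorphB /= horner_mx_X !horner_mx_C.
have AA1 : A * A = 1 by [].
have -> : (-1)%:M = - 1 :> 'M[R]_n.+1 by rewrite raddfN.
by rewrite -idmxE opprK mulrDr !mulrBl AA1 !mulr1 mul1r addrA subrK subrr.
Qed.

Fixpoint bit_seqs (n : nat) : seq (seq bool) :=
  if n is n'.+1 then [seq b :: s | b <- [:: true; false], s <- bit_seqs n'] else [:: [::]].

Lemma mem_bit_seqs s : s \in bit_seqs (size s).
Proof.
elim: s => [|b s IH] //; rewrite -[bit_seqs _]/(allpairs cons [:: true; false] (bit_seqs (size s))).
by apply/allpairsP; exists (b, s); split => //; case: b.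
Qed.

(** The patterns of eigenvalues, true for -1, that group elements could have if the characters i and
    j agreed; at most 4 of them, against 8 group elements. *)
Definition even_patterns (a i j : nat) := [seq s <- bit_seqs 5 |
  [&& ~~ nth false s a, nth false s i == nth false s j & ~~ odd (count id s)]].

Lemma size_even_patterns (a i j : 'I_5) : i != j -> (size (even_patterns a i j) <= 4)%N.
Proof.
move=> ij; have : ((i : nat) == j) || (size (even_patterns a i j) <= 4)%N.
  have check : all (fun i => all (fun j => all (fun a =>
      (i == j) || (size (even_patterns a i j) <= 4)%N) (iota 0 5)) (iota 0 5)) (iota 0 5).
    by vm_compute.
  have mem (k : 'I_5) : (k : nat) \in iota 0 5 by rewrite mem_iota ltn_ord.
  exact: (allP (allP (allP check _ (mem i)) _ (mem j)) _ (mem a)).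
by rewrite val_eqE (negPf ij).
Qed.

Lemma Z2cube_square (phi : 'Z_2 * 'Z_2 * 'Z_2 -> 'M[R]_5) :
  {morph phi : u u' / u + u' >-> u *m u'} -> (forall u, SO (phi u)) ->
  forall u, phi u *m phi u = 1%:M.
Proof.
move=> phiD phiSO u.
have phi0 : phi 0 = 1%:M.
  have [orth _] := phiSO 0; have := phiD 0 0; rewrite addr0 => E.
  by rewrite -[RHS]orth {2}E -mulmxA orth mulmx1.
rewrite -phiD -phi0; congr phi; case: u => [[a b] c].
have Z2 (x : 'Z_2) : x + x = 0 by apply: val_inj; case: x => [[|[|]]].
by rewrite -[LHS]/(a + a, b + b, c + c) !Z2.
Qed.

(* In a common eigenbasis the group consists of all sign patterns with an even
   number of [-1]'s and a [+1] at the fixed vector: its characters on [R^5] are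
   pairwise distinct, so that a commuting matrix is diagonal in this basis. *)
Lemma skew_commutant (phi : 'Z_2 * 'Z_2 * 'Z_2 -> 'M[R]_5) (v : 'cV[R]_5) (Y : 'M[R]_5) :
  injective phi -> {morph phi : u u' / u + u' >-> u *m u'} ->
  (forall u, SO (phi u)) -> v != 0 -> (forall u, phi u *m v = v) ->
  (forall u, phi u *m Y = Y *m phi u) -> Y^T = - Y -> Y = 0.
Proof.
move=> phi_inj phiD phiSO v0 phiv phiY YT.
have phi2 := Z2cube_square phiD phiSO.
have phiC u u' : phi u *m phi u' = phi u' *m phi u by rewrite -!phiD addrC.
have [P Pu Pdiag] : exists2 P : 'M[R]_5, P \in unitmx & forall u, similar_diag P (phi u).
  have [|P Pu /allP h] := (codiagonalizableP (map phi (enum {: 'Z_2 * 'Z_2 * 'Z_2}))).1.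
    split=> [A B /mapP[u _ ->] /mapP[u' _ ->]|A /mapP[u _ ->]]; first exact: phiC.
    exact: involution_diagonalizable.
  by exists P => // u; apply: h; rewrite map_f // mem_enum.
have /choice[s sE] : forall u, exists d : 'rV[R]_5, P *m phi u = diag_mx d *m P.
  move=> u; have /(similar_diagLR Pu)[d E] := Pdiag u; exists d.
  by rewrite E conjVmx // !mulmxA mulmxV // mul1mx.
have s2 u i : s u 0 i ^+ 2 = 1.
  have : diag_mx (s u) *m diag_mx (s u) = 1%:M.
    apply: (can_inj (mulmxK Pu)); rewrite -mulmxA -sE mulmxA -sE -mulmxA phi2 mulmx1 mul1mx //.
  by move/matrixP/(_ i i); rewrite mul_diag_mx !mxE eqxx expr2.
pose b u i := s u 0 i == -1.
have sb u i : s u 0 i = (-1) ^+ b u i.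
  rewrite /b; have /eqP := s2 u i; rewrite sqrf_eq1 => /orP[] /eqP ->.
    by rewrite -subr_eq0 opprK -mulr2n pnatr_eq0.
  by rewrite eqxx.
have sdet u : \prod_i s u 0 i = 1.
  have [_ d1] := phiSO u; rewrite -det_diag -[RHS]d1.
  have := congr1 determinant (sE u); rewrite !det_mulmx mulrC.
  by move/(mulIf _) => <- //; rewrite -unitfE.
(* Coordinates of the fixed vector in the eigenbasis: where one of them is nonzero, every group
   element has eigenvalue +1. *)
pose w := P *m v.
have w0 : w != 0.
  by apply: contra v0 => /eqP w0; rewrite -(mulKmx Pu v) -/w w0 mulmx0.
have [a wa] : exists a, w a 0 != 0.
  apply/existsP; apply: contraR w0; rewrite negb_exists => /forallP h.
  by apply/eqP/colP => i; rewrite [RHS]mxE; apply/eqP; have := h i; rewrite negbK.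
have ba u : b u a = false.
  have : diag_mx (s u) *m w = w by rewrite /w mulmxA -sE -mulmxA phiv.
  move/matrixP/(_ a 0); rewrite mul_diag_mx mxE -[RHS]mul1r => /(mulIf wa).
  by rewrite /b => ->; rewrite -subr_eq0 opprK -mulr2n pnatr_eq0.
have b_inj u u' : (forall i, b u i = b u' i) -> u = u'.
  move=> h; apply: phi_inj; apply: (can_inj (mulKmx Pu)); rewrite !sE; congr (_ *m _).
  by congr diag_mx; apply/rowP => i; rewrite !sb h.
(* If the characters i and j coincided, the 8 group elements would inject into the at most 4
   patterns of [even_patterns a i j]. *)
have distinct i j : i != j -> exists u, s u 0 i != s u 0 j.
  move=> ij; apply: contrapT => none.
  have bij u : b u i = b u j.
    have [//|h] := eqVneq (b u i) (b u j); exfalso; apply: none; exists u.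
    by apply: contraNneq h => e; rewrite /b e.
  pose pat u := [seq b u i | i <- enum 'I_5].
  have nth_pat u (k : 'I_5) : nth false (pat u) k = b u k.
    by rewrite (nth_map k) ?size_enum_ord // nth_ord_enum.
  have pat_inj : injective pat.
    by move=> u u' E; apply: b_inj => k; rewrite -!nth_pat E.
  have := size_even_patterns a ij; rewrite leqNgt => /negP; apply.
  apply: (@leq_trans (size (map pat (enum {: 'Z_2 * 'Z_2 * 'Z_2})))).
    by rewrite size_map -cardE !card_prod !card_ord.
  apply: uniq_leq_size; first by rewrite map_inj_uniq // enum_uniq.
  move=> _ /mapP[u _ ->]; rewrite mem_filter !nth_pat ba bij eqxx /=; apply/andP; split.
    have := sdet u; under eq_bigr do rewrite sb.
    rewrite prodrXr -signr_odd.
    have -> : (\sum_(k < 5) b u k = count id (pat u))%N.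
      by rewrite count_map -sum1_count [RHS]big_mkcond [RHS]big_enum /=; apply: eq_bigr => k _; case: (b u k).
    by case: odd => // /eqP; rewrite expr1 -subr_eq0 -opprD oppr_eq0 -mulr2n pnatr_eq0.
  by have := mem_bit_seqs (pat u); rewrite size_map size_enum_ord.
(* Z commutes with the diagonal sign matrices, so its entry (i, j) vanishes as soon as some group
   element separates i and j. *)
pose Z := P *m Y *m invmx P.
have Zdiag i j : i != j -> Z i j = 0.
  move=> ij; have [u sij] := distinct i j ij.
  have : diag_mx (s u) *m Z = Z *m diag_mx (s u).
    rewrite /Z !mulmxA -sE -(mulmxA P) phiY !mulmxA -(mulmxA _ (invmx P)).
    apply: (can_inj (mulmxK Pu)); rewrite -!mulmxA mulVmx // mulmx1 -sE.
    by rewrite (mulmxA (invmx P)) mulVmx // mul1mx.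
  move/matrixP/(_ i j); rewrite mul_diag_mx mul_mx_diag !mxE => /eqP.
  rewrite mulrC -subr_eq0 -mulrBr mulf_eq0 subr_eq0 (negPf sij) orbF.
  by move/eqP.
(* P need not be orthogonal, so skewness is used through the trace of Y^2, which is invariant under
   conjugation: a sum of squares for the diagonal Z, minus a sum of squares for the skew Y. *)
have trYY : \tr (Y *m Y) = \sum_i Z i i ^+ 2.
  transitivity (\tr (Z *m Z)).
    rewrite /Z -!mulmxA (mulmxA (invmx P)) mulVmx // mul1mx [RHS]mxtrace_mulC.
    by rewrite -!mulmxA mulVmx // mulmx1.
  apply: eq_bigr => i _; rewrite mxE (bigD1 i) //= big1 ?addr0 ?expr2 // => j ji.
  by rewrite Zdiag ?mul0r // eq_sym.
have trYYT : \tr (Y *m Y) = - \sum_i \sum_j Y i j ^+ 2.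
  rewrite -sumrN; apply: eq_bigr => i _; rewrite mxE -sumrN; apply: eq_bigr => j _.
  by have /matrixP/(_ i j) := YT; rewrite !mxE => ->; rewrite mulrN expr2.
have Y0 : \sum_i \sum_j Y i j ^+ 2 = 0.
  apply/eqP; rewrite eq_le; apply/andP; split.
    by rewrite -oppr_ge0 -trYYT trYY; apply: sumr_ge0 => i _; exact: sqr_ge0.
  by do 2![apply: sumr_ge0 => ? _]; exact: sqr_ge0.
apply/matrixP => i j; rewrite mxE; apply/eqP; rewrite -sqrf_eq0.
have rowge k : 0 <= \sum_l Y k l ^+ 2 by apply: sumr_ge0 => ? _; exact: sqr_ge0.
have : \sum_l Y i l ^+ 2 <= \sum_k \sum_l Y k l ^+ 2.
  by rewrite [leRHS](bigD1 i) //= lerDl sumr_ge0.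
rewrite Y0 (bigD1 j) //= => h.
rewrite eq_le sqr_ge0 andbT; apply: le_trans h; rewrite lerDl sumr_ge0 // => ? _.
exact: sqr_ge0.
Qed.

Lemma SO_subgroup m : is_subgroup (@mulmx R m m m) 1%:M (@SO R m).
Proof.
have SO_tr (A : 'M[R]_m) : SO A -> A^T *m A = 1%:M by move=> [/mulmx1C].
split.
- by split; [rewrite trmx1 mulmx1 | exact: det1].
- move=> A B [AA dA] [BB dB]; split; last by rewrite det_mulmx dA dB mulr1.
  by rewrite trmx_mul mulmxA -(mulmxA A) BB mulmx1.
move=> A As; have [AA dA] := As; exists A^T; split; [split|done|exact: SO_tr].
  by rewrite trmxK SO_tr.
by rewrite det_tr.
Qed.

Lemma tau_pi1orb i : pi1orb R (@tau R i).
Proof. by apply: sub_gen_smallest; right; exists i. Qed.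

Lemma translation_image_commute rho (Y : 'M[R]_5) : representation rho ->
  (forall i, rho (@tau R i) *m Y = Y *m rho (@tau R i)) ->
  forall A, translation_image rho A -> SO A /\ A *m Y = Y *m A.
Proof.
move=> [rhoSO _] rhoY A.
case: (SO_subgroup 5) => SO1 SOm SOi.
pose C : set 'M[R]_5 := [set A | SO A /\ A *m Y = Y *m A].
apply: (@smallest_sub _ _ _ C); last first.
  by move=> _ [i _ <-]; split => //; apply: rhoSO; exact: tau_pi1orb.
split.
- by split => //; rewrite mul1mx mulmx1.
- move=> B D [BSO BY] [DSO DY]; split; first exact: SOm.
  by rewrite -mulmxA DY mulmxA BY mulmxA.
move=> B [BSO BY]; have [D [DSO BD DB]] := SOi B BSO; exists D; split => //; split => //.
rewrite -[LHS]mulmx1 -BD -(mulmxA D) (mulmxA Y) -BY -(mulmxA B) (mulmxA D) DB.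
by rewrite mul1mx.
Qed.

Lemma rho_tau_square rho i : representation rho -> is_Z2xZ2xZ2 (translation_image rho) ->
  rho (@tau R i) *m rho (@tau R i) = 1%:M.
Proof.
move=> rho_rep [phi [_ phiD phi_im]].
have imP : translation_image rho (rho (@tau R i)) by apply: sub_gen_smallest; exists i.
have phiSO u : SO (phi u).
  have : translation_image rho (phi u) by rewrite -phi_im; exists u.
  move=> /(translation_image_commute (Y := 0) rho_rep)[] // j.
  by rewrite mulmx0 mul0mx.
by move: imP; rewrite -phi_im => -[u _ <-]; exact: Z2cube_square phiD phiSO u.
Qed.

Lemma commutant_translations rho (Y : 'M[R]_5) : representation rho ->
  is_Z2xZ2xZ2 (translation_image rho) ->
  (exists L : {vspace 'cV[R]_5}, \dim L = 1%N /\
     forall A v, translation_image rho A -> v \in L -> A *m v = v) ->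
  Y^T = - Y -> (forall i, rho (@tau R i) *m Y = Y *m rho (@tau R i)) -> Y = 0.
Proof.
move=> rho_rep [phi [phi_inj phiD phi_im]] [L [L1 Lfix]] YT rhoY.
have H := translation_image_commute rho_rep rhoY.
have imP u : translation_image rho (phi u) by rewrite -phi_im; exists u.
have v0 : vpick L != 0 by rewrite vpick0 -dimv_eq0 L1.
apply: (skew_commutant phi_inj phiD _ v0) => // u.
- by have [] := H _ (imP u).
- by apply: Lfix => //; exact: memv_pick.
- by have [] := H _ (imP u).
Qed.

End SkewCommutant.

(** * Sections over the orbifold *)

Section Pullback.
Variables (R : realType) (n : nat).
Local Notation X := 'rV[R]_n.+1.
Local Notation e i := (delta_mx 0 i : X).

Lemma form1_basis : form1 R n.+1 = basis_form R finset.set0.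
Proof. by []. Qed.

Lemma wedgeZZ (V : lmodType R) c d (a : form n.+1 R^o) (w : form n.+1 V) :
  wedge (c *: a) (d *: w) = (c * d) *: wedge a w.
Proof.
apply/ffunP => U; rewrite [in RHS]ffunE !ffunE scaler_sumr; apply: eq_bigr => S _.
rewrite !ffunE !scalerA; congr (_ *: _).
by rewrite -[c *: _]/(c * _); ring.
Qed.

Lemma big_wedge_dx (c : 'I_n.+1 -> R) (l : seq 'I_n.+1) :
  sorted (fun i j : 'I_n.+1 => (i < j)%N) l ->
  \big[@wedge R n.+1 R^o/form1 R n.+1]_(t <- l) (c t *: dx R t) =
  (\prod_(t <- l) c t) *: basis_form R [set j in l]%SET.
Proof.
elim: l => [|i l IH] il.
  rewrite !big_nil scale1r form1_basis.
  by have -> : [set j in [::]]%SET = finset.set0 :> {set 'I_n.+1} by apply/setP => j; rewrite !inE.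
have lti : all (fun j : 'I_n.+1 => i < j)%N l.
  by apply: order_path_min il => a b d; exact: ltn_trans.
rewrite !big_cons IH ?(path_sorted il) // wedgeZZ wedge_dx_basis.
- by congr (_ *: basis_form _ _); apply/setP => j; rewrite !inE.
- by rewrite inE; apply/negP => /(allP lti); rewrite ltnn.
by move=> j; rewrite inE => /(allP lti); exact: ltnW.
Qed.

Lemma sorted_enum_ord (T : {set 'I_n.+1}) :
  sorted (fun i j : 'I_n.+1 => (i < j)%N) (enum T).
Proof.
have -> : enum T = [seq i <- enum 'I_n.+1 | i \in T].
  by rewrite enumT; apply: eq_filter.
apply: sorted_filter => [a b d|]; first exact: ltn_trans.
by have := iota_ltn_sorted 0 n.+1; rewrite -val_enum_ord sorted_map.
Qed.

Lemma differential_signed_affine s g (t : 'I_n.+1) x : signed_affine s g ->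
  differential (fun y => g y 0 t) x = (-1) ^+ s t *: dx R t.
Proof.
move=> gs; rewrite /differential (bigD1 t) //= big1 ?addr0 => [|i it].
  congr (_ *: _); apply: (derive_of_taylor (C := 0) _).2 => h.
  by rewrite gs !mxE !eqxx /= mul0r (_ : _ - _ = 0) ?normr0 //; ring.
rewrite (_ : partial i _ x = 0) ?scale0r //.
apply: (derive_of_taylor (C := 0) _).2 => h.
by rewrite gs !mxE [t == i]eq_sym (negPf it) andbF /= mul0r (_ : _ - _ = 0) ?normr0 //; ring.
Qed.

(** The coordinate t of g has differential (-1)^(s t) dx_t, so the pullback is diagonal on the dx_T
    and only the summand T = U survives. *)
Lemma pullback_signed_affine (V : normedModType R) s g
    (w : X -> form n.+1 V) x U : signed_affine s g ->
  pullback g w x U = (\prod_(t in U) (-1) ^+ s t) *: w (g x) U.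
Proof.
move=> gs.
have bigE (T : {set 'I_n.+1}) : \big[@wedge R n.+1 R^o/form1 R n.+1]_(t <- enum T)
    differential (fun y => g y 0 t) x = (\prod_(t in T) (-1) ^+ s t) *: basis_form R T.
  rewrite (eq_bigr (fun t => (-1) ^+ s t *: dx R t)) => [|t _]; last first.
    exact: differential_signed_affine.
  rewrite big_wedge_dx ?sorted_enum_ord // big_enum /=; congr (_ *: basis_form _ _).
  by apply/setP => j; rewrite inE mem_enum.
rewrite ffunE (bigD1 U) //= big1 ?addr0 => [|T TU]; rewrite bigE !ffunE.
  by rewrite eqxx -[_ *: 1%R]/(_ * 1) mulr1.
by rewrite eq_sym (negPf TU) -[_ *: 0%R]/(_ * 0) mulr0 scale0r.
Qed.

Definition diagonal_affine (s : 'I_n.+1 -> bool) (c : X) (x : X) : X :=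
  \row_i ((-1) ^+ s i * x 0 i + c 0 i).

Lemma diagonal_affine_signed s c : signed_affine s (diagonal_affine s c).
Proof.
move=> x j t; apply/rowP => i; rewrite !mxE eqxx /=.
by case: eqP => [->|_]; rewrite ?mulr1 ?mulr0 ?addr0 // mulrDr addrAC.
Qed.

Lemma diagonal_affine_subgroup :
  is_subgroup (fun g h : X -> X => g \o h) id
    [set g | exists s c, g = diagonal_affine s c].
Proof.
split.
- exists (fun=> false), 0; apply/funext => x; apply/rowP => i.
  by rewrite !mxE mul1r addr0.
- move=> _ _ [s [c ->]] [s' [c' ->]].
  exists (fun i => s i (+) s' i), (\row_i ((-1) ^+ s i * c' 0 i + c 0 i)).
  by apply/funext => x; apply/rowP => i; rewrite !mxE signr_addb mulrDr mulrA addrA.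
move=> _ [s [c ->]]; exists (diagonal_affine s (\row_i (- ((-1) ^+ s i * c 0 i)))).
split; first by exists s, (\row_i (- ((-1) ^+ s i * c 0 i))).
  apply/funext => x; apply/rowP => i; rewrite !mxE mulrDr mulrA mulrN mulrA.
  by rewrite -expr2 sqrr_sign !mul1r subrK.
apply/funext => x; apply/rowP => i; rewrite !mxE mulrDr mulrA.
by rewrite -expr2 sqrr_sign !mul1r addrK.
Qed.

End Pullback.

Section OrbifoldGroupElements.
Variable R : realType.

(** The affine maps with diagonal linear part of entries +1 and -1 form a group containing all
    generators. *)
Lemma pi1orb_signed_affine g : pi1orb R g -> exists s, signed_affine s g.
Proof.
suff H : pi1orb R `<=` [set g | exists s c, g = diagonal_affine s c].
  by move=> /H [s [c ->]]; exists s; exact: diagonal_affine_signed.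
apply: smallest_sub; first exact: diagonal_affine_subgroup.
move=> _ [[[[->|->]|->]|->]|[i _ <-]].
- exists (fun i => i.+1 \in [:: 1; 2; 3; 4]%N), 0; apply/funext => x; apply/rowP => i.
  by rewrite !mxE addr0; case: ifP; rewrite ?expr1 ?expr0 ?mulN1r ?mul1r.
- exists (fun i => i.+1 \in [:: 5; 6; 7; 8]%N), 0; apply/funext => x; apply/rowP => i.
  by rewrite !mxE addr0; case: ifP; rewrite ?expr1 ?expr0 ?mulN1r ?mul1r.
- exists (fun i => i.+1 \in [:: 1; 2; 5; 6]%N),
    (\row_i if i.+1 \in [:: 1; 2; 5; 6]%N then 2^-1 else 0).
  apply/funext => x; apply/rowP => i; rewrite !mxE.
  by case: ifP; rewrite ?expr1 ?expr0 ?mulN1r ?mul1r ?addr0 // addrC.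
- exists (fun i => (i.+1 == 1%N) || (i.+1 \in [:: 3; 5; 7]%N)),
    (\row_i if i.+1 \in [:: 3; 5; 7]%N then 2^-1 else 0).
  apply/funext => x; apply/rowP => i; rewrite !mxE.
  case: (eqVneq i.+1 1%N) => [->|_] /=; first by rewrite expr1 mulN1r addr0.
  by case: ifP; rewrite ?expr1 ?expr0 ?mulN1r ?mul1r ?addr0 // addrC.
exists (fun=> false), (delta_mx 0 i); apply/funext => x; apply/rowP => j.
by rewrite !mxE mul1r.
Qed.

Lemma tau_signed_affine i : signed_affine (fun=> false) (@tau R i).
Proof. by move=> x j t; rewrite /tau mul1r addrAC. Qed.

End OrbifoldGroupElements.

(** * The Green operator and averages for matrix-valued functions *)

Section MatrixGreen.
Variables (R : realType) (n m : nat).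
Local Notation X := 'rV[R]_n.+1.
Local Notation M := 'M[R]_m.
Local Notation e i := (delta_mx 0 i : X).
Implicit Types (f : X -> M).

Definition mx_balanced f := forall a b, balanced (fun x => f x a b).

Definition mx_green f : X -> M := fun x => \matrix_(a, b) green_lim (fun y => f y a b) x.

Lemma mx_balanced_smooth f : mx_balanced f -> smooth f.
Proof. by move=> fb; apply/mx_smoothP => a b; exact: balanced_smooth. Qed.

Lemma mx_green_smooth f : mx_balanced f -> smooth (mx_green f).
Proof.
move=> fb; apply/mx_smoothP => a b.
under eq_fun do rewrite mxE; exact: balanced_green_smooth.
Qed.

Lemma partial_entry f j a b : smooth f ->
  (fun x => partial j f x a b) = partial j (fun x => f x a b).
Proof.
by move=> fs; apply/funext => x; rewrite partial_mx //; exact: smooth_derivable.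
Qed.

Lemma mx_balanced_partial f j : mx_balanced f -> mx_balanced (partial j f).
Proof.
move=> fb a b; rewrite partial_entry; last exact: mx_balanced_smooth.
exact: balanced_partial.
Qed.

Lemma mx_balanced_sum I (r : seq I) (F : I -> X -> M) :
  (forall i, mx_balanced (F i)) -> mx_balanced (fun x => \sum_(i <- r) F i x).
Proof.
move=> Fb a b; under eq_fun do rewrite summxE.
by apply: balanced_sum => i; exact: Fb.
Qed.

Lemma mx_green_partial f j : mx_balanced f ->
  partial j (mx_green f) = mx_green (partial j f).
Proof.
move=> fb; apply/funext => x; apply/matrixP => a b.
have gs := mx_green_smooth fb; have fs := mx_balanced_smooth fb.
have /(congr1 (@^~ x)) /= -> := partial_entry j a b gs.
rewrite [RHS]mxE (partial_entry j a b fs) -balanced_green_partial //.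
by congr (partial j _ x); apply/funext => y; rewrite mxE.
Qed.

Definition mx_laplacian f : X -> M := fun x => \sum_j partial j (partial j f) x.

Lemma mx_laplacian_entry f a b : smooth f ->
  (fun x => mx_laplacian f x a b) = laplacian (fun x => f x a b).
Proof.
move=> fs; apply/funext => x; rewrite /mx_laplacian summxE; apply: eq_bigr => j _.
have /(congr1 (@^~ x)) /= -> := partial_entry j a b (smooth_partial j fs).
by rewrite (partial_entry j a b fs).
Qed.

Lemma mx_laplacian_green f : mx_balanced f ->
  mx_laplacian (mx_green f) = (fun x => - (n.+1%:R *+ 2) *: f x).
Proof.
move=> fb; apply/funext => x; apply/matrixP => a b; rewrite [RHS]mxE.
have /(congr1 (@^~ x)) /= -> := mx_laplacian_entry a b (mx_green_smooth fb).
have -> : (fun y => mx_green f y a b) = green_lim (fun y => f y a b).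
  by apply/funext => y; rewrite mxE.
by rewrite laplacian_green.
Qed.

Lemma mx_green_laplacian f : mx_balanced f ->
  mx_green (mx_laplacian f) = (fun x => - (n.+1%:R *+ 2) *: f x).
Proof.
move=> fb; apply/funext => x; apply/matrixP => a b; rewrite [RHS]mxE [LHS]mxE.
rewrite (mx_laplacian_entry a b (mx_balanced_smooth fb)).
by rewrite balanced_green_laplacian.
Qed.

Lemma mx_green0 : mx_green (fun=> 0) = fun=> 0.
Proof.
apply/funext => x; apply/matrixP => a b; rewrite !mxE.
rewrite /green_lim; have -> : (fun N => green N (fun=> 0) x) = fun=> 0 :> R.
  apply/funext => N; have [s ->] := translation_op_green R n N.
  by rewrite big1 // => p _; rewrite mulr0.
exact: lim_cst.
Qed.

(** Conjugation is a combination of entries with constant coefficients, so linear operators acting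
    entrywise commute with it. *)
Lemma conj_entry (A F B : M) a b : (A *m F *m B) a b =
  \sum_(p : 'I_m * 'I_m) A a p.1 * B p.2 b * F p.1 p.2.
Proof.
rewrite mxE; under eq_bigr do rewrite mxE mulr_suml.
rewrite exchange_big pair_big; apply: eq_bigr => p _ /=; exact: mulrAC.
Qed.

Lemma mx_green_conj f (A B : M) c : mx_balanced f ->
  mx_green (fun y => c *: (A *m f y *m B)) = (fun x => c *: (A *m mx_green f x *m B)).
Proof.
move=> fb; apply/funext => x; apply/matrixP => a b; rewrite [LHS]mxE [RHS]mxE conj_entry mulr_sumr.
under [RHS]eq_bigr do rewrite mxE mulrA.
rewrite -balanced_green_lin => [|p]; last exact: fb.
congr (green_lim _ x); apply/funext => y; rewrite mxE conj_entry mulr_sumr.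
by apply: eq_bigr => p _; rewrite mulrA.
Qed.

Lemma mx_green_opp_tr f : mx_balanced f -> (forall x, (f x)^T = - f x) ->
  forall x, (mx_green f x)^T = - mx_green f x.
Proof.
move=> fb fT x; apply/matrixP => a b; rewrite !mxE.
have -> : (fun y => f y b a) = (fun y => \sum_(i <- [:: tt]) -1 * f y a b).
  by apply/funext => y; have /matrixP/(_ a b) := fT y; rewrite !mxE big_seq1 mulN1r.
by rewrite balanced_green_lin ?big_seq1 ?mulN1r.
Qed.

Lemma mx_green_signed_affine f s g x : signed_affine s g ->
  mx_green f (g x) = mx_green (f \o g) x.
Proof.
move=> gs; apply/matrixP => a b; rewrite !mxE.
exact: green_lim_signed_affine gs.
Qed.

Lemma partial_conj f (A B : M) c j : smooth f ->
  partial j (fun y => c *: (A *m f y *m B)) = (fun x => c *: (A *m partial j f x *m B)).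
Proof.
move=> fs; have fabs a b : smooth (fun y => f y a b) by move/mx_smoothP: fs; apply.
have E a b : (fun y => (c *: (A *m f y *m B)) a b) =
    (fun y => \sum_(p : 'I_m * 'I_m) (c * (A a p.1 * B p.2 b)) *: f y p.1 p.2).
  apply/funext => y; rewrite mxE conj_entry mulr_sumr; apply: eq_bigr => p _.
  by rewrite mulrA.
have hs : smooth (fun y => c *: (A *m f y *m B)).
  apply/mx_smoothP => a b; rewrite E; apply: smooth_sum => p; exact: smoothZ.
apply/funext => x; apply/matrixP => a b.
have /(congr1 (@^~ x)) /= -> := partial_entry j a b hs.
rewrite E partial_sum => [|p]; last exact: smoothZ.
rewrite mxE conj_entry mulr_sumr; apply: eq_bigr => p _.
rewrite (partialZ _ _ (fabs _ _)) -(partial_entry j _ _ fs).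
exact: esym (mulrA c _ _).
Qed.

Lemma partial_opp_tr f j : smooth f -> (forall x, (f x)^T = - f x) ->
  forall x, (partial j f x)^T = - partial j f x.
Proof.
move=> fs fT x; apply/matrixP => a b; rewrite !mxE.
have fabs : smooth (fun y => f y a b) by move/mx_smoothP: fs; apply.
have E c d := congr1 (@^~ x) (partial_entry j c d fs); rewrite /= in E.
rewrite !E.
have -> : (fun y => f y b a) = (fun y => -1 *: f y a b).
  by apply/funext => y; have /matrixP/(_ a b) := fT y; rewrite !mxE scaleN1r.
by rewrite (partialZ _ _ fabs) scaleN1r.
Qed.

Lemma average_entries (r : seq 'I_n.+1) f a b :
  (fun x => foldl (fun g i => average i g) f r x a b) =
  foldl (fun g i => average i (g : X -> R^o)) (fun x => f x a b) r.
Proof.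
elim: r f => [|i r IH] f //=; rewrite IH; congr foldl.
by apply/funext => x; rewrite /average !mxE.
Qed.

(** Averaging over e_j makes a function of period 2 e_j invariant under e_j, and further averages
    preserve this. *)
Lemma average_invariant (r : seq 'I_n.+1) f i :
  (forall j x, f (x + 2 *: e j) = f x) -> i \in r ->
  forall x, foldl (fun g i => average i g) f r (x + e i) =
            foldl (fun g i => average i g) f r x.
Proof.
have inv r' (g : X -> M) k : (forall x, g (x + e k) = g x) ->
    forall x, foldl (fun g i => average i g) g r' (x + e k) =
              foldl (fun g i => average i g) g r' x.
  elim: r' g => [|j r' IH] g gk //=; apply: IH => x.
  by rewrite /average addrAC !gk.
elim: r f => [|j r IH] f fp //=; rewrite inE; case: eqP => [-> _|_ /= ir].
  have e2 : e j + e j = 2 *: e j by rewrite scaler_nat mulr2n.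
  by apply: inv => x; rewrite /average -addrA e2 fp addrC.
by apply: IH => // k x; rewrite /average addrAC !fp.
Qed.

Lemma average_conj (r : seq 'I_n.+1) f (A : 'I_n.+1 -> M) :
  (forall i x, f (x + e i) = A i *m f x *m A i) ->
  forall i x, foldl (fun g i => average i g) f r (x + e i) =
     A i *m foldl (fun g i => average i g) f r x *m A i.
Proof.
elim: r f => [|j r IH] f fA //=; apply: IH => i x.
rewrite /average addrAC !fA -scalemxAr -scalemxAl; congr (_ *: _).
by rewrite mulmxDr mulmxDl.
Qed.

Lemma average_opp_tr (r : seq 'I_n.+1) f : (forall x, (f x)^T = - f x) ->
  forall x, (foldl (fun g i => average i g) f r x)^T =
    - foldl (fun g i => average i g) f r x.
Proof.
elim: r f => [|j r IH] f fT //=; apply: IH => x.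
by rewrite /average linearZ linearD /= !fT -opprD scalerN.
Qed.

End MatrixGreen.

(** * Vanishing of the three cohomology groups *)

Section AdSections.
Variable R : realType.
Local Notation X := 'rV[R]_8.
Local Notation M := 'M[R]_5.
Local Notation o k := (inord k : 'I_8).
Variable rho : (X -> X) -> M.
Hypothesis rho_rep : representation rho.
Hypothesis image_Z2 : is_Z2xZ2xZ2 (translation_image rho).
Hypothesis fixes_line : exists L : {vspace 'cV[R]_5}, \dim L = 1%N /\
       forall A v, translation_image rho A -> v \in L -> A *m v = v.

Let rho_tau2 i := rho_tau_square i rho_rep image_Z2.

Lemma invmx_rho_tau i : invmx (rho (@tau R i)) = rho (@tau R i).
Proof.
have [u _] := mulmx1_unit (rho_tau2 i).
by rewrite -[LHS]mulmx1 -(rho_tau2 i) mulKmx.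
Qed.

(* [c] is the sign by which [g] acts on the form component at hand. *)
Definition equivariant (c : R) (g : X -> X) (f : X -> M) :=
  forall x, c *: f (g x) = rho g *m f x *m invmx (rho g).

(** The average over all directions is skew and both invariant and equivariant under the
    translations, so it commutes with every rho(tau_i) and vanishes by [commutant_translations];
    only antiperiodic summands remain. *)
Lemma equivariant_mx_balanced f : smooth f -> (forall x, (f x)^T = - f x) ->
  (forall i, equivariant 1 (@tau R i) f) -> mx_balanced f.
Proof.
move=> fs fT fE.
have fA i x : f (x + delta_mx 0 i) = rho (@tau R i) *m f x *m rho (@tau R i).
  by have := fE i x; rewrite scale1r invmx_rho_tau.
have fp i x : f (x + 2 *: delta_mx 0 i) = f x.
  rewrite (_ : 2 *: _ = delta_mx 0 i + delta_mx 0 i) ?scaler_nat ?mulr2n // addrA !fA.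
  by rewrite !mulmxA rho_tau2 mul1mx -mulmxA rho_tau2 mulmx1.
have avg0 x : foldl (fun g i => average i g) f (enum 'I_8) x = 0.
  apply: (commutant_translations rho_rep image_Z2 fixes_line).
    exact: average_opp_tr.
  move=> i; have := average_conj (enum 'I_8) fA i x.
  rewrite average_invariant ?mem_enum // => {2}->.
  by rewrite -!mulmxA rho_tau2 mulmx1.
move=> a b; apply: (@balanced_of_average _ _ _ (enum 'I_8)).
- by move/mx_smoothP: fs; apply.
- by move=> j x; rewrite fp.
by move=> x; rewrite -average_entries avg0 mxE.
Qed.

(** The Green operator commutes with composition by g and with conjugation by the constant matrix
    rho(g). *)
Lemma equivariant_green c g s f : c * c = 1 -> signed_affine s g -> mx_balanced f ->
  equivariant c g f -> equivariant c g (mx_green f).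
Proof.
move=> cc gs fb fE x; rewrite (mx_green_signed_affine _ _ gs).
have -> : f \o g = fun y => c *: (rho g *m f y *m invmx (rho g)).
  by apply/funext => y; rewrite -fE scalerA cc scale1r.
by rewrite mx_green_conj // scalerA cc scale1r.
Qed.

Lemma equivariant_partial c g s f j : signed_affine s g -> smooth f ->
  equivariant c g f -> equivariant (c * (-1) ^+ s j) g (partial j f).
Proof.
move=> gs fs fE x.
have [fgd fgE] := partial_signed_affine gs (smooth_derivable (i := j) (x := g x) fs).
have E : (fun y => c *: (f \o g) y) = fun y => 1 *: (rho g *m f y *m invmx (rho g)).
  by apply/funext => y; rewrite scale1r -fE.
have := congr1 (fun F => partial j F x) E; rewrite partial_conj // scale1r => <-.
by rewrite -scalerA -fgE -(deriveZ _ fgd).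
Qed.

Lemma equivariant_scale c g d f : equivariant c g f -> equivariant c g (fun x => d *: f x).
Proof.
by move=> fE x; rewrite scalerA mulrC -scalerA fE -scalemxAr -scalemxAl.
Qed.

Lemma section_equivariant k w (S : {set 'I_8}) g s : Ad_section rho k w -> pi1orb R g ->
  signed_affine s g ->
  equivariant (\prod_(t in S) (-1) ^+ s t) g (fun x => w x S).
Proof. by move=> [_ _ _ wE] gG gs x; rewrite -wE // (pullback_signed_affine _ _ _ gs). Qed.

Lemma section_balanced k w S : Ad_section rho k w -> mx_balanced (fun x => w x S).
Proof.
move=> wS; have [ws _ wT _] := wS; apply: equivariant_mx_balanced => // i.
have := section_equivariant S wS (tau_pi1orb i) (tau_signed_affine i).
by rewrite big1.
Qed.

(** The orbifold group acts diagonally on the dx_S, so equivariance is tested component by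
    component, and only in degree k. *)
Lemma Ad_section_of_equivariant k w : smooth_form w -> (forall x, homogeneous k (w x)) ->
  (forall x S, (w x S)^T = - w x S) ->
  (forall g s (S : {set 'I_8}), pi1orb R g -> signed_affine s g -> #|S| = k ->
     equivariant (\prod_(t in S) (-1) ^+ s t) g (fun x => w x S)) ->
  Ad_section rho k w.
Proof.
move=> ws wk wT wE; split=> // g gG x S.
have [s gs] := pi1orb_signed_affine gG; rewrite (pullback_signed_affine _ _ _ gs).
have [Sk|/eqP Sk] := eqVneq #|S| k; first exact: wE.
by rewrite !wk ?scaler0 ?mulmx0 ?mul0mx //; apply/eqP.
Qed.

(** A closed 0-form has vanishing Laplacian, from which the Green operator recovers it up to the
    factor - 16. *)
Lemma irreducible : irreducible_connection rho.
Proof.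
move=> f [fS /= f0] x; apply/ffunP => S; rewrite [RHS]ffunE.
have [fs fh _ _] := fS.
case: (eqVneq S finset.set0) => [->|S0]; last by rewrite fh // cards_eq0.
pose phi y := f y finset.set0; have phib : mx_balanced phi by exact: section_balanced fS.
have dphi k : partial k phi = fun=> 0.
  apply/funext => y; rewrite /phi -ext_d_set1.
  by have /(congr1 (fun w : form 8 M => w [set k]%SET)) := f0 y; rewrite ffunE.
have : mx_laplacian phi = fun=> 0.
  apply/funext => y; rewrite /mx_laplacian big1 // => k _.
  by rewrite dphi partial_cst.
move/(congr1 (@mx_green _ _ _)); rewrite mx_green_laplacian // mx_green0.
move/(congr1 (@^~ x)) => /= /eqP; rewrite scaler_eq0 oppr_eq0 mulrn_eq0 pnatr_eq0 /=.
by move/eqP.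
Qed.

Lemma big_iota8 (V : zmodType) (F : 'I_8 -> V) :
  \sum_(i <- iota 0 8) F (o i) = \sum_i F i.
Proof.
by rewrite -[iota 0 8]/(index_iota 0 8) big_mkord; apply: eq_bigr => i _; rewrite inord_val.
Qed.

Lemma rigid : infinitesimally_rigid rho.
Proof.
move=> a [aS /= a0]; have [as_ ah aT _] := aS.
(* Minus the codifferential of a. The signs of g on d_i and on a_i cancel, so it is equivariant in
   degree 0. *)
pose dv x := \sum_(i <- iota 0 8) partial (o i) (comp1 a i) x.
have cb k : mx_balanced (comp1 a k) by exact: section_balanced aS.
have dvb : mx_balanced dv.
  by apply: mx_balanced_sum => i; exact: mx_balanced_partial.
have dvT x : (dv x)^T = - dv x.
  rewrite /dv raddf_sum -sumrN; apply: eq_bigr => i _ /=.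
  by apply: partial_opp_tr => [|y]; [exact: as_ | exact: aT].
have dvE g s : pi1orb R g -> signed_affine s g -> equivariant 1 g dv.
  move=> gG gs x; rewrite /dv scaler_sumr mulmx_sumr mulmx_suml.
  rewrite big_seq [RHS]big_seq; apply: eq_bigr => i; rewrite mem_iota /= => i8.
  have := equivariant_partial (o i) gs (as_ _) (section_equivariant (nset [:: i]) aS gG gs).
  rewrite nset1 // big_set1 -expr2 sqrr_sign => /(_ x).
  by rewrite -nset1.
(* The Green operator composed with the Laplacian is multiplication by minus twice the dimension
   8. *)
pose c : R := - 16.
have c0 : c != 0 by rewrite oppr_eq0 pnatr_eq0.
pose phi x := c^-1 *: mx_green dv x.
have phis : smooth phi by apply: smoothZ; exact: mx_green_smooth.
(* Since the codifferential of da vanishes, d_k of [dv] is the Laplacian of a_k, from which the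
   Green operator returns a_k. *)
have dphi k x : (k < 8)%N -> partial (o k) phi x = comp1 a k x.
  move=> k8; rewrite /phi partialZ; last exact: mx_green_smooth.
  rewrite mx_green_partial //; have -> : partial (o k) dv = mx_laplacian (comp1 a k).
    apply/funext => y; rewrite /dv partial_sum => [|i]; last by apply: smooth_partial; exact: as_.
    rewrite -(codifferential_ext_d_eq0 as_ a0 y k8) /mx_laplacian.
    exact: (big_iota8 (fun i => partial i (partial i (comp1 a k)) y)).
  rewrite mx_green_laplacian // scalerA (_ : _ * _ = 1) ?scale1r //.
  by rewrite (_ : - (8%:R *+ 2) = c) ?mulVf // /c -mulrnA.
exists (fun x => [ffun S => if S == finset.set0 then phi x else 0]).
  apply: Ad_section_of_equivariant.
  - move=> S; under eq_fun do rewrite ffunE.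
    by case: eqP => // _; exact: smooth_cst.
  - by move=> x S; rewrite cards_eq0 ffunE => /negPf ->.
  - move=> x S; rewrite ffunE; case: eqP => _; last by rewrite trmx0 oppr0.
    by rewrite /phi linearZ /= mx_green_opp_tr // scalerN.
  move=> g s S gG gs /eqP; rewrite cards_eq0 => /eqP ->; rewrite big_set0.
  have H := equivariant_scale c^-1 (equivariant_green (mulr1 _) gs dvb (dvE g s gG gs)).
  by move=> x; rewrite !ffunE eqxx; exact: H.
apply/funext => x; apply/ffunP => S.
have [/eqP/cards1P[k ->]|S1] := eqVneq #|S| 1%N; last first.
  rewrite ah // /D0 (ext_d_homogeneous (k := 0%N)) // => y T; rewrite cards_eq0 ffunE.
  by move/negPf ->.
rewrite /D0 ext_d_set1.
have -> : (fun y => ([ffun S => if S == finset.set0 then phi y else 0] : form 8 M) finset.set0) = phi.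
  by apply/funext => y; rewrite ffunE eqxx.
by have := dphi k x (ltn_ord k); rewrite /comp1 nset1 // inord_val.
Qed.

(** A term d_j u_m of the component k comes from the pair {j, k} of the block m; the sign by which g
    acts on u_m is read from this pair. *)
Lemma codiff_terms_block k t : k \in iota 0 8 -> t \in codiff_terms k ->
  t.2.2 \in iota 1 7 /\ exists2 q, q \in block t.2.2 &
    (hd1 q.2 = t.2.1 /\ hd2 q.2 = k) \/ (hd1 q.2 = k /\ hd2 q.2 = t.2.1).
Proof.
move=> k8 tk.
have /andP[t7 /hasP[q qt qE]] : (t.2.2 \in iota 1 7) && has (fun q : bool * seq nat =>
    ((hd1 q.2 == t.2.1) && (hd2 q.2 == k)) || ((hd1 q.2 == k) && (hd2 q.2 == t.2.1)))
    (block t.2.2).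
  by move: t tk; apply/allP; move: k k8; apply/allP; vm_compute.
split=> //; exists q => //.
by case/orP: qE => /andP[/eqP -> /eqP ->]; [left | right].
Qed.

Lemma unobstructed_theta : unobstructed rho.
Proof.
move=> w [wS /= wL]; have [ws wh wT _] := wS.
(* The Laplacian of u_m is then - 16 c W_m = 4 W_m, the multiple that [pi27_eq] requires. *)
pose c : R := - 4^-1.
pose W m x := w x (nset [:: 0; m]%N).
have Wb m : mx_balanced (W m) by exact: section_balanced wS.
pose u m x := c *: mx_green (W m) x.
have us m : smooth (u m) by apply: smoothZ; exact: mx_green_smooth.
have uT m x : (u m x)^T = - u m x.
  by rewrite /u linearZ /= mx_green_opp_tr ?scalerN // => y; exact: wT.
have ulap m x : \sum_(i <- iota 0 8) partial (o i) (partial (o i) (u m)) x = 4 *: W m x.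
  rewrite (big_iota8 (fun i => partial i (partial i (u m)) x)).
  have -> : \sum_i partial i (partial i (u m)) x = c *: mx_laplacian (mx_green (W m)) x.
    rewrite /mx_laplacian scaler_sumr; apply: eq_bigr => i _.
    rewrite /u partialZ; last exact: mx_green_smooth.
    rewrite partialZ //; apply: smooth_partial; exact: mx_green_smooth.
  rewrite mx_laplacian_green // scalerA; congr (_ *: _).
  by rewrite /c -mulrnA mulrNN; lra.
(* The coefficients of w on a block agree up to sign with W_m, so the sign of g on u_m can be read
   from any pair q of the block. *)
have uE g s m q : pi1orb R g -> signed_affine s g -> m \in iota 1 7 -> q \in block m ->
    equivariant ((-1) ^+ s (o (hd1 q.2)) * (-1) ^+ s (o (hd2 q.2))) g (u m).
  move=> gG gs m7 qm; set d := _ * _.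
  have dd : d * d = 1 by rewrite /d mulrACA -!expr2 !sqrr_sign mulr1.
  apply: equivariant_scale; apply: (equivariant_green dd gs (Wb m)).
  have [h12 h2 E] := blockE m7 qm; have h1 := ltn_trans h12 h2.
  have prodE : \prod_(t in nset q.2) (-1) ^+ s t = d.
    have -> : nset q.2 = [set o (hd1 q.2); o (hd2 q.2)]%SET.
      by rewrite {1}E; apply/setP => i; rewrite !inE -!val_eqE /= !inordK.
    rewrite big_setU1 ?big_set1 // inE -val_eqE /= !inordK //.
    by rewrite ltn_eqF.
  have := section_equivariant (nset q.2) wS gG gs; rewrite prodE.
  have Weq : (fun x => w x (nset q.2)) = fun x => (-1) ^+ q.1 *: W m x.
    by apply/funext => x; exact: Lambda27E (wL x) m7 qm.
  rewrite Weq => H.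
  suff -> : W m = fun x => (-1) ^+ q.1 *: ((-1) ^+ q.1 *: W m x).
    exact: equivariant_scale.
  by apply/funext => x; rewrite scalerA -expr2 sqrr_sign scale1r.
exists (one_form (codiff u)).
  apply: Ad_section_of_equivariant.
  - by apply: one_form_smooth => k; exact: codiff_smooth.
  - by move=> x; exact: one_form_homogeneous.
  - move=> x S; rewrite ffunE raddf_sum -sumrN; apply: eq_bigr => k _ /=.
    rewrite linearZ /= -scalerN; congr (_ *: _).
    rewrite /codiff /signed_sum raddf_sum -sumrN; apply: eq_bigr => t _ /=.
    by rewrite linearZ /= partial_opp_tr // scalerN.
  move=> g s S gG gs /eqP/cards1P[k ->]; rewrite big_set1.
  have k8 : (k : nat) \in iota 0 8 by rewrite mem_iota ltn_ord.
  have -> : (fun x => one_form (codiff u) x [set k]%SET) = codiff u k.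
    rewrite -(comp1_one_form (codiff u) (ltn_ord k)).
    by apply/funext => x; rewrite /comp1 nset1 // inord_val.
  move=> x; rewrite /codiff /signed_sum scaler_sumr mulmx_sumr mulmx_suml.
  rewrite big_seq [RHS]big_seq; apply: eq_bigr => t tk.
  have [t7 [q qt qE]] := codiff_terms_block k8 tk.
  have := equivariant_partial (o t.2.1) gs (us _) (uE g s _ q gG gs t7 qt).
  move/(equivariant_scale ((-1) ^+ t.1)) => /(_ x).
  (* The sign of the pair {j, k} times that of d_j is that of dx_k. *)
  suff -> : (-1) ^+ s (o (hd1 q.2)) * (-1) ^+ s (o (hd2 q.2)) * (-1) ^+ s (o t.2.1) =
    (-1) ^+ s k :> R by [].
  case: qE => [[-> ->]|[-> ->]]; rewrite inord_val.
    by rewrite mulrAC -expr2 sqrr_sign mul1r.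
  by rewrite -mulrA -expr2 sqrr_sign mulr1.
apply/funext => x; apply: pi27_eq => // m m7.
by rewrite block_ext_d_codiff.
Qed.

End AdSections.

Theorem proposition7p24 (R : realType)
    (rho : ('rV[R]_8 -> 'rV[R]_8) -> 'M[R]_5)
    (rho_rep : representation rho)
    (rho_alpha : rho (@alpha R) = 1%:M) (rho_beta : rho (@beta R) = 1%:M)
    (rho_comm : rho (@gamma R) *m rho (@delta R)
                = rho (@delta R) *m rho (@gamma R))
    (rho_nontrivial : rho (@gamma R) <> 1%:M \/ rho (@delta R) <> 1%:M)
    (image_Z2xZ2xZ2 : is_Z2xZ2xZ2 (translation_image rho))
    (image_fixes_line : exists L : {vspace 'cV[R]_5}, \dim L = 1%N /\
       forall A v, translation_image rho A -> v \in L -> A *m v = v) :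
  [/\ irreducible_connection rho, infinitesimally_rigid rho
    & unobstructed rho].
Proof.
split.
- exact: irreducible rho_rep image_Z2xZ2xZ2 image_fixes_line.
- exact: rigid rho_rep image_Z2xZ2xZ2 image_fixes_line.
- exact: unobstructed_theta rho_rep image_Z2xZ2xZ2 image_fixes_line.
Qed.
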